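(* Suppose that $w\in H_0^2(\Omega)\cap H^4(\Omega)$ with $\Omega\subset\mathbb{R}^2$. Then, for the interpolation operator $\Pi_h$ of the two-dimensional rectangular Morley element, $$(\nabla_h^2(w-\Pi_hw),\nabla_h^2\Pi_hw)_{L^2(\Omega)}\le\alpha_hh^2,$$ where $\lim_{h\to0}\alpha_h=0$.
   Context: $\nabla^2 w$ is the Hessian matrix of $w$; $\nabla_h^2$ is its piecewise counterpart, computed element by element. $\mathcal{T}_h$ is a regular uniform rectangular triangulation of $\Omega\subset\mathbb{R}^2$ with meshsize $h$: with $(x_{1,c},x_{2,c})$ the center of $K\in\mathcal{T}_h$, the map $\xi_i=(x_i-x_{i,c})/h$, $i=1,2$, sends $K$ onto $[-1,1]^2$ (so $K$ is a square of side $2h$). On $K$ let $P_T(K)=P_2(K)+\mathrm{span}\{x_1^3,x_2^3\}$, where $P_2(K)$ denotes the polynomials of degree $\le2$ on $K$. The interpolation operator $\Pi_K:H^3(K)\to P_T(K)$ is defined by $(\Pi_Kv)(P)=v(P)$ for each vertex $P$ of $K$ and $\int_F\frac{\partial\Pi_Kv}{\partial\nu_F}\,ds=\int_F\frac{\partial v}{\partial\nu_F}\,ds$ for each edge $F$ of $K$ ($\nu_F$ a unit normal to $F$). The global operator $\Pi_h$ is defined by $(\Pi_hw)|_K=\Pi_K(w|_K)$ for all $K\in\mathcal{T}_h$. The numbers $\alpha_h$ may depend on $w$. *)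

(* Defs.v *)
From HB Require Import structures.
From mathcomp Require Import all_boot all_order all_algebra finmap.
From mathcomp Require Import all_classical all_reals all_analysis.

Set Implicit Arguments.
Unset Strict Implicit.
Unset Printing Implicit Defensive.

Import Order.TTheory GRing.Theory Num.Theory.
Import numFieldNormedType.Exports.

Local Open Scope classical_set_scope.
Local Open Scope ring_scope.

Section Plane.
Variable R : realType.
Implicit Types (U K : set (R * R)) (v g p phi : R * R -> R) (c x : R * R).

Notation mu1 := (@lebesgue_measure R).
Notation mu2 := (mu1 \x mu1)%E.

Definition partial1 v : R * R -> R := 'D_((1, 0) : R * R) v.
Definition partial2 v : R * R -> R := 'D_((0, 1) : R * R) v.

Definition multi_index := (nat * nat)%type.

Definition pderiv (a : multi_index) v : R * R -> R :=
  iter a.1 partial1 (iter a.2 partial2 v).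

(** [Ck k v]: all partial derivatives of order at most [k], in any order of
    differentiation, exist and are continuous on the plane. *)
Fixpoint Ck (k : nat) v : Prop :=
  match k with
  | 0%N => continuous v
  | k'.+1 => [/\ continuous v,
                 (forall x, derivable v x (1, 0) /\ derivable v x (0, 1)),
                 Ck k' (partial1 v) & Ck k' (partial2 v)]
  end.

(** $C_c^\infty(U)$, the functions being extended by zero outside [U]. *)
Definition test_function U phi : Prop :=
  (forall k, Ck k phi) /\
  exists A : set (R * R), [/\ compact A, A `<=` U & forall x, ~ A x -> phi x = 0].

Definition loc_integrable U v : Prop :=
  forall A : set (R * R), compact A -> A `<=` U -> mu2.-integrable A (EFin \o v).

Definition is_weak_deriv U (a : multi_index) v g : Prop :=
  [/\ loc_integrable U v, loc_integrable U g &
   forall phi, test_function U phi ->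
     \int[mu2]_(x in U) (v x * pderiv a phi x) =
     (-1) ^+ (a.1 + a.2) * \int[mu2]_(x in U) (g x * phi x)].

(** A representative of the weak derivative (which is unique up to equality
    almost everywhere on [U]), and [0] if there is no weak derivative. *)
Definition wderiv U (a : multi_index) v : R * R -> R :=
  xget (fun=> 0) [set g | is_weak_deriv U a v g].

Definition L2 U v : Prop :=
  measurable_fun U v /\ mu2.-integrable U (fun x => (v x ^+ 2)%:E).

Definition in_Hk U (k : nat) v : Prop :=
  L2 U v /\
  forall a : multi_index, (a.1 + a.2 <= k)%N ->
    exists g, is_weak_deriv U a v g /\ L2 U g.

Definition Hk_sqnorm U (k : nat) v : \bar R :=
  (\sum_(i < k.+1) \sum_(j < k.+1 | (i + j <= k)%N)
     \int[mu2]_(x in U) ((wderiv U (nat_of_ord i, nat_of_ord j) v x) ^+ 2)%:E)%E.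

Definition in_Hk0 U (k : nat) v : Prop :=
  in_Hk U k v /\
  exists phi : nat -> R * R -> R,
    (forall n, test_function U (phi n)) /\
    Hk_sqnorm U k (v \- phi n) @[n --> \oo] --> 0%E.

(** An element of a mesh is given by its center [c] and its half side [h]. *)
Definition elt (h : R) c : set (R * R) :=
  `[c.1 - h, c.1 + h] `*` `[c.2 - h, c.2 + h].

Definition elt_vertex (h : R) c (b1 b2 : bool) : R * R :=
  (c.1 + (-1) ^+ b1 * h, c.2 + (-1) ^+ b2 * h).

Definition elt_vedge (h : R) c (b : bool) : set (R * R) :=
  [set c.1 + (-1) ^+ b * h] `*` `[c.2 - h, c.2 + h].
Definition elt_hedge (h : R) c (b : bool) : set (R * R) :=
  `[c.1 - h, c.1 + h] `*` [set c.2 + (-1) ^+ b * h].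

Definition is_vertex (h : R) c x : Prop := exists b1 b2, x = elt_vertex h c b1 b2.
Definition is_edge (h : R) c (F : set (R * R)) : Prop :=
  exists b, F = elt_vedge h c b \/ F = elt_hedge h c b.

(** [T] is the set of centers.  Taking the interior of the union of the closed
    elements says that [Omega] is open, that its closure is this union, and
    that [Omega] has no slit along the edges. *)
Definition square_mesh (Omega : set (R * R)) (h : R) (T : {fset (R * R)}) : Prop :=
  [/\ 0 < h,
      Omega = (\bigcup_(c in [set` T]) elt h c)° &
      forall c c', c \in T -> c' \in T -> c != c' ->
        [\/ elt h c `&` elt h c' = set0,
            exists x, [/\ is_vertex h c x, is_vertex h c' x &
                          elt h c `&` elt h c' = [set x]] |
            exists F, [/\ is_edge h c F, is_edge h c' F &
                          elt h c `&` elt h c' = F]]].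

(** The function equal to [F c] in the interior of each element.  Its value [0]
    on the edges is immaterial: the edges form a null set. *)
Definition piecewise (h : R) (T : {fset (R * R)}) (F : R * R -> R * R -> R)
    : R * R -> R :=
  fun x => \sum_(c <- T) ((F c) \_ (elt h c)°) x.

Definition P2 p : Prop :=
  exists a0 a1 a2 a11 a12 a22 : R, forall x,
    p x = a0 + a1 * x.1 + a2 * x.2 +
          a11 * x.1 ^+ 2 + a12 * (x.1 * x.2) + a22 * x.2 ^+ 2.

(** A polynomial on an element is identified with its extension to the plane. *)
Definition PT p : Prop :=
  exists q (b1 b2 : R), P2 q /\
    forall x, p x = q x + b1 * x.1 ^+ 3 + b2 * x.2 ^+ 3.

(** The continuous representative on the closed element [K] of a function of
    $H^2(K)\subset C(K)$; it gives the point values and the traces on the edges. *)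
Definition cont_repr K v : R * R -> R :=
  xget v [set u | {within K, continuous u} /\
                  {ae mu2, forall x, K x -> u x = v x}].

Definition vedge_integral (h : R) c (b : bool) v : R :=
  \int[mu1]_(t in `[c.2 - h, c.2 + h]) v (c.1 + (-1) ^+ b * h, t).
Definition hedge_integral (h : R) c (b : bool) v : R :=
  \int[mu1]_(t in `[c.1 - h, c.1 + h]) v (t, c.2 + (-1) ^+ b * h).

(** The unit normal is the first, resp. second, basis vector on [elt_vedge],
    resp. [elt_hedge].  For [v] in $H^3$ of the element, the normal derivative on
    an edge is the trace of a first weak derivative, which is in $H^2$. *)
Definition is_interpolant (h : R) c v p : Prop :=
  let K := elt h c in
  [/\ PT p,
      forall b1 b2, p (elt_vertex h c b1 b2) = cont_repr K v (elt_vertex h c b1 b2),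
      forall b, vedge_integral h c b (partial1 p) =
                vedge_integral h c b (cont_repr K (wderiv K° (1%N, 0%N) v)) &
      forall b, hedge_integral h c b (partial2 p) =
                hedge_integral h c b (cont_repr K (wderiv K° (0%N, 1%N) v))].

Definition Pi_elt (h : R) c v : R * R -> R :=
  xget (fun=> 0) [set p | is_interpolant h c v p].

Definition Pi_h (h : R) (T : {fset (R * R)}) v : R * R -> R :=
  piecewise h T (fun c => Pi_elt h c v).

Definition hess_index (i j : 'I_2) : multi_index :=
  (((i == 0 :> nat) + (j == 0 :> nat))%N, ((i == 1 :> nat) + (j == 1 :> nat))%N).

Definition hess_h (h : R) (T : {fset (R * R)}) v (x : R * R) : 'M[R]_2 :=
  \matrix_(i, j) piecewise h T (fun c => wderiv (elt h c)° (hess_index i j) v) x.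

Definition L2_inner (Omega : set (R * R)) (A B : R * R -> 'M[R]_2) : R :=
  \int[mu2]_(x in Omega) (\sum_i \sum_j A x i j * B x i j).

End Plane.

(* Main.v *)
From mathcomp Require Import all_boot all_order all_algebra finmap.
From mathcomp Require Import all_classical all_reals all_analysis.
From mathcomp Require Import measurable_realfun ring lra.
Require Import Defs.

Set Implicit Arguments.
Unset Strict Implicit.
Unset Printing Implicit Defensive.

Import Order.TTheory GRing.Theory Num.Theory.
Import numFieldNormedType.Exports.

Local Open Scope classical_set_scope.
Local Open Scope ring_scope.

(** On an element with center [c] write $X=x_1-c_1$, $Y=x_2-c_2$.  The vertex values of [w] and
    the edge integrals of its normal derivatives are integrals over the element of derivatives of
    [w] against polynomials, so the coefficients of the interpolant are explicit moments
    ([Pi_elt_epoly]).  Inserting them, the product of the Hessians of the error and of the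
    interpolant integrates over the element to
    $$\frac3{4h^4}\bigl[(m-d)d+(m'-d')d'\bigr],\qquad m=\int X\partial_{11}w,\
      d=\int Y\partial_{12}w,\ m'=\int Y\partial_{22}w,\ d'=\int X\partial_{12}w$$
    ([element_energy]).  This is of order $h^2$ only, and the gain comes from cancellation.

    Integration by parts turns a first moment such as [m] into $\frac{h^3}3$ times a difference of
    vertex values of a second derivative, with a remainder that is controlled by the derivatives of
    orders three and four.  Writing $s,z,t$ for $\partial_{11}w,\partial_{12}w,\partial_{22}w$ and
    $\delta_1,\delta_2$ for the differences of the vertex values in the two directions, the
    integral becomes
    $$\frac{h^2}{12}\bigl[(\delta_1s\,\delta_2z-\delta_2s\,\delta_1z)
      +(\delta_2t\,\delta_1z-\delta_1t\,\delta_2z)\bigr]$$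
    up to an error of order $h$ times the squared $L^1$ norms of these derivatives
    ([element_estimate]), that is $h^3$ times their squared $L^2$ norms, by Cauchy--Schwarz
    ([total_energy]).  Here one has to use that $\partial_1\partial_{12}w=\partial_2\partial_{11}w$
    and $\partial_2\partial_{12}w=\partial_1\partial_{22}w$: each moment of $\partial_{12}w$ has
    two leading terms, and the right choice makes both forms antisymmetric.

    An antisymmetric form of this kind is a null form: it is a sum of fluxes through the four edges
    of the element ([null_form_flux]).  The second derivatives of [w] are continuous, so the fluxes
    cancel between neighbours, and on an edge without neighbour the flux contains the difference of
    $\partial_{12}w$ along the edge, which vanishes because the first derivatives of a function of
    $H^2_0$ vanish there ([vertical_zero], [horizontal_zero]).  Hence only the remainders are left,
    and $\alpha_h$ can be taken as a constant times $h(1+h)$ ([mesh_estimate]).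

    Most of the work consists of giving a meaning to point values and traces of weak derivatives.
    On a rectangle, an integrable function with integrable weak derivatives $\partial_1$,
    $\partial_2$ and $\partial_{12}$ has the continuous representative [rep], an integral of the
    function and of these derivatives against explicit kernels ([continuous_rep], [rep_ae]).  The
    formula also holds on the sides of the rectangle, where the kernels are polynomials.  It yields
    the moments above, the equality of the vertex values seen from two neighbours ([trep_sub]), and
    the traces on the boundary ([boundary_vertical]).  It rests on the fundamental lemma of the
    calculus of variations ([bump_fundamental], [bump_fundamental2]), for which smooth functions of
    compact support are built from $e^{-1/x}$. *)

(** * Real-valued integrals and Fubini's theorem *)

Section RealIntegral.
Context d (T : measurableType d) (R : realType).
Variable mu : {measure set T -> \bar R}.
Implicit Types (f g h : T -> R) (k : R).

(** Integrability of a real-valued function on the whole space. Restrictions to subsets are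
    written with indicator factors, so that all integrals below have the same domain. *)
Definition rintegrable f := mu.-integrable setT (EFin \o f).

Lemma rintegrable_meas f : rintegrable f -> measurable_fun setT f.
Proof. by move=> /measurable_int /measurable_EFinP. Qed.

Lemma rintegrableD f g : rintegrable f -> rintegrable g -> rintegrable (fun x => f x + g x).
Proof. by move=> sf sg; apply: (integrableD measurableT sf sg). Qed.

Lemma rintegrableZ k f : rintegrable f -> rintegrable (fun x => k * f x).
Proof. by move=> sf; apply: (integrableZl measurableT k sf). Qed.

Lemma rintegrableN f : rintegrable f -> rintegrable (fun x => - f x).
Proof.
move=> sf; rewrite (_ : (fun x => - f x) = fun x => -1 * f x).
  exact: rintegrableZ.
by apply/funext => x; rewrite mulN1r.
Qed.

Lemma rintegrableB f g : rintegrable f -> rintegrable g -> rintegrable (fun x => f x - g x).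
Proof. by move=> sf /rintegrableN; exact: rintegrableD. Qed.

Lemma rintegrable_norm f : rintegrable f -> rintegrable (fun x => `|f x|).
Proof. exact: integrable_norm. Qed.

Lemma rintegrable_le f g : measurable_fun setT f -> rintegrable g ->
  (forall x, `|f x| <= g x) -> rintegrable f.
Proof.
move=> mf sg fg; apply: (le_integrable measurableT _ _ sg).
  exact/measurable_EFinP.
move=> x _ /=; rewrite lee_fin; apply: le_trans (fg x) _; exact: ler_norm.
Qed.

Lemma rintegrableM k f g : measurable_fun setT f -> (forall x, `|f x| <= k) ->
  rintegrable g -> rintegrable (fun x => f x * g x).
Proof.
move=> mf fk sg; apply: (@rintegrable_le _ (fun x => k * `|g x|)).
- by apply: measurable_funM => //; exact: rintegrable_meas.
- exact/rintegrableZ/rintegrable_norm.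
- by move=> x; rewrite normrM ler_wpM2r.
Qed.

Lemma rintegrable_sum (I : Type) (s : seq I) (F : I -> T -> R) :
  (forall i, rintegrable (F i)) -> rintegrable (fun x => \sum_(i <- s) F i x).
Proof.
move=> sF; elim: s => [|i s IH].
  rewrite (_ : (fun _ => _) = cst 0); last by apply/funext => x; rewrite big_nil.
  exact: integrable0.
rewrite (_ : (fun _ => _) = fun x => F i x + \sum_(j <- s) F j x).
  exact: rintegrableD.
by apply/funext => x; rewrite big_cons.
Qed.

Lemma rintD f g : rintegrable f -> rintegrable g ->
  \int[mu]_x (f x + g x) = \int[mu]_x f x + \int[mu]_x g x.
Proof. exact: RintegralD. Qed.

Lemma rintB f g : rintegrable f -> rintegrable g ->
  \int[mu]_x (f x - g x) = \int[mu]_x f x - \int[mu]_x g x.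
Proof. exact: RintegralB. Qed.

Lemma rintZ k f : rintegrable f -> \int[mu]_x (k * f x) = k * \int[mu]_x f x.
Proof. exact: RintegralZl. Qed.

Lemma rint_sum (I : Type) (s : seq I) (F : I -> T -> R) :
  (forall i, rintegrable (F i)) ->
  \int[mu]_x (\sum_(i <- s) F i x) = \sum_(i <- s) \int[mu]_x F i x.
Proof.
move=> sF; elim: s => [|i s IH].
  rewrite big_nil (_ : (fun _ => _) = cst 0).
    by rewrite /Rintegral integral0.
  by apply/funext => x; rewrite big_nil.
rewrite big_cons -IH -rintD//; last exact: rintegrable_sum.
by apply: eq_Rintegral => x _; rewrite big_cons.
Qed.

Lemma rint_le f g : rintegrable f -> rintegrable g -> (forall x, f x <= g x) ->
  \int[mu]_x f x <= \int[mu]_x g x.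
Proof. by move=> sf sg fg; apply: le_Rintegral. Qed.

Lemma rint_norm f : rintegrable f -> `|\int[mu]_x f x| <= \int[mu]_x `|f x|.
Proof. by move=> sf; apply: le_normr_Rintegral. Qed.

Lemma rint_ae f g : rintegrable f -> measurable_fun setT g ->
  {ae mu, forall x, f x = g x} -> \int[mu]_x f x = \int[mu]_x g x.
Proof.
move=> sf mg fg; congr fine; apply: ae_eq_integral => //.
- exact/measurable_EFinP/rintegrable_meas.
- exact/measurable_EFinP.
- by case: fg => N [mN N0 sN]; exists N; split => // x /= h; apply: sN => /= e;
    apply: h => _; rewrite e.
Qed.

Lemma rint_dominated (f_ : nat -> T -> R) f g :
  (forall n, measurable_fun setT (f_ n)) -> measurable_fun setT f ->
  {ae mu, forall x, f_ n x @[n --> \oo] --> f x} ->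
  rintegrable g -> (forall n x, `|f_ n x| <= g x) ->
  \int[mu]_x f_ n x @[n --> \oo] --> \int[mu]_x f x.
Proof.
move=> mf_ mf cf sg fg.
have sf n : rintegrable (f_ n) by apply: (rintegrable_le (mf_ n) sg).
have [] := @dominated_convergence _ _ _ mu setT measurableT
  (fun n => EFin \o f_ n) (EFin \o f) (EFin \o g).
- by move=> n; exact/measurable_EFinP.
- exact/measurable_EFinP.
- apply: filterS cf => x cx _ /=; apply: cvg_EFin => //; exact: nearW.
- exact: sg.
- by apply: aeW => x n _ /=; rewrite lee_fin.
move=> sf' _ cI.
have fin : (\int[mu]_x (f x)%:E)%E \is a fin_num by exact: integrable_fin_num.
by apply: fine_cvg; rewrite fineK.
Qed.

End RealIntegral.

Section Fubini.
Variable R : realType.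
Notation mu1 := (@lebesgue_measure R).
Notation mu2 := (mu1 \x mu1)%E.
Implicit Types (f g : R * R -> R).

Lemma ae_fubini1 f : rintegrable mu2 f ->
  {ae mu1, forall x, rintegrable mu1 (fun y => f (x, y))}.
Proof. by move=> sf; apply: (ae_integrable1 sf). Qed.

Lemma measurable_fun_fine1 (F : R -> \bar R) : measurable_fun setT F ->
  measurable_fun setT (fine \o F).
Proof. by move=> mF; apply: measurableT_comp. Qed.

Lemma rintegrable_fine (F : R -> \bar R) : mu1.-integrable setT F ->
  rintegrable mu1 (fine \o F).
Proof.
move=> iF; apply: (le_integrable measurableT _ _ iF).
  by apply/measurable_EFinP; apply: measurable_fun_fine1; exact: (measurable_int _ iF).
by move=> x _ /=; case: (F x) => [r| |]//=; rewrite ?normr0 leey.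
Qed.

Lemma rint_fine (F : R -> \bar R) : mu1.-integrable setT F ->
  \int[mu1]_x (fine (F x)) = fine (\int[mu1]_x F x)%E.
Proof.
move=> iF; congr fine; apply: ae_eq_integral => //.
- by apply/measurable_EFinP; apply: measurable_fun_fine1; exact: (measurable_int _ iF).
- exact: (measurable_int _ iF).
- have := integrable_ae measurableT iF; apply: filterS => x h /= _.
  by rewrite fineK// h.
Qed.

Lemma rintegrable_fubini1 f : rintegrable mu2 f ->
  rintegrable mu1 (fun x => \int[mu1]_y f (x, y)).
Proof. by move=> sf; apply: rintegrable_fine; apply: (integrable_fubini_F sf). Qed.

Definition transpose f : R * R -> R := fun x => f (x.2, x.1).

Lemma measurable_transpose f : measurable_fun setT f ->
  measurable_fun setT (transpose f).
Proof. by move=> mf; apply: (measurableT_comp mf); exact: measurable_swap. Qed.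

Lemma rintegrable_transpose f : rintegrable mu2 f -> rintegrable mu2 (transpose f).
Proof.
move=> sf; have mf := rintegrable_meas sf.
apply/(integrable12ltyP mu1 mu1).
  by apply/measurable_EFinP; apply: measurable_transpose.
apply/(integrable21ltyP mu1 mu1 (f := EFin \o f)) => //.
by apply/measurable_EFinP.
Qed.

Lemma rint_transpose f : rintegrable mu2 f ->
  \int[mu2]_x transpose f x = \int[mu2]_x f x.
Proof.
move=> sf; rewrite /Rintegral -(integral12_prod_meas1 (rintegrable_transpose sf)).
by rewrite -(integral21_prod_meas1 sf).
Qed.

Lemma rfubini1 f : rintegrable mu2 f ->
  \int[mu2]_z f z = \int[mu1]_x \int[mu1]_y f (x, y).
Proof.
move=> sf; rewrite rint_fine ?[in LHS]/Rintegral -?integral12_prod_meas1//.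
exact: (integrable_fubini_F sf).
Qed.

Lemma rintegrable_fubini2 f : rintegrable mu2 f ->
  rintegrable mu1 (fun y => \int[mu1]_x f (x, y)).
Proof. by move=> /rintegrable_transpose/rintegrable_fubini1. Qed.

Lemma rfubini2 f : rintegrable mu2 f ->
  \int[mu2]_z f z = \int[mu1]_y \int[mu1]_x f (x, y).
Proof.
by move=> sf; rewrite -rint_transpose// rfubini1//; exact: rintegrable_transpose.
Qed.

End Fubini.

(** * Smooth functions with compact support on the line *)

Section Smooth.
Variable R : realType.
Implicit Types (f g eta : R -> R) (p q : {poly R}) (a b c x t : R).

Fixpoint diff_class (k : nat) f : Prop :=
  if k is k'.+1 then
    exists2 g, (forall x, is_derive x 1 f (g x)) & diff_class k' g
  else continuous f.

Definition smooth f := forall k, diff_class k f.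

Lemma is_derive_continuous f g : (forall x, is_derive x 1 f (g x)) -> continuous f.
Proof.
move=> fg x; apply/differentiable_continuous/derivable1_diffP.
exact: (@ex_derive _ _ _ _ _ _ _ (fg x)).
Qed.

Lemma diff_classS k f : diff_class k.+1 f -> diff_class k f.
Proof.
elim: k f => [|k IH] f /=; first by move=> [g fg _]; exact: is_derive_continuous fg.
by move=> [g fg dg]; exists g => //; exact: IH.
Qed.

Lemma diff_classD k f g : diff_class k f -> diff_class k g ->
  diff_class k (fun x => f x + g x).
Proof.
elim: k f g => [|k IH] f g /=.
  by move=> cf cg x; apply: continuousD; [exact: cf|exact: cg].
move=> [f' ff' df'] [g' gg' dg']; exists (fun x => f' x + g' x); last exact: IH.
by move=> x; apply: is_deriveD.
Qed.

Lemma diff_classM k f g : diff_class k f -> diff_class k g ->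
  diff_class k (fun x => f x * g x).
Proof.
elim: k f g => [|k IH] f g.
  by move=> cf cg x; apply: continuousM; [exact: cf|exact: cg].
move=> df dg; have df0 := diff_classS df; have dg0 := diff_classS dg.
move: df dg => [f' ff' df'] [g' gg' dg'].
exists (fun x => f x * g' x + g x * f' x).
  by move=> x; apply: is_deriveM.
by apply: diff_classD; apply: IH.
Qed.

Lemma diff_class_cst k c : diff_class k (fun=> c).
Proof.
elim: k c => [|k IH] c /=; first by move=> x; exact: cst_continuous.
by exists (fun=> 0) => // x; exact: is_derive_cst.
Qed.

Lemma diff_class_affine k f a c : diff_class k f ->
  diff_class k (fun x => f (a * x + c)).
Proof.
elim: k f => [|k IH] f /=.
  move=> cf x; apply: (@continuous_comp _ _ _ (fun x => a * x + c) f); last exact: cf.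
  apply: continuousD; last exact: cst_continuous.
  by apply: continuousM; [exact: cst_continuous|exact: id].
move=> [f' ff' df']; exists (fun x => a * f' (a * x + c)); last first.
  by apply: diff_classM; [exact: diff_class_cst|exact: IH].
move=> x.
have h : is_derive x 1 (fun x => a * x + c) a.
  by apply: is_derive_eq; rewrite /GRing.scale/= ?(mulr0, mulr1, addr0).
have := @is_derive1_comp _ f (fun x => a * x + c) x _ _ (ff' _) h.
by rewrite mulrC.
Qed.

Lemma smooth_continuous f : smooth f -> continuous f.
Proof. by move/(_ 0). Qed.

Lemma smooth_is_derive f x : smooth f -> is_derive x 1 f (derive1 f x).
Proof.
move=> /(_ 1) /= [g fg _]; rewrite derive1E.
have := fg x; move=> h; rewrite (@derive_val _ _ _ _ _ _ _ h); exact: h.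
Qed.

Lemma smooth_derive1 f : smooth f -> smooth (derive1 f).
Proof.
move=> sf k; have /= [g fg dg] := sf k.+1.
suff -> : derive1 f = g by [].
by apply/funext => x; rewrite derive1E (@derive_val _ _ _ _ _ _ _ (fg x)).
Qed.

Lemma smoothM f g : smooth f -> smooth g -> smooth (fun x => f x * g x).
Proof. by move=> sf sg k; apply: diff_classM. Qed.

Lemma smoothD f g : smooth f -> smooth g -> smooth (fun x => f x + g x).
Proof. by move=> sf sg k; apply: diff_classD. Qed.

Lemma smooth_cst c : smooth (fun=> c).
Proof. by move=> k; exact: diff_class_cst. Qed.

Lemma smooth_primitive f g : smooth f -> (forall x, is_derive x 1 g (f x)) -> smooth g.
Proof.
move=> sf gf [|k] /=; first exact: is_derive_continuous gf.
by exists f.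
Qed.

Definition flat p x : R := if 0 < x then p.[x^-1] * expR (- x^-1) else 0.

(** The exponential beats every polynomial; this makes [flat p] vanish to second order at $0$. *)
Lemma horner_expRN_le q : exists C, forall t, 0 < t -> `|q.[t]| * expR (- t) <= C / t.
Proof.
suff : forall k, exists C, forall t, 0 < t ->
    `|q.[t] * t ^+ k| * expR (- t) <= C / t.
  by move=> /(_ 0) [C h]; exists C => t /h; rewrite expr0 mulr1.
elim/poly_ind: q => [|q c IH] k.
  by exists 0 => t t0; rewrite horner0 mul0r normr0 !mul0r.
have [C HC] := IH k.+1.
exists (C + `|c| * (k.+1)`!%:R) => t t0.
rewrite hornerMXaddC mulrDl -mulrA -exprS mulrDl.
apply: le_trans (_ : (`|q.[t] * t ^+ k.+1| + `|c * t ^+ k|) * expR (- t) <= _).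
  by rewrite ler_wpM2r ?expR_ge0// ler_normD.
rewrite mulrDl lerD//; first exact: HC.
rewrite normrM -mulrA -mulrA ler_wpM2l// normrX gtr0_norm// expRN.
rewrite ler_pdivlMr// mulrAC -exprSr ler_pdivrMr ?expR_gt0//.
have := @expR_ge1Dxn R t k (ltW t0).
have f0 : 0 < (k.+1)`!%:R :> R by rewrite ltr0n fact_gt0.
rewrite -(ler_pM2l f0) => h; apply: le_trans h.
rewrite mulrDr mulr1 mulrCA divff ?gt_eqF// mulr1 lerDr; exact: ltW.
Qed.

(** The functions $p(1/x)e^{-1/x}$, extended by zero to $x\le0$, are stable under differentiation, with $p$ replaced by
    $t^2(p-p')$, hence all of them are smooth. *)
Lemma is_derive_flat p x : is_derive x 1 (flat p) (flat ('X^2 * (p - p^`())) x).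
Proof.
have [x0|x0|->] := ltgtP x 0.
- rewrite /flat ltNge (ltW x0)/=.
  apply: (@near_eq_is_derive _ _ _ (fun=> 0)).
  near=> y; rewrite ifF//; apply/negbTE; rewrite -leNgt ltW//.
  near: y; exact: lt_nbhsl.
- rewrite /flat x0.
  have xV : is_derive x 1 (fun y : R => y^-1) (- x ^- 2).
    have := @is_deriveV R id x 1 1 (lt0r_neq0 x0) (is_derive_id _ _).
    by move=> h; apply: is_derive_eq; rewrite /GRing.scale/= mulr1.
  have h1 : is_derive x 1 (fun y => p.[y^-1]) (p^`().[x^-1] * (- x ^- 2)).
    exact: (@is_derive1_comp _ (horner p) (fun y => y^-1) x _ _ _ xV).
  have h2 : is_derive x 1 (fun y => expR (- y^-1)) (expR (- x^-1) * (x ^- 2)).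
    apply: (@is_derive1_comp _ expR (fun y => - y^-1) x).
    by apply: is_derive_eq; rewrite opprK.
  have h3 : is_derive x 1 (fun y => p.[y^-1] * expR (- y^-1))
      (('X^2 * (p - p^`())).[x^-1] * expR (- x^-1)).
    have h := is_deriveM h1 h2; apply: (is_derive_eq h).
    rewrite hornerM hornerXn hornerD hornerN exprVn /GRing.scale/=; ring.
  apply: near_eq_is_derive h3; near=> y; rewrite ifT//; near: y; exact: lt_nbhsr.
(* At the origin the function is bounded by $E h^2$. *)
- have [E HE] := horner_expRN_le ('X * p).
  have E0 : 0 <= E.
    by have := HE 1 ltr01; rewrite divr1; apply: le_trans; rewrite mulr_ge0// expR_ge0.
  have HD h : `|flat p h| <= E * `|h| ^+ 2.
    rewrite /flat; case: ifPn => h0; last by rewrite normr0 mulr_ge0// exprn_ge0.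
    have hV : 0 < h^-1 by rewrite invr_gt0.
    have := HE _ hV; rewrite invrK !hornerE normrM (gtr0_norm hV).
    rewrite normrM (gtr0_norm (expR_gt0 _)) (gtr0_norm h0) -mulrA mulrC.
    by rewrite ler_pdivrMr// -mulrA -expr2.
  rewrite {2}/flat ltxx.
  have lim0 : h^-1 *: (flat p (h *: 1 + 0) - flat p 0) @[h --> 0^'] --> (0 : R).
    apply/cvgrPdist_le => e e0; near=> h.
    rewrite sub0r normrN /GRing.scale/= addr0 mulr1 {2}/flat ltxx subr0 normrM.
    have h0 : h != 0 by near: h; exact: nbhs_dnbhs_neq.
    rewrite normfV ler_pdivrMl ?normr_gt0//.
    apply: le_trans (HD h) _; rewrite expr2 mulrA mulrC ler_wpM2l//.
    apply: le_trans (_ : (E + 1) * `|h| <= e); first by rewrite ler_wpM2r// lerDl.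
    rewrite -ler_pdivlMl ?ltr_wpDl// mulrC.
    by near: h; apply: dnbhs0_le; rewrite divr_gt0// ltr_wpDl.
  by split; [apply/cvg_ex; exists 0|apply/cvg_lim].
Unshelve. all: by end_near. Qed.

Lemma smooth_flat p : smooth (flat p).
Proof.
move=> k; elim: k p => [|k IH] p /=.
  exact: is_derive_continuous (is_derive_flat p).
by exists (flat ('X^2 * (p - p^`()))) => //; exact: is_derive_flat.
Qed.

(** The prototype $x\mapsto e^{-1/x}1_{x>0}$ of a smooth function. *)
Definition flat1 x := flat 1 x.

Lemma smooth_flat1 : smooth flat1. Proof. exact: smooth_flat. Qed.

Lemma flat1_ge0 x : 0 <= flat1 x.
Proof.
by rewrite /flat1 /flat; case: ifPn => // _; rewrite hornerC mul1r expR_ge0.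
Qed.

Lemma flat1_le1 x : flat1 x <= 1.
Proof.
rewrite /flat1 /flat; case: ifPn => // x0.
by rewrite hornerC mul1r expR_le1 oppr_le0 invr_ge0 ltW.
Qed.

Lemma flat1_npos x : x <= 0 -> flat1 x = 0.
Proof. by rewrite /flat1 /flat leNgt => /negbTE ->. Qed.

Lemma flat1_lim (u : nat -> R) : u n @[n --> \oo] --> +oo ->
  flat1 (u n) @[n --> \oo] --> (1 : R).
Proof.
move=> uoo; have upos : \forall n \near \oo, 0 < u n by move/cvgryPgt : uoo; apply.
have uV : (u n)^-1 @[n --> \oo] --> (0 : R).
  exact/gtr0_cvgV0.
have h : expR (- (u n)^-1) @[n --> \oo] --> expR (- 0 : R).
  by apply: continuous_cvg; [exact: continuous_expR|exact: cvgN].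
rewrite oppr0 expR0 in h.
apply: cvg_trans h; apply: near_eq_cvg; near=> n.
rewrite /flat1 /flat ifT ?hornerC ?mul1r//; near: n; exact: upos.
Unshelve. all: by end_near. Qed.

Definition bump a b eta :=
  smooth eta /\ exists c d, [/\ a < c, d < b & forall x, ~ (c <= x <= d) -> eta x = 0].

Lemma bump_derive1 a b eta : bump a b eta -> bump a b (derive1 eta).
Proof.
move=> [se [c [d [ac db e0]]]]; split; first exact: smooth_derive1.
exists c, d; split => // x xcd.
rewrite derive1E; apply: (@derive_val _ _ _ _ _ _ _ _).
apply: (@near_eq_is_derive _ _ _ (fun=> 0)).
have [xc|cx] := ltP x c.
  near=> y; apply/esym/e0 => /andP[cy _]; move: cy; apply/negP; rewrite -ltNge.
  by near: y; exact: lt_nbhsl.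
have [dx|xd] := ltP d x; last by case: xcd; rewrite cx xd.
near=> y; apply/esym/e0 => /andP[_ yd]; move: yd; apply/negP; rewrite -ltNge.
by near: y; exact: lt_nbhsr.
Unshelve. all: by end_near. Qed.

Lemma bump_flat a b c d n : a < c -> d < b -> 0 < n ->
  bump a b (fun x => flat1 (n * (x - c)) * flat1 (n * (d - x))).
Proof.
move=> ac db n0; split.
  apply: smoothM => k.
    have := diff_class_affine n (- (n * c)) (smooth_flat1 k).
    by under eq_fun do rewrite -mulrN -mulrDr.
  have := diff_class_affine (- n) (n * d) (smooth_flat1 k).
  by under eq_fun do rewrite mulNr addrC -mulrBr.
exists c, d; split => // x xcd.
have [xc|cx] := ltP x c.
  by rewrite flat1_npos ?mul0r// pmulr_rle0// subr_le0 ltW.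
have [dx|xd] := ltP d x; last by case: xcd; rewrite cx xd.
by rewrite mulrC flat1_npos ?mul0r// pmulr_rle0// subr_le0 ltW.
Qed.

End Smooth.

(** * The fundamental lemma of the calculus of variations on the line *)

Section Line.
Variable R : realType.
Notation mu1 := (@lebesgue_measure R).
Notation mu2 := (mu1 \x mu1)%E.
Implicit Types (F G eta al : R -> R) (a b c x C : R).

Lemma rintegrable_tensor F G : rintegrable mu1 F -> rintegrable mu1 G ->
  rintegrable mu2 (fun x : R * R => F x.1 * G x.2).
Proof.
move=> sF sG; have mF := rintegrable_meas sF; have mG := rintegrable_meas sG.
have mFG : measurable_fun setT (fun x : R * R => F x.1 * G x.2).
  by apply: measurable_funM; [apply: (measurableT_comp mF)|
    apply: (measurableT_comp mG)].
apply/(integrable12ltyP mu1 mu1); first by apply/measurable_EFinP.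
have /integrableP[_ iF] := sF; have /integrableP[_ iG] := sG.
have -> : (\int[mu1]_x \int[mu1]_y `|(EFin \o (fun z : R * R => (F z.1 * G z.2)%R)) (x, y)|
  = (\int[mu1]_x `|(F x)%:E|) * (\int[mu1]_x `|(G x)%:E|))%E.
  rewrite -ge0_integralZr//.
  - apply: eq_integral => x _ /=; rewrite -ge0_integralZl//.
    + by apply: eq_integral => y _ /=; rewrite normrM EFinM.
    + by apply/measurable_EFinP; apply: measurableT_comp.
  - by apply/measurable_EFinP; apply: measurableT_comp.
  - exact: integral_ge0.
by rewrite lte_mul_pinfty// ?integral_ge0// ge0_fin_numE// integral_ge0.
Qed.

Lemma measurable_bool_ind d (T : measurableType d) (P : T -> bool) :
  measurable_fun setT P -> measurable_fun setT (fun z : T => (P z)%:R : R).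
Proof. by move=> mP; apply: (measurableT_comp (f := fun b : bool => b%:R : R)). Qed.

Lemma measurable_le_ind d (T : measurableType d) (f g : T -> R) :
  measurable_fun setT f -> measurable_fun setT g ->
  measurable_fun setT (fun z : T => (f z <= g z)%R%:R : R).
Proof. by move=> mf mg; apply: measurable_bool_ind; exact: measurable_fun_ler. Qed.

Lemma ind_le1 (b : bool) : `|b%:R : R| <= 1.
Proof. by case: b; rewrite ?normr1 ?normr0. Qed.

Lemma rintegrable_indM d (T : measurableType d) (mu : {measure set T -> \bar R})
    (P : T -> bool) (f : T -> R) : measurable_fun setT P -> rintegrable mu f ->
  rintegrable mu (fun z : T => (P z)%:R * f z).
Proof.
move=> mP; apply: (@rintegrableM _ _ _ _ 1); first exact: measurable_bool_ind.
by move=> x; exact: ind_le1.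
Qed.

Definition prim F x := \int[mu1]_s ((s <= x)%R%:R * F s).
Definition tail F x := \int[mu1]_s ((x <= s)%R%:R * F s).

(** Fubini's theorem on the half plane $x\le y$: an integration by parts without boundary terms. *)
Lemma rint_tail F G : rintegrable mu1 F -> rintegrable mu1 G ->
  \int[mu1]_x (F x * tail G x) = \int[mu1]_x (prim F x * G x).
Proof.
move=> sF sG.
have s2 : rintegrable mu2 (fun z : R * R => (z.1 <= z.2)%R%:R * (F z.1 * G z.2)).
  apply: (@rintegrable_indM _ _ mu2 (fun z : R * R => (z.1 <= z.2)%R)).
    by apply: measurable_fun_ler.
  exact: rintegrable_tensor.
have E1 : forall x, F x * tail G x = \int[mu1]_y ((x <= y)%R%:R * (F x * G y)).
  move=> x; rewrite -rintZ.
    by apply: eq_Rintegral => y _; rewrite mulrCA.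
  by apply: rintegrable_indM => //; apply: measurable_fun_ler.
have E2 : forall y, prim F y * G y = \int[mu1]_x ((x <= y)%R%:R * (F x * G y)).
  move=> y; rewrite mulrC -rintZ.
    by apply: eq_Rintegral => x _; rewrite mulrCA [G y * _]mulrC.
  by apply: rintegrable_indM => //; apply: measurable_fun_ler.
transitivity (\int[mu2]_z ((z.1 <= z.2)%R%:R * (F z.1 * G z.2))).
  by rewrite rfubini1//; apply: eq_Rintegral => x _; rewrite E1.
by rewrite rfubini2//; apply: eq_Rintegral => x _; rewrite E2.
Qed.

Lemma rintegrable_continuous_bounded eta a b : continuous eta ->
  (forall x, ~ (a <= x <= b) -> eta x = 0) -> rintegrable mu1 eta.
Proof.
move=> ce e0.
have -> : eta = eta \_ `[a, b].
  apply/funext => x; rewrite patchE; case: ifPn => //.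
  by rewrite notin_setE /= in_itv/=; exact: e0.
have h : mu1.-integrable `[a, b] (EFin \o eta).
  apply: continuous_compact_integrable; first exact: segment_compact.
  exact: continuous_subspaceT.
by rewrite /rintegrable -restrict_EFin; apply: (integrable_mkcond _ _).1 h.
Qed.

Lemma primE F x : rintegrable mu1 F -> prim F x = \int[mu1]_(t in `]-oo, x]) F t.
Proof.
move=> sF; rewrite Rintegral_mkcond; apply: eq_Rintegral => t _.
rewrite patchE; case: ifPn; rewrite ?inE ?notin_setE /= in_itv/=.
  by move=> ->; rewrite mul1r.
by move=> /negP/negbTE ->; rewrite mul0r.
Qed.

Lemma is_derive_prim F x : rintegrable mu1 F -> continuous F ->
  is_derive x 1 (prim F) (F x).
Proof.
move=> sF cF.
have -> : prim F = fun x => \int[mu1]_(t in `]-oo, x]) F t.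
  by apply/funext => y; exact: primE.
have iF : mu1.-integrable `]-oo, (x + 1)] (EFin \o F).
  by apply: (integrableS measurableT) => //.
have x1 : x < x + 1 by rewrite ltrDl.
have [d1 d2] := @continuous_FTC1 R F -oo%O x (x + 1) x1 iF (ltNyr _) (cF x).
by split; [exact: d1|rewrite -derive1E; exact: d2].
Qed.

Lemma prim_lt F x c : (forall t, t < c -> F t = 0) -> x < c -> prim F x = 0.
Proof.
move=> F0 xc; rewrite /prim (_ : (fun _ => _) = cst 0); first by rewrite Rintegral_cst ?mul0r.
apply/funext => s /=; have [sx|] := leP s x; last by rewrite mul0r.
by rewrite F0 ?mulr0// (le_lt_trans sx).
Qed.

Lemma prim_gt F x c : (forall t, c < t -> F t = 0) -> c <= x ->
  prim F x = \int[mu1]_s F s.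
Proof.
move=> F0 cx; apply: eq_Rintegral => s _; have [sx|xs] := leP s x; rewrite ?mul1r//.
by rewrite F0 ?mulr0// (le_lt_trans cx).
Qed.

Lemma bump_rintegrable a b eta : bump a b eta -> rintegrable mu1 eta.
Proof.
move=> [se [c [d [ac db e0]]]].
exact: (rintegrable_continuous_bounded (smooth_continuous se) e0).
Qed.

Lemma bump_prim a b eta : bump a b eta -> \int[mu1]_s eta s = 0 ->
  bump a b (prim eta) /\ derive1 (prim eta) = eta.
Proof.
move=> be i0; have [se [c [d [ac db e0]]]] := be.
have sI := bump_rintegrable be.
have dp x : is_derive x 1 (prim eta) (eta x).
  by apply: is_derive_prim => //; exact: smooth_continuous.
split; last first.
  by apply/funext => x; rewrite derive1E; exact: (@derive_val _ _ _ _ _ _ _ (dp x)).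
split; first exact: smooth_primitive se dp.
exists c, d; split => // x xcd.
have [xc|cx] := ltP x c.
  apply: (@prim_lt _ _ c) => // t tc; apply: e0 => /andP[ct _].
  by move: tc; rewrite ltNge ct.
have [dx|xd] := ltP d x; last by case: xcd; rewrite cx xd.
rewrite (@prim_gt _ _ d) ?ltW// => t dt; apply: e0 => /andP[_ td].
by move: dt; rewrite ltNge td.
Qed.

Lemma continuous_bounded eta c d : continuous eta ->
  (forall x, ~ (c <= x <= d) -> eta x = 0) -> exists k, forall x, `|eta x| <= k.
Proof.
move=> ce e0; have [cd|dc] := leP c d; last first.
  exists 0 => x; rewrite e0 ?normr0// => /andP[cx xd].
  by move: (le_trans cx xd); rewrite leNgt dc.
have [|m _ Hm] := @EVT_max R (fun x => `|eta x|) c d cd.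
  apply: continuous_subspaceT => x; apply: continuous_comp; first exact: ce.
  exact: norm_continuous.
exists `|eta m| => x; have [xcd|/negP xcd] := boolP (c <= x <= d).
  by apply: Hm; rewrite in_itv.
by rewrite e0// normr0.
Qed.

Lemma bump_bounded a b eta : bump a b eta -> exists k, forall x, `|eta x| <= k.
Proof.
move=> [se [c [d [ac db e0]]]].
exact: (continuous_bounded (smooth_continuous se) e0).
Qed.

Lemma bump_measurable a b eta : bump a b eta -> measurable_fun setT eta.
Proof. by move=> /bump_rintegrable/rintegrable_meas. Qed.

Lemma bumpM_rintegrable a b eta F : bump a b eta -> rintegrable mu1 F ->
  rintegrable mu1 (fun x => eta x * F x).
Proof.
move=> be; have [k Hk] := bump_bounded be.
by apply: (@rintegrableM _ _ _ mu1 k) => //; exact: bump_measurable be.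
Qed.

(** Through these dilated bumps, integrals against bumps determine integrals over subintervals. *)
Lemma bump_cvg_itv a d x :
  flat1 (n.+1%:R * (x - (a + n.+1%:R^-1))) * flat1 (n.+1%:R * (d - n.+1%:R^-1 - x))
    @[n --> \oo] --> ((a < x < d)%R%:R : R).
Proof.
have key y : 0 < y -> flat1 (n.+1%:R * (y - n.+1%:R^-1)) @[n --> \oo] --> (1 : R).
  move=> y0; apply: flat1_lim.
  under eq_fun do rewrite mulrBr divff ?pnatr_eq0// -natr1.
  apply/cvgryPge => A; near=> n.
  rewrite mulrDl mul1r lerBrDr -lerBlDr -ler_pdivrMr//.
  near: n; exact: nbhs_infty_ger.
have key0 y : y <= 0 -> forall n, flat1 (n.+1%:R * (y - n.+1%:R^-1)) = 0 :> R.
  move=> y0 n; apply: flat1_npos; rewrite pmulr_rle0// subr_le0.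
  by rewrite (le_trans y0)// invr_ge0.
have E n : flat1 (n.+1%:R * (x - (a + n.+1%:R^-1))) * flat1 (n.+1%:R * (d - n.+1%:R^-1 - x)) =
    flat1 (n.+1%:R * ((x - a) - n.+1%:R^-1)) * flat1 (n.+1%:R * ((d - x) - n.+1%:R^-1)) :> R.
  by rewrite opprD addrA [d - _ - x]addrAC.
under eq_fun do rewrite E.
have [ax|xa] := ltP a x; last first.
  under eq_fun do rewrite key0 ?subr_le0// mul0r; exact: cvg_cst.
have [xd|dx] := ltP x d; last first.
  under eq_fun do rewrite [X in _ * X]key0 ?subr_le0// mulr0; exact: cvg_cst.
rewrite (_ : (true && true)%:R = 1 * 1 :> R); last by rewrite mulr1.
by apply: cvgM; apply: key; rewrite subr_gt0.
Unshelve. all: by end_near. Qed.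

Lemma rint_itv_bump0 a b d F : rintegrable mu1 F -> d <= b ->
  (forall eta, bump a b eta -> \int[mu1]_x (F x * eta x) = 0) ->
  \int[mu1]_x ((a < x < d)%R%:R * F x) = 0.
Proof.
move=> sF db HF.
pose e n x : R :=
  flat1 (n.+1%:R * (x - (a + n.+1%:R^-1))) * flat1 (n.+1%:R * (d - n.+1%:R^-1 - x)).
have be n : bump a b (e n).
  by apply: bump_flat => //; [rewrite ltrDl invr_gt0|
    rewrite ltrBlDr (le_lt_trans db)// ltrDl invr_gt0].
have mind : measurable_fun setT (fun x : R => (a < x < d)%R).
  by apply: measurable_and; apply: measurable_fun_ltr.
have : \int[mu1]_x (e n x * F x) @[n --> \oo] --> \int[mu1]_x ((a < x < d)%R%:R * F x).
  apply: (@rint_dominated _ _ _ mu1 (fun n x => e n x * F x)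
      (fun x => (a < x < d)%R%:R * F x) (fun x => `|F x|)).
  - by move=> n; apply: measurable_funM; [exact: bump_measurable (be n)|exact: rintegrable_meas sF].
  - by apply: measurable_funM; [exact: measurable_bool_ind|exact: rintegrable_meas sF].
  - by apply: aeW => x; apply: cvgMl; exact: bump_cvg_itv.
  - exact: rintegrable_norm.
  - move=> n x; rewrite normrM ler_piMl// ger0_norm ?mulr_ge0 ?flat1_ge0//.
    by rewrite mulr_ile1 ?flat1_ge0 ?flat1_le1.
have -> : (fun n => \int[mu1]_x (e n x * F x)) = fun=> 0.
  apply/funext => n; rewrite -(HF _ (be n)); apply: eq_Rintegral => x _.
  by rewrite mulrC.
by move=> /(cvg_lim (@Rhausdorff R)) <-; rewrite lim_cst.
Qed.

(** If all primitives of an integrable function vanish, so does the function, by Lebesgue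
    differentiation. *)
Lemma bump_fundamental a b F : rintegrable mu1 F ->
  (forall x, ~~ (a < x < b) -> F x = 0) ->
  (forall eta, bump a b eta -> \int[mu1]_x (F x * eta x) = 0) ->
  {ae mu1, forall x, F x = 0}.
Proof.
move=> sF F0 HF.
have P0 x : \int[mu1]_(t in `]-oo, x]) F t = 0.
  rewrite -primE//.
  have [xb|bx] := leP x b.
    rewrite -(rint_itv_bump0 sF xb HF).
    have xint : rintegrable mu1 (fun s => (s <= x)%R%:R * F s).
      by apply: rintegrable_indM => //; apply: measurable_fun_ler.
    apply: rint_ae => //.
      apply: measurable_funM; last exact: rintegrable_meas sF.
      apply: measurable_bool_ind.
      by apply: measurable_and; apply: measurable_fun_ltr.
    exists [set x]; split => //; first exact: lebesgue_measure_set1.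
    move=> s /= h; apply: contrapT => sx; apply: h.
    rewrite le_eqVlt (_ : (s == x) = false) /=; last exact/eqP.
    case: (ltP s x) => // sx'; case: (ltP a s) => // sa.
    have -> : F s = 0 by apply: F0; rewrite negb_and -leNgt sa.
    by rewrite !mulr0.
  rewrite (@prim_gt _ _ b) ?(ltW bx)//; last first.
    by move=> t bt; rewrite F0// negb_and -!leNgt (ltW bt) orbT.
  rewrite -(rint_itv_bump0 sF (lexx b) HF); apply: eq_Rintegral => x' _.
  by case: (boolP (a < x' < b)) => h; rewrite ?mul1r// F0// mulr0.
have := @FTC1Ny R F.
have li : locally_integrable [set: R] F.
  have := integrable_locally measurableT sF.
  by have -> : F \_ setT = F by apply/funext => x; rewrite patchE in_setT.
move=> /(_ _ li) /=; have -> : (fun x => \int[mu1]_(t in `]-oo, x]) F t) = cst 0.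
  by apply/funext => x; rewrite P0.
move=> h; apply: (@filterS _ _ (ae_filter_ringOfSetsType mu1) _ _ _ (h _)) => [x [_ <-]|y].
  by rewrite derive1_cst.
exact: (integrableS measurableT _ _ sF).
Qed.

End Line.

(** * Weak derivatives on an interval *)

Lemma eq_rint d (T : measurableType d) (R : realType)
    (mu : {measure set T -> \bar R}) (f g : T -> R) : f =1 g ->
  Rintegral mu setT f = Rintegral mu setT g.
Proof. by move=> fg; apply: eq_Rintegral => x _. Qed.

Section WeakDerivativeLine.
Variable R : realType.
Notation mu1 := (@lebesgue_measure R).
Notation mu2 := (mu1 \x mu1)%E.
Implicit Types (F G eta al : R -> R) (a b c k x s C : R).

Definition ind_itv a b x : R := (a < x < b)%R%:R.

Definition off a b F := forall x, ~~ (a < x < b) -> F x = 0.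

(** Tested on functions with compact support inside the interval, so nothing is said about the
    boundary values. *)
Definition weak1 a b F G := forall eta, bump a b eta ->
  \int[mu1]_x (F x * derive1 eta x) = - \int[mu1]_x (G x * eta x).

Lemma rintegrableM1 k al F : measurable_fun setT al -> (forall x, `|al x| <= k) ->
  rintegrable mu1 F -> rintegrable mu1 (fun x => al x * F x).
Proof. by move=> mal alk sF; apply: (@rintegrableM _ _ _ mu1 k). Qed.

Lemma measurable_ind_itv a b : measurable_fun setT (ind_itv a b).
Proof.
apply: measurable_bool_ind.
by apply: measurable_and; apply: measurable_fun_ltr.
Qed.

Lemma ind_itvM a b F : off a b F -> forall x, ind_itv a b x * F x = F x.
Proof.
by move=> F0 x; rewrite /ind_itv; case: (boolP (a < x < b)) => h; rewrite ?mul1r// F0// mulr0.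
Qed.

Lemma ind_itv_off a b F : off a b (fun x => ind_itv a b x * F x).
Proof. by move=> x /negbTE h; rewrite /ind_itv h mul0r. Qed.

Lemma norm_ind_itv a b x : `|ind_itv a b x| <= 1.
Proof. exact: ind_le1. Qed.

Lemma itvoo_lty a b : (mu1 `]a, b[ < +oo)%E.
Proof.
by rewrite lebesgue_measure_itv/=; case: ifPn => // _; rewrite -EFinB ltry.
Qed.

Lemma rintegrable_bounded_off a b k F : measurable_fun setT F -> off a b F ->
  (forall x, `|F x| <= k) -> rintegrable mu1 F.
Proof.
move=> mF oF Fk.
have -> : F = F \_ `]a, b[.
  apply/funext => x; rewrite patchE; case: ifPn => //.
  by rewrite notin_setE /= in_itv/= => /negP; exact: oF.
have h : mu1.-integrable `]a, b[ (EFin \o F).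
  apply: measurable_bounded_integrable => //.
  - exact: itvoo_lty.
  - exact: measurable_funS mF.
  - exists k; split; first exact: num_real.
    by move=> M kM x _ /=; rewrite (le_trans (Fk x))// ltW.
by rewrite /rintegrable -restrict_EFin; apply: (integrable_mkcond _ _).1 h.
Qed.

Lemma rintegrable_ind_itv a b : rintegrable mu1 (ind_itv a b).
Proof.
apply: (@rintegrable_bounded_off a b 1) => //; first exact: measurable_ind_itv.
  by move=> x /negbTE h; rewrite /ind_itv h.
exact: norm_ind_itv.
Qed.

Lemma fine_itv (p q : bool) a b : a < b ->
  fine (mu1 [set` Interval (BSide p a) (BSide q b)]) = b - a.
Proof. by move=> ab; rewrite lebesgue_measure_itv/= lte_fin ab. Qed.

Lemma rint_ind_itv a b : a < b -> \int[mu1]_x ind_itv a b x = b - a.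
Proof.
move=> ab; transitivity (\int[mu1]_(x in `]a, b[) (1 : R)).
  rewrite [RHS]Rintegral_mkcond; apply: eq_Rintegral => x _; rewrite patchE /ind_itv.
  case: ifPn; rewrite ?inE ?notin_setE /= in_itv/= => h; first by rewrite h.
  by case: (a < x < b) h => // /(_ isT).
by rewrite Rintegral_cst// mul1r; exact: fine_itv.
Qed.

Lemma bump_off a b eta : bump a b eta -> off a b eta.
Proof.
move=> [_ [c [d [ac db e0]]]] x xab; apply: e0 => /andP[cx xd]; move: xab.
by rewrite (lt_le_trans ac cx) (le_lt_trans xd db).
Qed.

Lemma bumpZ a b k eta : bump a b eta -> bump a b (fun x => k * eta x).
Proof.
move=> [se [c [d [ac db e0]]]]; split.
  by apply: smoothM => //; exact: smooth_cst.
by exists c, d; split => // x /e0 ->; rewrite mulr0.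
Qed.

Lemma bumpB a b eta eta' : bump a b eta -> bump a b eta' ->
  bump a b (fun x => eta x - eta' x).
Proof.
move=> [se [c [d [ac db e0]]]] /(bumpZ (-1)) [se' [c' [d' [ac' db' e0']]]]; split.
  have := smoothD se se'; by under eq_fun do rewrite mulN1r.
exists (Num.min c c'), (Num.max d d'); split; rewrite ?lt_min ?gt_max ?ac ?ac' ?db ?db'//.
move=> x h; have -> : eta x = 0.
  by apply: e0 => /andP[cx xd]; apply: h; rewrite ge_min cx le_max xd.
have := e0' x; rewrite mulN1r => ->; first by rewrite addr0.
by move=> /andP[cx xd]; apply: h; rewrite ge_min cx orbT le_max xd orbT.
Qed.

Lemma ae_itv_neq0 a b (P : R -> Prop) : a < b -> {ae mu1, forall x, P x} ->
  exists2 x, a < x < b & P x.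
Proof.
move=> ab [N [mN N0 sN]]; apply: contrapT => h.
have : (mu1 `]a, b[ <= mu1 N)%E.
  apply: le_measure; rewrite ?inE// => x /=; rewrite in_itv/= => xab.
  by apply: sN => Px; apply: h; exists x.
rewrite N0 lebesgue_measure_itv/= lte_fin ab -EFinB lee_fin subr_le0.
by rewrite leNgt ab.
Qed.

Lemma exists_bump a b : a < b -> exists2 eta, bump a b eta & \int[mu1]_x eta x = 1.
Proof.
move=> ab; suff [eta be nz] : exists2 eta, bump a b eta & \int[mu1]_x eta x != 0.
  exists (fun x => (\int[mu1]_x eta x)^-1 * eta x); first exact: bumpZ.
  by rewrite rintZ ?mulVf//; exact: bump_rintegrable be.
apply: contrapT => h.
have h0 eta : bump a b eta -> \int[mu1]_x (ind_itv a b x * eta x) = 0.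
  move=> be; have -> : (fun x => ind_itv a b x * eta x) = eta.
    by apply/funext => x; apply: ind_itvM; exact: bump_off.
  by apply: contrapT => /eqP ?; apply: h; exists eta.
have off_ind x : ~~ (a < x < b) -> ind_itv a b x = 0.
  by move=> /negbTE xab; rewrite /ind_itv xab.
have := bump_fundamental (rintegrable_ind_itv a b) off_ind h0.
move=> /(ae_itv_neq0 ab)[x xab]; rewrite /ind_itv xab => /eqP.
by rewrite oner_eq0.
Qed.

Lemma rintegrable_ind_tail a b G : rintegrable mu1 G ->
  rintegrable mu1 (fun x => ind_itv a b x * tail G x).
Proof.
move=> sG; have s2 : rintegrable mu2 (fun z : R * R => (z.1 <= z.2)%R%:R * (ind_itv a b z.1 * G z.2)).
  apply: (@rintegrable_indM _ _ _ mu2 (fun z : R * R => (z.1 <= z.2)%R)).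
    by apply: measurable_fun_ler.
  by apply: rintegrable_tensor => //; exact: rintegrable_ind_itv.
have := rintegrable_fubini1 s2; congr (rintegrable _ _); apply/funext => x /=.
rewrite /tail -rintZ.
  by apply: eq_Rintegral => y _; rewrite mulrCA.
by apply: rintegrable_indM => //; apply: measurable_fun_ler.
Qed.

(** Du Bois-Reymond: an integrable function with an integrable weak derivative is the
    difference of a constant and of the integral of the derivative to the right. *)
Lemma weak1_tail a b F G : a < b -> rintegrable mu1 F -> rintegrable mu1 G ->
  off a b F -> weak1 a b F G ->
  exists C, {ae mu1, forall x, F x = ind_itv a b x * (C - tail G x)}.
Proof.
move=> ab sF sG oF wFG; have [eta0 be0 i0] := exists_bump ab.
(* [W] annihilates the bumps of mean value zero, so it is the constant [C] given by one bump of
   integral one. *)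
pose W x := F x + ind_itv a b x * tail G x.
have sV := rintegrable_ind_tail a b sG.
have sW : rintegrable mu1 W by exact: rintegrableD.
have sM eta H : bump a b eta -> rintegrable mu1 H -> rintegrable mu1 (fun x => H x * eta x).
  by move=> be sH; have := bumpM_rintegrable be sH; under eq_fun do rewrite mulrC.
have W0 z : bump a b z -> \int[mu1]_x z x = 0 -> \int[mu1]_x (W x * z x) = 0.
  move=> bz iz; have [bA dA] := bump_prim bz iz.
  have -> : (fun x => W x * z x) = fun x => F x * z x + z x * tail G x.
    by apply/funext => x; rewrite /W mulrDl mulrC mulrAC [_ * z x]ind_itvM//; exact: bump_off.
  rewrite rintD; [|exact: sM|].
  - rewrite rint_tail//; last exact: bump_rintegrable bz.
    have := wFG _ bA; rewrite dA => ->.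
    by rewrite (eq_rint mu1 (fun x => mulrC (G x) (prim z x))) addNr.
  - have := sM _ _ bz sV; congr (rintegrable _ _); apply/funext => x.
    by rewrite mulrC mulrA [_ * ind_itv _ _ _]mulrC ind_itvM//; exact: bump_off.
pose C := \int[mu1]_x (W x * eta0 x); exists C.
have sC : rintegrable mu1 (fun x => C * ind_itv a b x).
  exact/rintegrableZ/rintegrable_ind_itv.
have h : {ae mu1, forall x, W x - C * ind_itv a b x = 0}.
  apply: (@bump_fundamental _ a b); first exact: rintegrableB.
    by move=> x xab; rewrite /W oF// /ind_itv (negbTE xab) mul0r mulr0 addr0 subr0.
  move=> eta be; set m := \int[mu1]_x eta x.
  have sb := bump_rintegrable be; have sb0 := bump_rintegrable be0.
  have bz : bump a b (fun x => eta x - m * eta0 x) by apply: bumpB => //; exact: bumpZ.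
  have := W0 _ bz; rewrite rintB//; last exact: rintegrableZ.
  rewrite rintZ// i0 mulr1 subrr => /(_ erefl).
  have -> : (fun x => W x * (eta x - m * eta0 x)) = fun x => W x * eta x - m * (W x * eta0 x).
    by apply/funext => x; rewrite mulrBr [X in _ - X]mulrCA.
  rewrite rintB ?rintZ; [|exact: sM|exact: sM|exact/rintegrableZ/sM].
  move=> E.
  have -> : (fun x => (W x - C * ind_itv a b x) * eta x) = fun x => W x * eta x - C * eta x.
    by apply/funext => x; rewrite mulrBl -mulrA ind_itvM//; exact: bump_off.
  by rewrite rintB ?rintZ//; [rewrite -/m mulrC; exact: E|exact: sM|exact: rintegrableZ].
apply: (@filterS _ _ (ae_filter_ringOfSetsType mu1) _ _ _ h) => x /eqP.
rewrite subr_eq0 /W mulrBr => /eqP E.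
by rewrite mulrC -E addrK.
Qed.

(** The weight [al] is only bounded: [weak1_tail] reduces the claim to Fubini's theorem. *)
Lemma weak1_prim a b F G al k : a < b -> rintegrable mu1 F -> rintegrable mu1 G ->
  off a b F -> weak1 a b F G ->
  measurable_fun setT al -> off a b al -> (forall x, `|al x| <= k) ->
  \int[mu1]_x al x = 0 ->
  \int[mu1]_x (al x * F x) = - \int[mu1]_x (prim al x * G x).
Proof.
move=> ab sF sG oF wFG mal oal alk ial.
have sal : rintegrable mu1 al by exact: rintegrable_bounded_off mal oal alk.
have [C FC] := weak1_tail ab sF sG oF wFG.
have sV := rintegrable_ind_tail a b sG.
have salV : rintegrable mu1 (fun x => al x * tail G x).
  have := rintegrableM1 mal alk sV; congr (rintegrable _ _); apply/funext => x.
  by rewrite mulrA [_ * ind_itv _ _ _]mulrC ind_itvM.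
have sCV : rintegrable mu1 (fun x => C * al x - al x * tail G x).
  by apply: rintegrableB => //; exact: rintegrableZ.
rewrite -rint_tail//.
have -> : \int[mu1]_x (al x * F x) = \int[mu1]_x (C * al x - al x * tail G x).
  apply: rint_ae; [exact: (rintegrableM1 mal alk sF)|exact: rintegrable_meas sCV|].
  apply: (@filterS _ _ (ae_filter_ringOfSetsType mu1) _ _ _ FC) => x ->.
  by rewrite mulrA [_ * ind_itv _ _ _]mulrC ind_itvM// mulrBr mulrC.
by rewrite rintB ?rintZ ?ial ?mulr0 ?sub0r//; exact: rintegrableZ.
Qed.

(** The Green kernel: $\kappa_x(s)=s-a$ to the left of $x$ and $s-b$ to its right. *)
Definition kern a b x s : R := s - a - (b - a) * (x <= s)%R%:R.

Lemma measurable_kern a b x : measurable_fun setT (kern a b x).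
Proof.
apply: measurable_funB.
  exact: measurable_funB.
by apply: measurable_funM => //; apply: measurable_le_ind.
Qed.

Lemma norm_kern a b x s : a < s < b -> `|kern a b x s| <= b - a.
Proof.
move=> /andP[sa sb]; rewrite /kern ler_norml.
by case: (x <= s)%R; rewrite ?mulr1 ?mulr0; lra.
Qed.

Lemma kern_ind_le a b x s : `|ind_itv a b s * kern a b x s| <= `|b - a|.
Proof.
rewrite /ind_itv; case: (boolP (a < s < b)) => h; last by rewrite mul0r normr0.
by rewrite mul1r (le_trans (norm_kern _ h))// ler_norm.
Qed.

Lemma rintegrable_kernM a b x F : rintegrable mu1 F -> off a b F ->
  rintegrable mu1 (fun s => kern a b x s * F s).
Proof.
move=> sF oF; have -> : (fun s => kern a b x s * F s) =
    fun s => (ind_itv a b s * kern a b x s) * F s.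
  by apply/funext => s; rewrite mulrAC ind_itvM// mulrC.
apply: (@rintegrableM1 `|b - a|) => //.
  by apply: measurable_funM; [exact: measurable_ind_itv|exact: measurable_kern].
exact: kern_ind_le.
Qed.

(** The value at a point as a mean value corrected by the derivative. The right-hand side is
    defined for every point and continuous, and only involves integrals over the whole interval,
    which is what makes exact formulas for vertex values and edge integrals possible. *)
Lemma weak1_rep a b F G : a < b -> rintegrable mu1 F -> rintegrable mu1 G ->
  off a b F -> off a b G -> weak1 a b F G ->
  {ae mu1, forall x, F x = ind_itv a b x *
     ((b - a)^-1 * \int[mu1]_s (F s + kern a b x s * G s))}.
Proof.
move=> ab sF sG oF oG wFG.
have [C FC] := weak1_tail ab sF sG oF wFG.
have ba0 : b - a != 0 by rewrite subr_eq0 gt_eqF.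
have sI := rintegrable_ind_itv a b.
have sV := rintegrable_ind_tail a b sG.
have primI x : a < x < b -> prim (ind_itv a b) x = x - a.
  move=> /andP[ax xb]; transitivity (\int[mu1]_(s in `]a, x]) (1 : R)).
    rewrite [RHS]Rintegral_mkcond; apply: eq_Rintegral => s _; rewrite patchE /ind_itv.
    have [sx|xs] := leP s x; case: ifPn; rewrite ?inE ?notin_setE /= in_itv/= ?sx ?andbT.
    - by move=> ->; rewrite (le_lt_trans sx xb) mulr1.
    - by move=> /negP/negbTE ->; rewrite mulr0.
    - by rewrite leNgt xs andbF.
    - by rewrite mul0r.
  by rewrite Rintegral_cst// mul1r; exact: fine_itv.
have sg : rintegrable mu1 (fun s => (s - a) * G s).
  have -> : (fun s => (s - a) * G s) = fun s => kern a b b s * G s.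
    apply/funext => s; rewrite /kern; case: (boolP (a < s < b)) => h.
      by case/andP: h => _ h; rewrite leNgt h mulr0 subr0.
    by rewrite oG// !mulr0.
  exact: rintegrable_kernM.
have EF : \int[mu1]_s F s = C * (b - a) - \int[mu1]_s ((s - a) * G s).
  have sCV : rintegrable mu1 (fun x => C * ind_itv a b x - ind_itv a b x * tail G x).
    by apply: rintegrableB => //; exact: rintegrableZ.
  have -> : \int[mu1]_s F s = \int[mu1]_s (C * ind_itv a b s - ind_itv a b s * tail G s).
    apply: rint_ae; [exact: sF|exact: rintegrable_meas sCV|].
    apply: (@filterS _ _ (ae_filter_ringOfSetsType mu1) _ _ _ FC) => x ->.
    by rewrite mulrBr mulrC.
  rewrite rintB ?rintZ//; last exact: rintegrableZ.
  rewrite rint_ind_itv// rint_tail//; congr (_ - _).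
  apply: eq_Rintegral => s _; case: (boolP (a < s < b)) => h; first by rewrite primI.
  by rewrite oG// !mulr0.
apply: (@filterS _ _ (ae_filter_ringOfSetsType mu1) _ _ _ FC) => x ->.
congr (_ * _).
have st : rintegrable mu1 (fun s => (x <= s)%R%:R * G s).
  by apply: rintegrable_indM => //; apply: measurable_fun_ler.
have -> : (fun s => F s + kern a b x s * G s) =
    fun s => F s + ((s - a) * G s - (b - a) * ((x <= s)%R%:R * G s)).
  by apply/funext => s; rewrite /kern mulrBl mulrA.
rewrite rintD//; last by apply: rintegrableB => //; exact: rintegrableZ.
rewrite rintB ?rintZ//; last exact: rintegrableZ.
rewrite EF -/(tail G x) addrA subrK mulrBr mulrC mulfK//; congr (_ - _).
by rewrite mulKf.
Qed.

End WeakDerivativeLine.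

(** * Rectangles and almost everywhere equality in the plane *)

Section PlaneTopology.
Variable R : realType.
Notation mu1 := (@lebesgue_measure R).
Notation mu2 := (mu1 \x mu1)%E.
Implicit Types (U A : set (R * R)) (f g : R * R -> R) (p q z : R * R) (a b c d e : R).

Definition box a1 b1 a2 b2 : set (R * R) := `]a1, b1[ `*` `]a2, b2[.

Lemma boxE a1 b1 a2 b2 z :
  box a1 b1 a2 b2 z <-> (a1 < z.1 < b1) && (a2 < z.2 < b2).
Proof.
rewrite /box /= !in_itv/=; split=> [[h1 h2]|/andP[]//]; by apply/andP.
Qed.

Lemma nbhs_boxP z U : nbhs z U <->
  exists2 e, 0 < e & box (z.1 - e) (z.1 + e) (z.2 - e) (z.2 + e) `<=` U.
Proof.
split=> [/nbhs_ballP[e /= e0 he]|[e e0 he]].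
  exists e => // w /boxE /andP[/andP[? ?] /andP[? ?]]; apply: he.
  by split; rewrite /ball/= ltr_distlC; apply/andP; split; lra.
apply/nbhs_ballP; exists e => //= w [].
rewrite /ball/= !ltr_distlC => h1 h2.
by apply: he; apply/boxE; rewrite h1.
Qed.

Lemma nbhs_box a1 b1 a2 b2 z : box a1 b1 a2 b2 z -> nbhs z (box a1 b1 a2 b2).
Proof.
move=> /boxE/andP[/andP[h1 h2] /andP[h3 h4]]; apply/nbhs_boxP.
exists (Num.min (Num.min (z.1 - a1) (b1 - z.1)) (Num.min (z.2 - a2) (b2 - z.2))).
  by rewrite !lt_min !subr_gt0 h1 h2 h3 h4.
set e := Num.min _ _.
have [e1 e2 e3 e4] : [/\ e <= z.1 - a1, e <= b1 - z.1, e <= z.2 - a2 & e <= b2 - z.2].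
  by split; rewrite !ge_min lexx ?orbT.
move=> w /boxE /andP[/andP[k1 k2] /andP[k3 k4]]; apply/boxE.
by apply/andP; split; apply/andP; split; lra.
Qed.

Lemma open_box a1 b1 a2 b2 : open (box a1 b1 a2 b2).
Proof. by rewrite openE => z /nbhs_box. Qed.

Lemma measurable_box a1 b1 a2 b2 : measurable (box a1 b1 a2 b2).
Proof. exact: measurableX. Qed.

Lemma rat_between a b : a < b -> exists r : rat, a < ratr r < b.
Proof.
move=> /rat_in_itvoo[r]; rewrite in_itv/= => h; by exists r.
Qed.

(** An open set is a countable union of rectangles, those with rational centers and half sides
    $1/(n+1)$ that it contains. *)
Lemma open_induction (P : set (R * R) -> Prop) U : open U -> P set0 ->
  (forall a1 b1 a2 b2, box a1 b1 a2 b2 `<=` U -> P (box a1 b1 a2 b2)) ->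
  (forall F : nat -> set (R * R), (forall n, P (F n)) -> P (\bigcup_n F n)) -> P U.
Proof.
move=> oU P0 Pbox Pcup.
pose B (n : nat) (r s : rat) := box (ratr r - n.+1%:R^-1) (ratr r + n.+1%:R^-1)
  (ratr s - n.+1%:R^-1) (ratr s + n.+1%:R^-1) : set (R * R).
pose F (m : nat) := if (choice.unpickle m : option (nat * rat * rat)) is Some t then
  (if `[< B t.1.1 t.1.2 t.2 `<=` U >] then B t.1.1 t.1.2 t.2 else set0) else set0.
have -> : U = \bigcup_m F m.
  apply/seteqP; split => [z Uz|z [m _]]; last first.
    by rewrite /F; case: (choice.unpickle m) => // t; case: asboolP => // h /h.
  have /nbhs_boxP[e e0 he] : nbhs z U by apply: open_nbhs_nbhs.
  have [n ne] : exists n, n.+1%:R^-1 < e / 2.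
    have e20 : 0 < (e / 2)^-1 by rewrite invr_gt0 divr_gt0.
    exists (Num.trunc (e / 2)^-1); rewrite invf_plt ?posrE ?divr_gt0//.
    exact: truncnS_gt.
  have n0 : 0 < n.+1%:R^-1 :> R by rewrite invr_gt0.
  pose i : R := n.+1%:R^-1.
  have [r /andP[r1 r2]] : exists r : rat, z.1 - i < ratr r < z.1 + i.
    by apply: rat_between; rewrite ltrBlDr -addrA ltrDl addr_gt0.
  have [s /andP[s1 s2]] : exists s : rat, z.2 - i < ratr s < z.2 + i.
    by apply: rat_between; rewrite ltrBlDr -addrA ltrDl addr_gt0.
  have {}ne : i < e / 2 by [].
  exists (choice.pickle (n, r, s)) => //.
  rewrite /F choice.pickleK /= /B -/i; case: asboolP => [_|].
    by apply/boxE; apply/andP; split; apply/andP; split; lra.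
  case; apply: subset_trans he => w /boxE/andP[/andP[? ?] /andP[? ?]].
  by apply/boxE; apply/andP; split; apply/andP; split; lra.
apply: Pcup => m; rewrite /F; case: (choice.unpickle m) => // t; case: asboolP => // BU.
exact: Pbox.
Qed.

Lemma open_measurable2 U : open U -> measurable U.
Proof.
move=> oU; apply: (open_induction oU) => // [a1 b1 a2 b2 _|F mF]; first exact: measurable_box.
exact: bigcup_measurable.
Qed.

Lemma continuous_measurable2 f : continuous f -> measurable_fun setT f.
Proof.
move=> cf; apply: (measurability _ (RGenOInfty.measurableE R)) => _ [_ [x ->] <-].
rewrite setTI; apply: open_measurable2.
by apply: open_comp; [move=> z _; exact: cf|exact: interval_open].
Qed.

(** Dominated convergence is about sequences, hence this criterion. *)
Lemma continuous_seq f z :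
  (forall u : nat -> R * R, (u n).1 @[n --> \oo] --> z.1 ->
     (u n).2 @[n --> \oo] --> z.2 -> f (u n) @[n --> \oo] --> f z) ->
  {for z, continuous f}.
Proof.
move=> H; apply: contrapT => nc.
have [e e0 He] : exists2 e, 0 < e & forall n : nat, exists w,
    [/\ `|z.1 - w.1| < n.+1%:R^-1, `|z.2 - w.2| < n.+1%:R^-1 & e <= `|f z - f w|].
  apply: contrapT => h; apply: nc; apply/cvgrPdist_lt => e e0.
  apply: contrapT => h'; apply: h; exists e => // n; apply: contrapT => h; apply: h'.
  apply/nbhs_boxP; exists n.+1%:R^-1 => //.
  move=> w /boxE; rewrite -!ltr_distlC => /andP[w1 w2] /=.
  by rewrite ltNge; apply/negP => ew; apply: h; exists w; split.
have [u Hu] := choice He.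
have lim0 : (n.+1%:R^-1 : R) @[n --> \oo] --> 0.
  exact: (@cvg_harmonic R).
have cu i : (forall n, `|i z - i (u n)| < n.+1%:R^-1) -> i (u n) @[n --> \oo] --> (i z : R).
  move=> hi; apply/cvgrPdist_lt => d d0; near=> n.
  apply: lt_trans (hi n) _; near: n.
  have /cvgrPdist_lt/(_ _ d0) := lim0; apply: filterS => n.
  by rewrite sub0r normrN gtr0_norm.
have := H u (cu fst (fun n => let: And3 h _ _ := Hu n in h))
  (cu snd (fun n => let: And3 _ h _ := Hu n in h)).
move=> /cvgrPdist_lt/(_ _ e0)[N _ HN].
have [_ _] := Hu N; rewrite leNgt => /negP; apply; exact: HN (leqnn N).
Unshelve. all: by end_near. Qed.

Lemma box_gt0 a1 b1 a2 b2 : a1 < b1 -> a2 < b2 -> (0 < mu2 (box a1 b1 a2 b2))%E.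
Proof.
move=> h1 h2; rewrite product_measure1E//.
have E1 : mu1 `]a1, b1[ = (b1 - a1)%:E by rewrite lebesgue_measure_itv/= lte_fin h1.
have E2 : mu1 `]a2, b2[ = (b2 - a2)%:E by rewrite lebesgue_measure_itv/= lte_fin h2.
rewrite [X in (_ < X)%E](_ : _ = ((b1 - a1) * (b2 - a2))%:E).
  by rewrite lte_fin mulr_gt0// subr_gt0.
by rewrite EFinM -E1 -E2.
Qed.

Lemma ae_box_neq0 a1 b1 a2 b2 (P : R * R -> Prop) : a1 < b1 -> a2 < b2 ->
  {ae mu2, forall z, P z} -> exists2 z, box a1 b1 a2 b2 z & P z.
Proof.
move=> h1 h2 [N [mN N0 sN]]; apply: contrapT => h.
have : (mu2 (box a1 b1 a2 b2) <= mu2 N)%E.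
  apply: le_measure; rewrite ?inE//; first exact: measurable_box.
  by move=> z bz; apply: sN => Pz; apply: h; exists z.
by rewrite N0 leNgt box_gt0.
Qed.

(** Two continuous functions on a closed rectangle that agree almost everywhere agree
    everywhere, because every relative neighbourhood of a point has positive measure. *)
Lemma continuous_ae_eq a1 b1 a2 b2 f g : a1 < b1 -> a2 < b2 ->
  let K := `[a1, b1] `*` `[a2, b2] in
  {within K, continuous f} -> {within K, continuous g} ->
  {ae mu2, forall z, K z -> f z = g z} -> forall z, K z -> f z = g z.
Proof.
move=> h1 h2 K cf cg fg z Kz; apply: contrapT => /eqP nfg.
pose e := `|f z - g z| / 2.
have e0 : 0 < e by rewrite divr_gt0// normr_gt0 subr_eq0.
have near_f (k : R * R -> R) : {within K, continuous k} ->
    exists2 d, 0 < d & forall w, box (z.1 - d) (z.1 + d) (z.2 - d) (z.2 + d) w -> K w ->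
      `|k z - k w| < e.
  move=> ck; have /cvgrPdist_lt /(_ _ e0) hk := ck z.
  have : within K (nbhs z) (fun w => `|k z - k w| < e).
    by rewrite (nbhs_subspace_in Kz); exact: hk.
  rewrite /within/= => /nbhs_boxP[d d0 hd]; by exists d.
have [d d0 hd] := near_f f cf; have [d' d'0 hd'] := near_f g cg.
pose m := Num.min d d'.
have m0 : 0 < m by rewrite lt_min d0.
have [md md'] : m <= d /\ m <= d' by split; rewrite ge_min lexx ?orbT.
have [z1 z2] := Kz; move: z1 z2; rewrite /= !in_itv/= => /andP[z1 z1'] /andP[z2 z2'].
have [] := @ae_box_neq0 (Num.max a1 (z.1 - m)) (Num.min b1 (z.1 + m))
  (Num.max a2 (z.2 - m)) (Num.min b2 (z.2 + m)) _ _ _ fg.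
- by rewrite gt_max !lt_min h1; apply/andP; split; [apply/andP; split|apply/andP; split]; lra.
- by rewrite gt_max !lt_min h2; apply/andP; split; [apply/andP; split|apply/andP; split]; lra.
move=> w /boxE; rewrite !gt_max !lt_min.
move=> /andP[/andP[/andP[w1 w2] /andP[w3 w4]] /andP[/andP[w5 w6] /andP[w7 w8]]].
have Kw : K w by split; rewrite /= in_itv/=; apply/andP; split; lra.
move=> /(_ Kw) fgw.
have hf : `|f z - f w| < e.
  by apply: hd => //; apply/boxE; apply/andP; split; apply/andP; split; lra.
have hg : `|g z - g w| < e.
  by apply: hd' => //; apply/boxE; apply/andP; split; apply/andP; split; lra.
have : `|f z - g z| < e + e.
  have -> : f z - g z = (f z - f w) - (g z - g w) by rewrite fgw; ring.
  by rewrite (le_lt_trans (ler_normB _ _))// ltrD.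
by rewrite /e -splitr ltxx.
Qed.

End PlaneTopology.

(** * Weak derivatives on a rectangle *)

Section WeakDerivativePlane.
Variable R : realType.
Notation mu1 := (@lebesgue_measure R).
Notation mu2 := (mu1 \x mu1)%E.
Implicit Types (f g : R * R -> R) (al be eta psi : R -> R) (z p : R * R).
Implicit Types (a b x y s t k : R).

Definition off2 a1 b1 a2 b2 f :=
  forall z, ~~ ((a1 < z.1 < b1) && (a2 < z.2 < b2)) -> f z = 0.

(** The weak derivative in the first variable, tested on tensor products only: they are enough
    because an integrable function that annihilates them vanishes. *)
Definition weakx a1 b1 a2 b2 f g := forall eta psi, bump a1 b1 eta -> bump a2 b2 psi ->
  \int[mu2]_z (f z * (derive1 eta z.1 * psi z.2)) =
  - \int[mu2]_z (g z * (eta z.1 * psi z.2)).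

Definition weaky a1 b1 a2 b2 f g := forall eta psi, bump a1 b1 eta -> bump a2 b2 psi ->
  \int[mu2]_z (f z * (eta z.1 * derive1 psi z.2)) =
  - \int[mu2]_z (g z * (eta z.1 * psi z.2)).

Lemma measurable_comp1 al : measurable_fun setT al ->
  measurable_fun setT (fun z : R * R => al z.1).
Proof. by move=> mal; apply: (measurableT_comp mal). Qed.

Lemma measurable_comp2 al : measurable_fun setT al ->
  measurable_fun setT (fun z : R * R => al z.2).
Proof. by move=> mal; apply: (measurableT_comp mal). Qed.

Lemma rintegrableM2 k (h f : R * R -> R) : measurable_fun setT h -> (forall z, `|h z| <= k) ->
  rintegrable mu2 f -> rintegrable mu2 (fun z => h z * f z).
Proof. by move=> mh hk sf; apply: (@rintegrableM _ _ _ mu2 k). Qed.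

Lemma rintegrable_mul1 k al f : measurable_fun setT al -> (forall x, `|al x| <= k) ->
  rintegrable mu2 f -> rintegrable mu2 (fun z => al z.1 * f z).
Proof. by move=> mal alk; apply: (@rintegrableM2 k) => //; exact: measurable_comp1. Qed.

Lemma rintegrable_mul2 k al f : measurable_fun setT al -> (forall x, `|al x| <= k) ->
  rintegrable mu2 f -> rintegrable mu2 (fun z => al z.2 * f z).
Proof. by move=> mal alk; apply: (@rintegrableM2 k) => //; exact: measurable_comp2. Qed.

Lemma rfubini_mul1 k al f : measurable_fun setT al -> (forall x, `|al x| <= k) ->
  rintegrable mu2 f ->
  \int[mu2]_z (al z.1 * f z) = \int[mu1]_x (al x * \int[mu1]_y f (x, y)).
Proof.
move=> mal alk sf; have saf := rintegrable_mul1 mal alk sf.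
rewrite rfubini1//; apply: rint_ae; first exact: (rintegrable_fubini1 saf).
  by apply: measurable_funM => //; exact: rintegrable_meas (rintegrable_fubini1 sf).
apply: (@filterS _ _ (ae_filter_ringOfSetsType mu1) _ _ _ (ae_fubini1 sf)) => x sx.
by rewrite /= rintZ.
Qed.

Lemma rfubini_mul2 k al f : measurable_fun setT al -> (forall x, `|al x| <= k) ->
  rintegrable mu2 f ->
  \int[mu2]_z (al z.2 * f z) = \int[mu1]_y (al y * \int[mu1]_x f (x, y)).
Proof.
move=> mp pk sv; have sv' := rintegrable_transpose sv.
have := rfubini_mul1 mp pk sv'; rewrite -[LHS]rint_transpose; last exact: rintegrable_mul1 pk sv'.
rewrite {1}/transpose /= /transpose/= => E.
by rewrite (@eq_rint _ _ _ mu2 _ (fun x : R * R => al x.2 * f (x.1, x.2))); last by case.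
Qed.

Lemma rintegrable_bump2 a1 b1 a2 b2 f eta psi : rintegrable mu2 f ->
  bump a1 b1 eta -> bump a2 b2 psi -> rintegrable mu2 (fun z => f z * (eta z.1 * psi z.2)).
Proof.
move=> sf beta bpsi.
have [k1 Hk1] := bump_bounded beta; have meta := bump_measurable beta.
have [k2 Hk2] := bump_bounded bpsi; have mpsi := bump_measurable bpsi.
have := rintegrable_mul1 meta Hk1 (rintegrable_mul2 mpsi Hk2 sf).
by congr (rintegrable _ _); apply/funext => z; rewrite mulrA mulrC.
Qed.

Lemma off2_fubini1 a1 b1 a2 b2 f be : off2 a1 b1 a2 b2 f ->
  off a1 b1 (fun x => \int[mu1]_y (be y * f (x, y))).
Proof.
move=> of2 x xab; rewrite (@eq_rint _ _ _ mu1 _ (fun=> 0)).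
  by rewrite Rintegral_cst ?mul0r.
by move=> y; rewrite of2 ?mulr0// negb_and /= xab.
Qed.

Lemma off2_transpose a1 b1 a2 b2 f : off2 a1 b1 a2 b2 f ->
  off2 a2 b2 a1 b1 (transpose f).
Proof. by move=> of2 z h; apply: of2; rewrite andbC. Qed.

Lemma off2_mul a1 b1 a2 b2 (h f : R * R -> R) : off2 a1 b1 a2 b2 f ->
  off2 a1 b1 a2 b2 (fun z => h z * f z).
Proof. by move=> of2 z /of2 ->; rewrite mulr0. Qed.

Lemma off2_add a1 b1 a2 b2 f g : off2 a1 b1 a2 b2 f -> off2 a1 b1 a2 b2 g ->
  off2 a1 b1 a2 b2 (fun z => f z + g z).
Proof. by move=> of2 og2 z h; rewrite of2// og2// addr0. Qed.

Lemma rint_transpose_bump a1 b1 a2 b2 f eta psi : rintegrable mu2 f ->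
  bump a1 b1 eta -> bump a2 b2 psi ->
  \int[mu2]_z (transpose f z * (psi z.1 * eta z.2)) =
  \int[mu2]_z (f z * (eta z.1 * psi z.2)).
Proof.
move=> sf beta bpsi; rewrite -[RHS]rint_transpose; last exact: rintegrable_bump2 sf beta bpsi.
by apply: eq_rint => z; rewrite /transpose /= [eta _ * _]mulrC.
Qed.

Lemma weakx_transpose a1 b1 a2 b2 f g : rintegrable mu2 f -> rintegrable mu2 g ->
  weakx a1 b1 a2 b2 f g -> weaky a2 b2 a1 b1 (transpose f) (transpose g).
Proof.
move=> sf sg w psi eta bpsi beta; have := w _ _ beta bpsi.
by rewrite (rint_transpose_bump sf (bump_derive1 beta) bpsi) (rint_transpose_bump sg beta bpsi).
Qed.

Lemma weaky_transpose a1 b1 a2 b2 f g : rintegrable mu2 f -> rintegrable mu2 g ->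
  weaky a1 b1 a2 b2 f g -> weakx a2 b2 a1 b1 (transpose f) (transpose g).
Proof.
move=> sf sg w psi eta bpsi beta; have := w _ _ beta bpsi.
by rewrite (rint_transpose_bump sf beta (bump_derive1 bpsi)) (rint_transpose_bump sg beta bpsi).
Qed.

(** The test functions of the variable that is not differentiated can be replaced by arbitrary
    bounded weights: the other factor being fixed, integration in that variable leaves an
    integrable function to which the fundamental lemma on the line applies. *)
Lemma weaky_slice a1 b1 a2 b2 f g k al : rintegrable mu2 f -> rintegrable mu2 g ->
  off2 a1 b1 a2 b2 f -> off2 a1 b1 a2 b2 g -> weaky a1 b1 a2 b2 f g ->
  measurable_fun setT al -> (forall x, `|al x| <= k) ->
  weak1 a2 b2 (fun y => \int[mu1]_x (al x * f (x, y))) (fun y => \int[mu1]_x (al x * g (x, y))).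
Proof.
move=> sf sg of2 og2 w mal alk psi bpsi.
have [k2 Hk2] := bump_bounded bpsi; have [k3 Hk3] := bump_bounded (bump_derive1 bpsi).
have mpsi := bump_measurable bpsi; have mpsi' := bump_measurable (bump_derive1 bpsi).
pose u z := derive1 psi z.2 * f z + psi z.2 * g z.
have sfp : rintegrable mu2 (fun z => derive1 psi z.2 * f z) by exact: rintegrable_mul2 Hk3 sf.
have sgp : rintegrable mu2 (fun z => psi z.2 * g z) by exact: rintegrable_mul2 Hk2 sg.
have su : rintegrable mu2 u by exact: rintegrableD.
have ou : off2 a1 b1 a2 b2 u by move=> z h; rewrite /u of2// og2// !mulr0 addr0.
pose X x := \int[mu1]_y u (x, y).
have X0 : {ae mu1, forall x, X x = 0}.
  apply: (@bump_fundamental _ a1 b1).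
  - exact: rintegrable_fubini1.
  - move=> x xab; rewrite /X (@eq_rint _ _ _ mu1 _ (fun=> 0)); first by rewrite Rintegral_cst ?mul0r.
    by move=> y; rewrite ou// negb_and xab.
  - move=> eta beta; have [k1 Hk1] := bump_bounded beta.
    have meta := bump_measurable beta.
    rewrite (eq_rint mu1 (fun x => mulrC (X x) (eta x))) /X -(rfubini_mul1 meta Hk1 su).
    rewrite /u (@eq_rint _ _ _ mu2 _ (fun z => eta z.1 * (derive1 psi z.2 * f z) + eta z.1 * (psi z.2 * g z))).
      rewrite rintD; [|exact: rintegrable_mul1 Hk1 sfp|exact: rintegrable_mul1 Hk1 sgp].
      have := w _ _ beta bpsi => E.
      rewrite (@eq_rint _ _ _ mu2 _ (fun z => f z * (eta z.1 * derive1 psi z.2))).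
        rewrite E (@eq_rint _ _ _ mu2 (fun z => eta z.1 * (psi z.2 * g z)) (fun z => g z * (eta z.1 * psi z.2))).
          by rewrite addNr.
        by move=> z; ring.
      by move=> z; ring.
    by move=> z; rewrite mulrDr.
have E0 : \int[mu2]_z (al z.1 * u z) = 0.
  rewrite (rfubini_mul1 mal alk su) -/X.
  have sX : rintegrable mu1 X by exact: rintegrable_fubini1.
  rewrite (@rint_ae _ _ _ mu1 _ (fun=> 0)) ?Rintegral_cst ?mul0r//.
    exact: (rintegrableM1 mal alk sX).
  by apply: (@filterS _ _ (ae_filter_ringOfSetsType mu1) _ _ _ X0) => x Xx; rewrite -/(X x) Xx mulr0.
have saf := rintegrable_mul1 mal alk sf; have sag := rintegrable_mul1 mal alk sg.
have rev (v : R * R -> R) (q : R -> R) kq : measurable_fun setT q -> (forall x, `|q x| <= kq) ->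
    rintegrable mu2 v ->
    \int[mu2]_z (q z.2 * v z) = \int[mu1]_y ((\int[mu1]_x v (x, y)) * q y).
  by move=> mq qk sv; rewrite (rfubini_mul2 mq qk sv); apply: eq_rint => y; rewrite mulrC.
rewrite -(rev _ _ _ mpsi' Hk3 saf) -(rev _ _ _ mpsi Hk2 sag).
apply/eqP; rewrite -addr_eq0 -rintD; [|exact: rintegrable_mul2 Hk3 saf|exact: rintegrable_mul2 Hk2 sag].
rewrite -[X in _ == X]E0; apply/eqP/eq_rint => z; rewrite /u; ring.
Qed.

Lemma weakx_slice a1 b1 a2 b2 f g k be : rintegrable mu2 f -> rintegrable mu2 g ->
  off2 a1 b1 a2 b2 f -> off2 a1 b1 a2 b2 g -> weakx a1 b1 a2 b2 f g ->
  measurable_fun setT be -> (forall x, `|be x| <= k) ->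
  weak1 a1 b1 (fun x => \int[mu1]_y (be y * f (x, y))) (fun x => \int[mu1]_y (be y * g (x, y))).
Proof.
move=> sf sg of2 og2 /weakx_transpose w mbe bek.
exact: (weaky_slice (rintegrable_transpose sf) (rintegrable_transpose sg)
  (off2_transpose of2) (off2_transpose og2) (w sf sg) mbe bek).
Qed.

Lemma weaky_mul a1 b1 a2 b2 f g k al : rintegrable mu2 f -> rintegrable mu2 g ->
  off2 a1 b1 a2 b2 f -> off2 a1 b1 a2 b2 g -> weaky a1 b1 a2 b2 f g ->
  measurable_fun setT al -> (forall x, `|al x| <= k) ->
  weaky a1 b1 a2 b2 (fun z => al z.1 * f z) (fun z => al z.1 * g z).
Proof.
move=> sf sg of2 og2 w mal alk eta psi beta bpsi.
have [k1 Hk1] := bump_bounded beta; have meta := bump_measurable beta.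
have [k2 Hk2] := bump_bounded bpsi; have [k3 Hk3] := bump_bounded (bump_derive1 bpsi).
have mpsi := bump_measurable bpsi; have mpsi' := bump_measurable (bump_derive1 bpsi).
have m2 : measurable_fun setT (fun x => al x * eta x) by exact: measurable_funM.
have k4 x : `|al x * eta x| <= k * k1.
  by rewrite normrM ler_pM.
have := weaky_slice sf sg of2 og2 w m2 k4 bpsi.
have rev (v : R * R -> R) (q : R -> R) kq : measurable_fun setT q -> (forall x, `|q x| <= kq) ->
    rintegrable mu2 v ->
    \int[mu1]_y ((\int[mu1]_x (al x * eta x * v (x, y))) * q y) =
    \int[mu2]_z (al z.1 * v z * (eta z.1 * q z.2)).
  move=> mq qk sv; have sav := rintegrable_mul1 m2 k4 sv.
  rewrite (@eq_rint _ _ _ mu2 _ (fun z => q z.2 * (al z.1 * eta z.1 * v z))).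
    by rewrite (rfubini_mul2 mq qk sav); apply: eq_rint => y; rewrite mulrC.
  by move=> z /=; ring.
by rewrite (rev _ _ _ mpsi' Hk3)// (rev _ _ _ mpsi Hk2).
Qed.

Lemma weaky_add a1 b1 a2 b2 f g f' g' : rintegrable mu2 f -> rintegrable mu2 g ->
  rintegrable mu2 f' -> rintegrable mu2 g' ->
  weaky a1 b1 a2 b2 f g -> weaky a1 b1 a2 b2 f' g' ->
  weaky a1 b1 a2 b2 (fun z => f z + f' z) (fun z => g z + g' z).
Proof.
move=> sf sg sf' sg' w w' eta psi beta bpsi; have bp' := bump_derive1 bpsi.
under eq_rint do rewrite mulrDl; under [in RHS]eq_rint do rewrite mulrDl.
rewrite rintD; [|exact: (rintegrable_bump2 sf beta bp')|exact: (rintegrable_bump2 sf' beta bp')].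
rewrite rintD; [|exact: (rintegrable_bump2 sg beta bpsi)|exact: (rintegrable_bump2 sg' beta bpsi)].
by rewrite w// w'// opprD.
Qed.

(** The sets over which the integral vanishes form a Dynkin system, and the measurable rectangles
    generate the product $\sigma$-algebra. *)
Lemma rectangles_ae0 f : rintegrable mu2 f ->
  (forall al be, measurable_fun setT al -> measurable_fun setT be ->
     (forall x, `|al x| <= 1) -> (forall y, `|be y| <= 1) ->
     \int[mu2]_z (al z.1 * be z.2 * f z) = 0) ->
  {ae mu2, forall z, f z = 0}.
Proof.
move=> sf H.
have mS (S : set (R * R)) : measurable S -> mu2.-integrable S (EFin \o f).
  by move=> mS; apply: (integrableS measurableT).
have ET : (\int[mu2]_(z in setT) (f z)%:E = 0)%E.
  have := H (fun=> 1) (fun=> 1).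
  rewrite (@eq_rint _ _ _ mu2 _ f); last by move=> z; rewrite !mul1r.
  move=> h; apply/eqP; rewrite -fine_eq0; last exact: integrable_fin_num.
  by apply/eqP; apply: h => // x; rewrite normr1.
have key : forall S : set (R * R), measurable S -> (\int[mu2]_(z in S) (f z)%:E = 0)%E.
  move=> S; rewrite measurable_prod_measurableType; move: S.
  apply: (@dynkin_induction _ _ _ (fun S => (\int[mu2]_(z in S) (f z)%:E = 0)%E)
    (@measurable_prod_measurableType _ _ _ _)).
  - move=> _ _ [A mA [B mB <-]] [A' mA' [B' mB' <-]].
    by rewrite -setXI; exists (A `&` A'); [exact: measurableI|exists (B `&` B') => //; exact: measurableI].
  - exact: ET.
  - move=> _ [A mA [B mB <-]].
    have := H \1_A \1_B; rewrite (@eq_rint _ _ _ mu2 _ (f \_ (A `*` B))).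
      rewrite -Rintegral_mkcond => h; apply/eqP.
      rewrite -fine_eq0; last by apply: integrable_fin_num => //; [exact: measurableX|apply: mS; exact: measurableX].
      apply/eqP; apply: h => // x; rewrite ?indicE ?ind_le1//.
    move=> [x y]; rewrite patchE !indicE /= in_setX/=.
    by case: (x \in A); case: (y \in B); rewrite ?mul1r ?mulr0 ?mul0r.
  - move=> S mS' S0.
    have : (\int[mu2]_(z in setT) (f z)%:E = 0)%E by [].
    rewrite -(setUv S) integral_setU_EFin//; [|exact: measurableC| |].
    + by rewrite [X in (X + _)%E]S0 add0e.
    + by rewrite setUv; exact: rintegrable_meas sf.
    + by apply/disj_setPS; rewrite setICr.
  - move=> F mF tF F0; rewrite integral_bigcup//.
      by apply: eseries0 => n _ _; exact: F0.
    by apply: mS; exact: bigcupT_measurable.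
have := @integral_ae_eq _ _ _ mu2 setT measurableT (cst 0%E) (EFin \o f) sf.
move=> /(_ (measurable_cst _)) h.
have {}h : ae_eq mu2 setT (EFin \o f) (cst 0%E).
  by apply: h => S _ mS'; rewrite key// integral0.
apply: (@filterS _ _ (ae_filter_ringOfSetsType mu2) _ _ _ h) => z /= /(_ I).
by move=> [].
Qed.

End WeakDerivativePlane.

(** * Continuous representatives *)

Section Representative.
Variable R : realType.
Notation mu1 := (@lebesgue_measure R).
Notation mu2 := (mu1 \x mu1)%E.
Implicit Types (f g : R * R -> R) (al be eta psi : R -> R) (z p : R * R).
Implicit Types (a b x y s t k : R).

Lemma rintegrable_kern1 a1 b1 a2 b2 x f : rintegrable mu2 f -> off2 a1 b1 a2 b2 f ->
  rintegrable mu2 (fun z => kern a1 b1 x z.1 * f z).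
Proof.
move=> sf of2; have -> : (fun z => kern a1 b1 x z.1 * f z) =
    fun z => (ind_itv a1 b1 z.1 * kern a1 b1 x z.1) * f z.
  apply/funext => z; rewrite /ind_itv; case: (boolP (a1 < z.1 < b1)) => h; first by rewrite mul1r.
  by rewrite of2 ?mulr0// negb_and h.
apply: (@rintegrable_mul1 _ `|b1 - a1| (fun s => ind_itv a1 b1 s * kern a1 b1 x s)) => //.
  by apply: measurable_funM; [exact: measurable_ind_itv|exact: measurable_kern].
exact: kern_ind_le.
Qed.

Lemma rintegrable_kern2 a1 b1 a2 b2 y f : rintegrable mu2 f -> off2 a1 b1 a2 b2 f ->
  rintegrable mu2 (fun z => kern a2 b2 y z.2 * f z).
Proof.
move=> sf of2; have := rintegrable_kern1 y (rintegrable_transpose sf) (off2_transpose of2).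
move/rintegrable_transpose; congr (rintegrable _ _).
by apply/funext => -[].
Qed.

Lemma rint_kern2 a1 b1 a2 b2 y f : rintegrable mu2 f -> off2 a1 b1 a2 b2 f ->
  \int[mu2]_z (kern a2 b2 y z.2 * f z) = \int[mu1]_t (kern a2 b2 y t * \int[mu1]_s f (s, t)).
Proof.
move=> sf of2; rewrite (@eq_rint _ _ _ mu2 _ (fun z => (ind_itv a2 b2 z.2 * kern a2 b2 y z.2) * f z)).
  rewrite (@rfubini_mul2 _ `|b2 - a2| (fun s => ind_itv a2 b2 s * kern a2 b2 y s))//.
  - apply: eq_rint => t; rewrite /ind_itv; case: (boolP (a2 < t < b2)) => h; first by rewrite mul1r.
    rewrite (@eq_rint _ _ _ mu1 (fun s => f (s, t)) (fun=> 0)).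
      by rewrite Rintegral_cst ?mul0r ?mulr0.
    by move=> s; rewrite of2// negb_and h orbT.
  - by apply: measurable_funM; [exact: measurable_ind_itv|exact: measurable_kern].
  - exact: kern_ind_le.
move=> z; rewrite /ind_itv; case: (boolP (a2 < z.2 < b2)) => h; first by rewrite mul1r.
by rewrite of2 ?mulr0// negb_and h orbT.
Qed.

Lemma cvg_kern a b (u : nat -> R) x s : u n @[n --> \oo] --> x -> s != x ->
  kern a b (u n) s @[n --> \oo] --> kern a b x s.
Proof.
move=> ux sx; apply: cvg_near_cst.
have [lt|lt] : x < s \/ s < x by apply/orP; rewrite -neq_lt eq_sym.
  near=> n; rewrite /kern (ltW lt).
  by have -> : (u n <= s)%R by apply: ltW; near: n; exact: (cvgr_lt _ ux _ lt).
near=> n; rewrite /kern !leNgt lt.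
by have -> : (s < u n)%R by near: n; exact: (cvgr_gt _ ux _ lt).
Unshelve. all: by end_near. Qed.

Lemma ae_not_on_lines x y : {ae mu2, forall z : R * R, z.1 != x /\ z.2 != y}.
Proof.
exists (([set x] `*` setT) `|` (setT `*` [set y])); split.
- by apply: measurableU; apply: measurableX.
- apply/eqP; rewrite -measure_le0; apply: le_trans (measureU2 _ _ _) _ => //;
    try exact: measurableX.
  rewrite [X in (X + _)%E](_ : _ = 0%E) ?add0e; last first.
    rewrite [LHS]product_measure1E// [X in (X * _)%E](_ : _ = 0%E) ?mul0e//.
    exact: lebesgue_measure_set1.
  rewrite [X in (X <= _)%E](_ : _ = 0%E)//.
  rewrite [LHS]product_measure1E// [X in (_ * X)%E](_ : _ = 0%E) ?mule0//.
  exact: lebesgue_measure_set1.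
- move=> [s t] /= h; apply: contrapT => h'; apply: h; split; apply/eqP => E; apply: h'.
    by left; split.
  by right; split.
Qed.

Lemma weaky_marginal a1 b1 a2 b2 f g : rintegrable mu2 f -> rintegrable mu2 g ->
  off2 a1 b1 a2 b2 f -> off2 a1 b1 a2 b2 g -> weaky a1 b1 a2 b2 f g ->
  weak1 a2 b2 (fun y => \int[mu1]_x f (x, y)) (fun y => \int[mu1]_x g (x, y)).
Proof.
move=> sf sg of2 og2 w.
have one1 (s : R) : `|(fun=> 1) s : R| <= 1 by rewrite normr1.
have m1 : measurable_fun setT ((fun=> 1) : R -> R) by exact: measurable_cst.
have := weaky_slice sf sg of2 og2 w m1 one1.
have E1 h : (fun y => \int[mu1]_s (1 * h (s, y))) = fun y => \int[mu1]_s h (s, y).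
  by apply/funext => y; apply: eq_rint => s; rewrite mul1r.
by rewrite !E1.
Qed.

Lemma weaky_kern1 a1 b1 a2 b2 x f g : rintegrable mu2 f -> rintegrable mu2 g ->
  off2 a1 b1 a2 b2 f -> off2 a1 b1 a2 b2 g -> weaky a1 b1 a2 b2 f g ->
  weaky a1 b1 a2 b2 (fun z => kern a1 b1 x z.1 * f z) (fun z => kern a1 b1 x z.1 * g z).
Proof.
move=> sf sg of2 og2 w.
have E (q : R * R -> R) : off2 a1 b1 a2 b2 q -> (fun z => kern a1 b1 x z.1 * q z) =
    fun z => (ind_itv a1 b1 z.1 * kern a1 b1 x z.1) * q z.
  move=> oq; apply/funext => z; rewrite /ind_itv.
  case: (boolP (a1 < z.1 < b1)) => h; first by rewrite mul1r.
  by rewrite oq ?mulr0// negb_and h.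
rewrite !E//; apply: (@weaky_mul _ _ _ _ _ _ _ `|b1 - a1| (fun s => ind_itv a1 b1 s * kern a1 b1 x s)) => //.
  by apply: measurable_funM; [exact: measurable_ind_itv|exact: measurable_kern].
exact: kern_ind_le.
Qed.

Section Rectangle.
Variables (a1 b1 a2 b2 : R) (v v1 v2 v12 : R * R -> R).
Hypotheses (ab1 : a1 < b1) (ab2 : a2 < b2).
Hypotheses (sv : rintegrable mu2 v) (sv1 : rintegrable mu2 v1)
  (sv2 : rintegrable mu2 v2) (sv12 : rintegrable mu2 v12).
Hypotheses (ov : off2 a1 b1 a2 b2 v) (ov1 : off2 a1 b1 a2 b2 v1)
  (ov2 : off2 a1 b1 a2 b2 v2) (ov12 : off2 a1 b1 a2 b2 v12).
Hypotheses (wx : weakx a1 b1 a2 b2 v v1) (wy : weaky a1 b1 a2 b2 v v2).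
Hypotheses (wxy : weaky a1 b1 a2 b2 v1 v12).

(** [rep] is [weak1_rep] in each variable successively. It needs one derivative in each variable
    and the mixed one, and no smoothness beyond integrability. *)
Definition rep_integrand p z :=
  (v z + kern a1 b1 p.1 z.1 * v1 z) +
  kern a2 b2 p.2 z.2 * (v2 z + kern a1 b1 p.1 z.1 * v12 z).

Definition rep p := (b2 - a2)^-1 * ((b1 - a1)^-1 * \int[mu2]_z rep_integrand p z).

Let slicex x z := v z + kern a1 b1 x z.1 * v1 z.
Let slicex2 x z := v2 z + kern a1 b1 x z.1 * v12 z.

Let sslicex x : rintegrable mu2 (slicex x).
Proof. by apply: rintegrableD => //; exact: rintegrable_kern1 _ sv1 ov1. Qed.

Let sslicex2 x : rintegrable mu2 (slicex2 x).
Proof. by apply: rintegrableD => //; exact: rintegrable_kern1 _ sv12 ov12. Qed.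

Let oslicex x : off2 a1 b1 a2 b2 (slicex x).
Proof. by apply: off2_add => //; exact: (off2_mul (fun z => kern a1 b1 x z.1)). Qed.

Let oslicex2 x : off2 a1 b1 a2 b2 (slicex2 x).
Proof. by apply: off2_add => //; exact: (off2_mul (fun z => kern a1 b1 x z.1)). Qed.

Lemma rintegrable_rep_integrand p : rintegrable mu2 (rep_integrand p).
Proof. exact: (rintegrableD (sslicex p.1) (rintegrable_kern2 p.2 (sslicex2 p.1) (oslicex2 p.1))). Qed.

Definition rep_bound z :=
  `|v z| + (b1 - a1) * `|v1 z| + (b2 - a2) * (`|v2 z| + (b1 - a1) * `|v12 z|).

Lemma rintegrable_rep_bound : rintegrable mu2 rep_bound.
Proof.
by apply: rintegrableD; [|apply: rintegrableZ]; apply: rintegrableD;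
  try (apply: rintegrableZ); exact: rintegrable_norm.
Qed.

Lemma norm_rep_integrand p z : `|rep_integrand p z| <= rep_bound z.
Proof.
have b10 : 0 <= b1 - a1 by rewrite subr_ge0 ltW.
have b20 : 0 <= b2 - a2 by rewrite subr_ge0 ltW.
have [/andP[h1 h2]|h] := boolP ((a1 < z.1 < b1) && (a2 < z.2 < b2)); last first.
  rewrite /rep_integrand ov// ov1// ov2// ov12// !(mulr0, addr0, normr0).
  by rewrite !addr_ge0// mulr_ge0// addr_ge0// mulr_ge0.
have k1 := norm_kern p.1 h1; have k2 := norm_kern p.2 h2.
rewrite /rep_integrand /rep_bound; apply: le_trans (ler_normD _ _) _; apply: lerD.
  by apply: le_trans (ler_normD _ _) _; rewrite lerD// normrM ler_wpM2r.
rewrite normrM ler_pM//.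
by apply: le_trans (ler_normD _ _) _; rewrite lerD// normrM ler_wpM2r.
Qed.

(** The kernel is discontinuous in its parameter only on the line through the point, a null set,
    so dominated convergence applies. *)
Lemma continuous_rep : continuous rep.
Proof.
move=> p; apply: continuous_seq => u u1 u2; rewrite /rep.
apply: cvgMr; apply: cvgMr.
apply: (@rint_dominated _ _ _ mu2 (fun n => rep_integrand (u n)) (rep_integrand p) rep_bound).
- by move=> n; exact: rintegrable_meas (rintegrable_rep_integrand _).
- exact: rintegrable_meas (rintegrable_rep_integrand _).
- apply: (@filterS _ _ (ae_filter_ringOfSetsType mu2) _ _ _ (ae_not_on_lines p.1 p.2)).
  move=> z [z1 z2]; rewrite /rep_integrand.
  have c1 := @cvg_kern a1 b1 _ _ _ u1 z1; have c2 := @cvg_kern a2 b2 _ _ _ u2 z2.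
  by apply: cvgD; [apply: cvgD; [exact: cvg_cst|exact: cvgMl]|
    apply: cvgM => //; apply: cvgD; [exact: cvg_cst|exact: cvgMl]].
- exact: rintegrable_rep_bound.
- by move=> n z; exact: norm_rep_integrand.
Qed.

(** The slice $v+\kappa_x v_1$ averaged in the first variable is a function of the second one
    with an integrable weak derivative; [weak1_rep] represents it. This holds for every $x$, also
    on the sides of the rectangle, and therefore describes traces. *)
Lemma rep_vertical x : {ae mu1, forall y, ind_itv a2 b2 y * rep (x, y) =
  ind_itv a2 b2 y * ((b1 - a1)^-1 * \int[mu1]_s slicex x (s, y))}.
Proof.
have wk : weaky a1 b1 a2 b2 (slicex x) (slicex2 x).
  have s1 := rintegrable_kern1 x sv1 ov1; have s12 := rintegrable_kern1 x sv12 ov12.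
  exact: (weaky_add sv sv2 s1 s12 wy (weaky_kern1 x sv1 sv12 ov1 ov12 wxy)).
have w1 := weaky_marginal (sslicex x) (sslicex2 x) (oslicex x) (oslicex2 x) wk.
have sH := rintegrable_fubini2 (sslicex x); have sH2 := rintegrable_fubini2 (sslicex2 x).
have oH f : off2 a1 b1 a2 b2 f -> off a2 b2 (fun y => \int[mu1]_s f (s, y)).
  move=> of2 y yab; rewrite (@eq_rint _ _ _ mu1 _ (fun=> 0)).
    by rewrite Rintegral_cst ?mul0r.
  by move=> s; rewrite of2// negb_and yab orbT.
have := weak1_rep ab2 sH sH2 (oH _ (oslicex x)) (oH _ (oslicex2 x)) w1.
apply: (@filterS _ _ (ae_filter_ringOfSetsType mu1)) => y ->.
have EI : \int[mu2]_z rep_integrand (x, y) z = \int[mu1]_t (\int[mu1]_s slicex x (s, t) +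
    kern a2 b2 y t * \int[mu1]_s slicex2 x (s, t)).
  rewrite [RHS]rintD//; last exact: (rintegrable_kernM y sH2 (oH _ (oslicex2 x))).
  rewrite -(rint_kern2 y (sslicex2 x) (oslicex2 x)) -(rfubini2 (sslicex x)).
  by rewrite -rintD//; exact: rintegrable_kern2 _ (sslicex2 x) (oslicex2 x).
rewrite /rep EI /ind_itv; case: (a2 < y < b2); last by rewrite !mul0r.
by rewrite !mul1r mulrCA.
Qed.

(** It suffices to compare integrals against products $\alpha(x)\beta(y)$. The function
    $\int\beta v\,dy$ is represented by [weak1_rep] in the first variable, and what remains is the
    representation of slices in the second variable. *)
Lemma rep_ae : {ae mu2, forall z, ((a1 < z.1 < b1) && (a2 < z.2 < b2))%R%:R * rep z = v z}.
Proof.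
have cr := continuous_measurable2 continuous_rep.
pose I z : R := ind_itv a1 b1 z.1 * ind_itv a2 b2 z.2.
have IE z : ((a1 < z.1 < b1) && (a2 < z.2 < b2))%R%:R = I z.
  by rewrite /I /ind_itv; case: (a1 < z.1 < b1); case: (a2 < z.2 < b2); rewrite ?mulr1 ?mulr0.
have mI : measurable_fun setT I.
  by apply: measurable_funM; [apply: measurable_comp1|apply: measurable_comp2];
    exact: measurable_ind_itv.
have sI : rintegrable mu2 I.
  by apply: rintegrable_tensor; exact: rintegrable_ind_itv.
pose M := (b2 - a2)^-1 * ((b1 - a1)^-1 * \int[mu2]_z rep_bound z).
have repM z : `|rep z| <= M.
  have i1 : 0 <= (b1 - a1)^-1 by rewrite invr_ge0 subr_ge0 ltW.
  have i2 : 0 <= (b2 - a2)^-1 by rewrite invr_ge0 subr_ge0 ltW.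
  rewrite /rep normrM (ger0_norm i2) normrM (ger0_norm i1).
  apply: ler_wpM2l => //; apply: ler_wpM2l => //.
  apply: le_trans (rint_norm (rintegrable_rep_integrand z)) _.
  apply: rint_le; [exact/rintegrable_norm/rintegrable_rep_integrand|exact: rintegrable_rep_bound|].
  exact: norm_rep_integrand.
have sIr : rintegrable mu2 (fun z => I z * rep z).
  have := rintegrableM2 cr repM sI; congr (rintegrable _ _).
  by apply/funext => z; rewrite mulrC.
have h : {ae mu2, forall z, v z - I z * rep z = 0}.
  apply: rectangles_ae0; first exact: rintegrableB.
  move=> al be mal mbe al1 be1.
  have sbv := rintegrable_mul2 mbe be1 sv; have sbv1 := rintegrable_mul2 mbe be1 sv1.
  have sbr := rintegrable_mul2 mbe be1 sIr.
  have sab f : rintegrable mu2 f -> rintegrable mu2 (fun z => al z.1 * (be z.2 * f z)).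
    by move=> sf; apply: rintegrable_mul1 al1 _ => //; exact: rintegrable_mul2 be1 sf.
  rewrite (@eq_rint _ _ _ mu2 _ (fun z => al z.1 * (be z.2 * v z) - al z.1 * (be z.2 * (I z * rep z)))); last first.
    by move=> z; rewrite mulrBr !mulrA.
  rewrite rintB; [|exact: sab|exact: sab].
  apply/eqP; rewrite subr_eq0; apply/eqP.
  rewrite (rfubini_mul1 mal al1 sbv) (rfubini_mul1 mal al1 sbr).
  have sF := rintegrable_fubini1 sbv; have sG := rintegrable_fubini1 sbv1.
  have oF := off2_fubini1 be ov; have oG := off2_fubini1 be ov1.
  have := weak1_rep ab1 sF sG oF oG (weakx_slice sv sv1 ov ov1 wx mbe be1).
  move=> key; apply: rint_ae; first exact: (rintegrableM1 mal al1 sF).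
    by apply: measurable_funM => //; exact: rintegrable_meas (rintegrable_fubini1 sbr).
  apply: (@filterS _ _ (ae_filter_ringOfSetsType mu1) _ _ _ key) => x /= ->.
  congr (_ * _).
  have -> : \int[mu1]_s (\int[mu1]_y (be y * v (s, y)) + kern a1 b1 x s * \int[mu1]_y (be y * v1 (s, y)))
      = \int[mu2]_z (be z.2 * slicex x z).
    rewrite [RHS](@eq_rint _ _ _ mu2 _ (fun z => be z.2 * v z + kern a1 b1 x z.1 * (be z.2 * v1 z))); last first.
      by move=> z; rewrite /slicex mulrDr [in LHS]mulrCA.
    have obv1 := off2_mul (fun z => be z.2) ov1.
    rewrite [RHS]rintD//; last exact: (rintegrable_kern1 x sbv1 obv1).
    rewrite [LHS]rintD//; last exact: (rintegrable_kernM x sG oG).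
    congr (_ + _); first by rewrite rfubini1.
    have := rint_kern2 x (rintegrable_transpose sbv1) (off2_transpose obv1).
    rewrite -rint_transpose; first by move=> <-; apply: eq_rint => -[].
    exact: rintegrable_kern2 _ (rintegrable_transpose sbv1) (off2_transpose obv1).
  rewrite (rfubini_mul2 mbe be1 (sslicex x)).
  have sH := rintegrable_fubini2 (sslicex x).
  have sbH : rintegrable mu1 (fun y => be y * \int[mu1]_s slicex x (s, y)) by exact: rintegrableM1 be1 sH.
  rewrite -rintZ// -rintZ; last exact: rintegrableZ.
  apply: rint_ae; first by apply: rintegrableZ; exact: rintegrableZ.
    have mp : measurable_fun setT (fun y => rep (x, y)).
      exact: (measurableT_comp cr (pair1_measurable x)).
    have mI' : measurable_fun setT (fun y => I (x, y)).
      exact: (measurableT_comp mI (pair1_measurable x)).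
    apply: (measurable_funM (f := be)) => //; exact: (measurable_funM mI' mp).
  apply: (@filterS _ _ (ae_filter_ringOfSetsType mu1) _ _ _ (rep_vertical x)) => y E.
  rewrite /I /= -[in RHS]mulrA E /ind_itv.
  case: (boolP (a2 < y < b2)) => h.
    by rewrite mul1r [RHS]mulrCA; congr (_ * _); rewrite mulrCA.
  rewrite (@eq_rint _ _ _ mu1 (fun s => slicex x (s, y)) (fun=> 0)).
    by rewrite Rintegral_cst// !(mul0r, mulr0).
  by move=> s; rewrite oslicex// negb_and h orbT.
apply: (@filterS _ _ (ae_filter_ringOfSetsType mu2) _ _ _ h) => z /eqP.
by rewrite subr_eq0 IE => /eqP.
Qed.

End Rectangle.
End Representative.

(** * Partial derivatives and tensor products *)

Section Partials.
Variable R : realType.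
Implicit Types (v f g : R * R -> R) (eta psi : R -> R) (z : R * R).

Let hline1 (h : R) z : h *: ((1, 0) : R * R) + z = (h *: 1 + z.1, z.2).
Proof. by case: z => x y; congr (_, _) => /=; rewrite /GRing.scale/= mulr0 add0r. Qed.

Let hline2 (h : R) z : h *: ((0, 1) : R * R) + z = (z.1, h *: 1 + z.2).
Proof. by case: z => x y; congr (_, _) => /=; rewrite /GRing.scale/= mulr0 add0r. Qed.

Lemma is_derive_line1 v z l :
  is_derive z (1, 0) v l <-> is_derive z.1 1 (fun s => v (s, z.2)) l.
Proof.
have E : (fun h : R => h^-1 *: (v (h *: ((1, 0) : R * R) + z) - v z)) =
    fun h : R => h^-1 *: (v (h *: 1 + z.1, z.2) - v (z.1, z.2)).
  by apply/funext => h; rewrite hline1; case: z.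
by split=> -[d e]; split; [move: d; rewrite /derivable E|move: e; rewrite /derive E|
  rewrite /derivable E|rewrite /derive E].
Qed.

Lemma is_derive_line2 v z l :
  is_derive z (0, 1) v l <-> is_derive z.2 1 (fun s => v (z.1, s)) l.
Proof.
have E : (fun h : R => h^-1 *: (v (h *: ((0, 1) : R * R) + z) - v z)) =
    fun h : R => h^-1 *: (v (z.1, h *: 1 + z.2) - v (z.1, z.2)).
  by apply/funext => h; rewrite hline2; case: z.
by split=> -[d e]; split; [move: d; rewrite /derivable E|move: e; rewrite /derive E|
  rewrite /derivable E|rewrite /derive E].
Qed.

Lemma partial1_eq v g : (forall z, is_derive z.1 1 (fun s => v (s, z.2)) (g z)) ->
  partial1 v = g.
Proof. by move=> h; apply/funext => z; have [_] := (is_derive_line1 v z (g z)).2 (h z). Qed.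

Lemma partial2_eq v g : (forall z, is_derive z.2 1 (fun s => v (z.1, s)) (g z)) ->
  partial2 v = g.
Proof. by move=> h; apply/funext => z; have [_] := (is_derive_line2 v z (g z)).2 (h z). Qed.

Lemma Ck_intro k v g1 g2 : continuous v ->
  (forall z, is_derive z.1 1 (fun s => v (s, z.2)) (g1 z)) ->
  (forall z, is_derive z.2 1 (fun s => v (z.1, s)) (g2 z)) ->
  Ck k g1 -> Ck k g2 -> Ck k.+1 v.
Proof.
move=> cv h1 h2 k1 k2; split => //; [move=> z; split|by rewrite (partial1_eq h1)|by rewrite (partial2_eq h2)].
- by have [] := (is_derive_line1 v z (g1 z)).2 (h1 z).
- by have [] := (is_derive_line2 v z (g2 z)).2 (h2 z).
Qed.

Lemma Ck_continuous k v : Ck k v -> continuous v.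
Proof. by case: k => [//|k []]. Qed.

Lemma Ck_derive1 k v z : Ck k.+1 v -> is_derive z.1 1 (fun s => v (s, z.2)) (partial1 v z).
Proof. by move=> [_ /(_ z)[d _] _ _]; apply/is_derive_line1; split. Qed.

Lemma Ck_derive2 k v z : Ck k.+1 v -> is_derive z.2 1 (fun s => v (z.1, s)) (partial2 v z).
Proof. by move=> [_ /(_ z)[_ d] _ _]; apply/is_derive_line2; split. Qed.

Lemma CkS k v : Ck k.+1 v -> [/\ continuous v, Ck k (partial1 v) & Ck k (partial2 v)].
Proof. by move=> [cv dv h1 h2]. Qed.

Lemma Ck_pred k v : Ck k.+1 v -> Ck k v.
Proof.
elim: k v => [|k IH] v; first by case.
move=> [cv dv h1 h2]; exact: (And4 cv dv (IH _ h1) (IH _ h2)).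
Qed.

Lemma Ck_add k v g : Ck k v -> Ck k g -> Ck k (fun z => v z + g z).
Proof.
elim: k v g => [|k IH] v g; first by move=> cv cg z; apply: cvgD; [exact: cv|exact: cg].
move=> kv kg; have [cv h1 h2] := CkS kv; have [cg h1' h2'] := CkS kg.
apply: (@Ck_intro _ _ (fun z => partial1 v z + partial1 g z) (fun z => partial2 v z + partial2 g z)).
- by move=> z; apply: cvgD; [exact: cv|exact: cg].
- by move=> z; exact: (is_deriveD (Ck_derive1 z kv) (Ck_derive1 z kg)).
- by move=> z; exact: (is_deriveD (Ck_derive2 z kv) (Ck_derive2 z kg)).
- exact: IH.
- exact: IH.
Qed.

Lemma Ck_mul k v g : Ck k v -> Ck k g -> Ck k (fun z => v z * g z).
Proof.
elim: k v g => [|k IH] v g; first by move=> cv cg z; apply: cvgM; [exact: cv|exact: cg].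
move=> kv kg; have [cv h1 h2] := CkS kv; have [cg h1' h2'] := CkS kg.
have pv := Ck_pred kv; have pg := Ck_pred kg.
apply: (@Ck_intro _ _ (fun z => v z * partial1 g z + g z * partial1 v z)
  (fun z => v z * partial2 g z + g z * partial2 v z)).
- by move=> z; apply: cvgM; [exact: cv|exact: cg].
- by move=> z; have := is_deriveM (Ck_derive1 z kv) (Ck_derive1 z kg); case: z.
- by move=> z; have := is_deriveM (Ck_derive2 z kv) (Ck_derive2 z kg); case: z.
- by apply: Ck_add; exact: IH.
- by apply: Ck_add; exact: IH.
Qed.

Lemma Ck_fst k eta : smooth eta -> Ck k (fun z => eta z.1).
Proof.
elim: k eta => [|k IH] eta se.
  by move=> z; apply: continuous_comp; [exact: cvg_fst|exact: smooth_continuous].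
apply: (@Ck_intro _ _ (fun z => derive1 eta z.1) (fun=> 0)).
- by move=> z; apply: continuous_comp; [exact: cvg_fst|exact: smooth_continuous].
- by move=> z; exact: smooth_is_derive.
- by move=> z; exact: (is_derive_cst (eta z.1)).
- exact/IH/smooth_derive1.
- by apply: (IH (fun=> 0)); exact: smooth_cst.
Qed.

Lemma Ck_snd k eta : smooth eta -> Ck k (fun z => eta z.2).
Proof.
elim: k eta => [|k IH] eta se.
  by move=> z; apply: continuous_comp; [exact: cvg_snd|exact: smooth_continuous].
apply: (@Ck_intro _ _ (fun=> 0) (fun z => derive1 eta z.2)).
- by move=> z; apply: continuous_comp; [exact: cvg_snd|exact: smooth_continuous].
- by move=> z; exact: (is_derive_cst (eta z.2)).
- by move=> z; exact: smooth_is_derive.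
- by apply: (IH (fun=> 0)); exact: smooth_cst.
- exact/IH/smooth_derive1.
Qed.

Definition tensor eta psi z := eta z.1 * psi z.2.

Lemma Ck_tensor k eta psi : smooth eta -> smooth psi -> Ck k (tensor eta psi).
Proof. by move=> se sp; apply: Ck_mul; [exact: Ck_fst|exact: Ck_snd]. Qed.

Lemma partial1_tensor eta psi : smooth eta -> partial1 (tensor eta psi) = tensor (derive1 eta) psi.
Proof.
move=> se; apply: partial1_eq => z; rewrite /tensor /=.
have h := is_deriveM (smooth_is_derive z.1 se) (is_derive_cst (psi z.2) z.1 1).
by apply: (is_derive_eq h); rewrite /GRing.scale/= mulr0 add0r mulrC.
Qed.

Lemma partial2_tensor eta psi : smooth psi -> partial2 (tensor eta psi) = tensor eta (derive1 psi).
Proof.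
move=> sp; apply: partial2_eq => z; rewrite /tensor /=.
have h := is_deriveM (is_derive_cst (eta z.1) z.2 1) (smooth_is_derive z.2 sp).
by apply: (is_derive_eq h); rewrite /GRing.scale/= mulr0 addr0.
Qed.

Lemma smooth_derive1n n eta : smooth eta -> smooth (derive1n n eta).
Proof. by move=> se; elim: n => [//|n IH]; rewrite derive1nS; exact: smooth_derive1. Qed.

Lemma pderiv_tensor i j eta psi : smooth eta -> smooth psi ->
  pderiv (i, j) (tensor eta psi) = tensor (derive1n i eta) (derive1n j psi).
Proof.
move=> se sp; rewrite /pderiv /=.
have -> : iter j (@partial2 R) (tensor eta psi) = tensor eta (derive1n j psi).
  by elim: j => [//|j IH]; rewrite iterS IH partial2_tensor ?derive1nS//; exact: smooth_derive1n.
by elim: i => [//|i IH]; rewrite iterS IH partial1_tensor ?derive1nS//; exact: smooth_derive1n.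
Qed.

Lemma compact_box (c1 d1 c2 d2 : R) : compact (`[c1, d1]%classic `*` `[c2, d2]%classic).
Proof. by apply: compact_setX; exact: segment_compact. Qed.

Lemma test_tensor (U : set (R * R)) (a1 b1 a2 b2 : R) eta psi : box a1 b1 a2 b2 `<=` U ->
  bump a1 b1 eta -> bump a2 b2 psi -> test_function U (tensor eta psi).
Proof.
move=> sU [se [c1 [d1 [ac1 db1 e1]]]] [sp [c2 [d2 [ac2 db2 e2]]]]; split.
  by move=> k; exact: Ck_tensor.
exists (`[c1, d1]%classic `*` `[c2, d2]%classic); split; first exact: compact_box.
  move=> z [] /=; rewrite !in_itv/= => /andP[h1 h2] /andP[h3 h4]; apply/sU/boxE.
  by rewrite (lt_le_trans ac1)// (le_lt_trans h2)// (lt_le_trans ac2)// (le_lt_trans h4).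
move=> z; rewrite /tensor; have [h1|/negP h1] := boolP (c1 <= z.1 <= d1); last by rewrite e1 ?mul0r.
have [h2|/negP h2] := boolP (c2 <= z.2 <= d2); last by rewrite e2 ?mulr0.
by case; split; rewrite /= in_itv.
Qed.

End Partials.

(** * Classical integration by parts against test functions *)

Section PlaneIntegrationByParts.
Variable R : realType.
Notation mu1 := (@lebesgue_measure R).
Notation mu2 := (mu1 \x mu1)%E.
Implicit Types (u v f g phi : R * R -> R) (eta psi : R -> R) (z : R * R).
Implicit Types (U A : set (R * R)) (a b c d M : R).

(** The fundamental lemma on the line, applied in one variable after the other, replaces the
    bumps by arbitrary bounded weights. *)
Lemma bump_fundamental2 a1 b1 a2 b2 f : rintegrable mu2 f -> off2 a1 b1 a2 b2 f ->
  (forall eta psi, bump a1 b1 eta -> bump a2 b2 psi ->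
     \int[mu2]_z (f z * (eta z.1 * psi z.2)) = 0) ->
  {ae mu2, forall z, f z = 0}.
Proof.
move=> sf of2 H; apply: rectangles_ae0 => // al be mal mbe al1 be1.
have saf := rintegrable_mul1 mal al1 sf.
have mul0 (F G : R -> R) : rintegrable mu1 F -> measurable_fun setT G -> (forall x, `|G x| <= 1) ->
    {ae mu1, forall x, F x = 0} -> \int[mu1]_x (G x * F x) = 0.
  move=> sF mG G1 F0; rewrite (@rint_ae _ _ _ mu1 _ (fun=> 0)) ?Rintegral_cst ?mul0r//.
    exact: rintegrableM1 mG G1 sF.
  by apply: (@filterS _ _ (ae_filter_ringOfSetsType mu1) _ _ _ F0) => x ->; rewrite mulr0.
have h1 psi : bump a2 b2 psi -> \int[mu2]_z (al z.1 * (psi z.2 * f z)) = 0.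
  move=> bp; have [k Hk] := bump_bounded bp; have mp := bump_measurable bp.
  have sp := rintegrable_mul2 mp Hk sf.
  rewrite (rfubini_mul1 mal al1 sp); apply: mul0 => //; first exact: rintegrable_fubini1 sp.
  apply: (@bump_fundamental _ a1 b1); first exact: rintegrable_fubini1 sp.
    by move=> x xab; exact: (off2_fubini1 psi of2).
  move=> eta be'; have [k' Hk'] := bump_bounded be'; have me := bump_measurable be'.
  rewrite -(H _ _ be' bp) (eq_rint mu2 (fun z => mulrC (f z) (eta z.1 * psi z.2))).
  rewrite (eq_rint mu2 (fun z => esym (mulrA (eta z.1) (psi z.2) (f z)))).
  by rewrite (rfubini_mul1 me Hk' sp); apply: eq_rint => x; rewrite mulrC.
rewrite (@eq_rint _ _ _ mu2 _ (fun z => be z.2 * (al z.1 * f z))); last first.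
  by move=> z; rewrite mulrAC mulrC mulrA.
rewrite (rfubini_mul2 mbe be1 saf); apply: mul0 => //; first exact: rintegrable_fubini2 saf.
apply: (@bump_fundamental _ a2 b2); first exact: rintegrable_fubini2 saf.
  move=> y yab; rewrite (@eq_rint _ _ _ mu1 _ (fun=> 0)).
    by rewrite Rintegral_cst ?mul0r.
  by move=> x /=; rewrite of2 ?mulr0// negb_and yab orbT.
move=> psi bp; have [k Hk] := bump_bounded bp; have mp := bump_measurable bp.
rewrite -(h1 _ bp) (eq_rint mu2 (fun z => mulrCA (al z.1) (psi z.2) (f z))).
by rewrite (rfubini_mul2 mp Hk saf); apply: eq_rint => y; rewrite mulrC.
Qed.

Lemma compact_in_square A : compact A -> exists2 M, 0 < M &
  forall z, A z -> - M < z.1 < M /\ - M < z.2 < M.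
Proof.
move=> cA.
have h (i : R * R -> R) : continuous i -> exists M, forall z, A z -> `|i z| <= M.
  move=> ci; have := compact_bounded (continuous_compact (continuous_subspaceT ci) cA).
  move=> [M [_ HM]]; exists (M + 1) => z Az.
  by apply: (HM (M + 1)); [rewrite ltrDl|exists z].
have [M1 H1] := h fst (fun z => cvg_fst); have [M2 H2] := h snd (fun z => cvg_snd).
exists (`|M1| + `|M2| + 1); first by rewrite ltr_wpDl// addr_ge0.
move=> z Az; rewrite -!ltr_norml; split.
  by rewrite (le_lt_trans (H1 z Az))// -addrA (le_lt_trans (ler_norm _))// ltrDl ltr_wpDl.
rewrite (le_lt_trans (H2 z Az))// (le_lt_trans (ler_norm _))// [_ + `|M2|]addrC -addrA ltrDl.
by rewrite ltr_wpDl.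
Qed.

Lemma closed_measurable2 A : closed A -> measurable A.
Proof.
by move=> /closed_openC/open_measurable2/measurableC; rewrite setCK.
Qed.

Lemma compact_closed2 A : compact A -> closed A.
Proof. by apply: compact_closed; exact: norm_hausdorff. Qed.

Lemma compact_measurable2 A : compact A -> measurable A.
Proof. by move=> /compact_closed2/closed_measurable2. Qed.

Lemma bounded_on_compact A u : compact A -> continuous u -> exists k, forall z, A z -> `|u z| <= k.
Proof.
move=> cA cu; have := compact_bounded (continuous_compact (continuous_subspaceT cu) cA).
move=> [M [_ HM]]; exists (M + 1) => z Az.
by apply: (HM (M + 1)); [rewrite ltrDl|exists z].
Qed.

Lemma compact_lty A : compact A -> (mu2 A < +oo)%E.
Proof.
move=> cA; have [M M0 HM] := compact_in_square cA.
apply: (@le_lt_trans _ _ (mu2 (box (- M) M (- M) M))).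
  apply: le_measure; rewrite ?inE.
  - exact: compact_measurable2.
  - exact: measurable_box.
  - by move=> z /HM [h1 h2]; apply/boxE; rewrite h1 h2.
rewrite product_measure1E//.
have E : mu1 `]- M, M[ = (M - - M)%:E by rewrite lebesgue_measure_itv/= lte_fin gtrN.
by rewrite [X in (X < _)%E](_ : _ = ((M - - M) * (M - - M))%:E) ?ltry// EFinM -E.
Qed.

Lemma continuous_compact_integrable2 A u : compact A -> continuous u ->
  mu2.-integrable A (EFin \o u).
Proof.
move=> cA cu; have mA := compact_measurable2 cA.
have [k Hk] := bounded_on_compact cA cu.
apply: measurable_bounded_integrable => //.
- exact: compact_lty.
- by apply: (measurable_funS measurableT) => //; exact: continuous_measurable2.
- by exists k; split; [exact: num_real|move=> M kM z Az /=; rewrite (le_trans (Hk z Az))// ltW].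
Qed.

Lemma rintegrable_Cc A u : compact A -> continuous u -> (forall z, ~ A z -> u z = 0) ->
  rintegrable mu2 u.
Proof.
move=> cA cu u0; have h := continuous_compact_integrable2 cA cu.
have -> : u = u \_ A.
  by apply/funext => z; rewrite patchE; case: ifPn => //; rewrite notin_setE => /u0.
have mA := compact_measurable2 cA.
by rewrite /rintegrable -restrict_EFin; apply: (integrable_mkcond _ _).1 h.
Qed.

Lemma partial0 (e : R * R) A u z : closed A -> (forall z, ~ A z -> u z = 0) -> ~ A z ->
  'D_e u z = 0.
Proof.
move=> clA u0 nAz; rewrite (@near_eq_derive _ _ _ _ (fun=> 0)); first exact: derive_cst.
have : nbhs z (~` A) by apply: open_nbhs_nbhs; split => //; exact: closed_openC.
by apply: filterS => y /u0.
Qed.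

Lemma continuous_line1 u (y : R) : continuous u -> continuous (fun x : R => u (x, y)).
Proof.
move=> cu x; apply: (@continuous_comp R (R * R)%type R (fun x => (x, y)) u x); last exact: cu.
by apply: (@cvg_pair _ _ _ (nbhs x) (nbhs x) (nbhs y) _ _ _ id (fun=> y)); [exact: cvg_id|exact: cvg_cst].
Qed.

Lemma continuous_line2 u (x : R) : continuous u -> continuous (fun y : R => u (x, y)).
Proof.
move=> cu y; apply: (@continuous_comp R (R * R)%type R (fun y => (x, y)) u y); last exact: cu.
by apply: (@cvg_pair _ _ _ (nbhs y) (nbhs x) (nbhs y) _ _ _ (fun=> x) id); [exact: cvg_cst|exact: cvg_id].
Qed.

Lemma FTC_smooth (F f : R -> R) a b : a < b -> continuous f ->
  (forall x : R, is_derive x 1 F (f x)) ->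
  \int[mu1]_(x in `[a, b]) f x = F b - F a.
Proof.
move=> ab cf dF; have cF := is_derive_continuous dF.
rewrite /Rintegral (@continuous_FTC2 _ f F)//.
- exact: continuous_subspaceT.
- split; first by move=> x _; have [] := dF x.
  + by apply: cvg_at_right_filter; exact: cF.
  + by apply: cvg_at_left_filter; exact: cF.
- by move=> x _; rewrite derive1E; have [_] := dF x.
Qed.

Lemma rint_partial1_0 A u : compact A -> Ck 1 u -> (forall z, ~ A z -> u z = 0) ->
  \int[mu2]_z partial1 u z = 0.
Proof.
move=> cA ku u0; have [cu c1 c2] := CkS ku.
have p0 z : ~ A z -> partial1 u z = 0 by exact: partial0 (compact_closed2 cA) u0.
have sp := rintegrable_Cc cA c1 p0.
have [M M0 HM] := compact_in_square cA.
rewrite rfubini2// (@eq_rint _ _ _ mu1 _ (fun=> 0)) ?Rintegral_cst ?mul0r// => y.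
have -> : \int[mu1]_x partial1 u (x, y) = \int[mu1]_(x in `[- M, M]) partial1 u (x, y).
  rewrite [RHS]Rintegral_mkcond; apply: eq_rint => x; rewrite patchE.
  case: ifPn => //; rewrite notin_setE /= in_itv/= => h; apply: p0 => /HM[/andP[h1 h2] _].
  by apply: h; rewrite !ltW.
have cf := @continuous_line1 (partial1 u) y (Ck_continuous c1).
have df (x : R) : is_derive x 1 (fun x : R => u (x, y)) (partial1 u (x, y)).
  exact: (Ck_derive1 (x, y) ku).
have MM : - M < M by rewrite gtrN.
rewrite (FTC_smooth MM cf df) !u0 ?subrr//; first by move=> /HM[/=]; rewrite ltxx.
by move=> /HM[/=]; rewrite ltxx andbF.
Qed.

Lemma rint_partial2_0 A u : compact A -> Ck 1 u -> (forall z, ~ A z -> u z = 0) ->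
  \int[mu2]_z partial2 u z = 0.
Proof.
move=> cA ku u0; have [cu c1 c2] := CkS ku.
have p0 z : ~ A z -> partial2 u z = 0 by exact: partial0 (compact_closed2 cA) u0.
have sp := rintegrable_Cc cA c2 p0.
have [M M0 HM] := compact_in_square cA.
rewrite rfubini1// (@eq_rint _ _ _ mu1 _ (fun=> 0)) ?Rintegral_cst ?mul0r// => x.
have -> : \int[mu1]_y partial2 u (x, y) = \int[mu1]_(y in `[- M, M]) partial2 u (x, y).
  rewrite [RHS]Rintegral_mkcond; apply: eq_rint => y; rewrite patchE.
  case: ifPn => //; rewrite notin_setE /= in_itv/= => h; apply: p0 => /HM[_ /andP[h1 h2]].
  by apply: h; rewrite !ltW.
have cf := @continuous_line2 (partial2 u) x (Ck_continuous c2).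
have df (y : R) : is_derive y 1 (fun y : R => u (x, y)) (partial2 u (x, y)).
  exact: (Ck_derive2 (x, y) ku).
have MM : - M < M by rewrite gtrN.
rewrite (FTC_smooth MM cf df) !u0 ?subrr//; first by move=> /HM[_ /=]; rewrite ltxx.
by move=> /HM[_ /=]; rewrite ltxx andbF.
Qed.

Lemma partial1M k u v : Ck k.+1 u -> Ck k.+1 v ->
  partial1 (fun z => u z * v z) = fun z => u z * partial1 v z + v z * partial1 u z.
Proof.
move=> ku kv; apply: partial1_eq => z.
by have := is_deriveM (Ck_derive1 z ku) (Ck_derive1 z kv); case: z.
Qed.

Lemma partial2M k u v : Ck k.+1 u -> Ck k.+1 v ->
  partial2 (fun z => u z * v z) = fun z => u z * partial2 v z + v z * partial2 u z.
Proof.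
move=> ku kv; apply: partial2_eq => z.
by have := is_deriveM (Ck_derive2 z ku) (Ck_derive2 z kv); case: z.
Qed.

Lemma test_partial1 U phi : test_function U phi -> test_function U (partial1 phi).
Proof.
move=> [kphi [A [cA AU p0]]]; split; first by move=> k; have [] := CkS (kphi k.+1).
by exists A; split => // z; exact: partial0 (compact_closed2 cA) p0.
Qed.

Lemma test_partial2 U phi : test_function U phi -> test_function U (partial2 phi).
Proof.
move=> [kphi [A [cA AU p0]]]; split; first by move=> k; have [] := CkS (kphi k.+1).
by exists A; split => // z; exact: partial0 (compact_closed2 cA) p0.
Qed.

Lemma test_continuous U phi : test_function U phi -> continuous phi.
Proof. by move=> [/(_ 0%N)]. Qed.

Lemma test_off U phi z : test_function U phi -> ~ U z -> phi z = 0.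
Proof. by move=> [_ [A [_ AU p0]]] nU; apply: p0 => /AU. Qed.

Lemma rint_test U u phi : test_function U phi ->
  \int[mu2]_(z in U) (u z * phi z) = \int[mu2]_z (u z * phi z).
Proof.
move=> tp; rewrite Rintegral_mkcond; apply: eq_rint => z; rewrite patchE.
by case: ifPn => //; rewrite notin_setE => /(test_off tp) ->; rewrite mulr0.
Qed.

Lemma rintegrable_continuous_test U u phi : continuous u -> test_function U phi ->
  rintegrable mu2 (fun z => u z * phi z).
Proof.
move=> cu tp; have cp := test_continuous tp; have [_ [A [cA AU p0]]] := tp.
apply: (rintegrable_Cc cA); first by move=> z; apply: cvgM; [exact: cu|exact: cp].
by move=> z /p0 ->; rewrite mulr0.
Qed.

Lemma test_ibp1 U u phi : Ck 1 u -> test_function U phi ->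
  \int[mu2]_z (u z * partial1 phi z) = - \int[mu2]_z (partial1 u z * phi z).
Proof.
move=> ku tp; have [kp [A [cA AU p0]]] := tp; have [cu c1 _] := CkS ku.
apply/eqP; rewrite -addr_eq0 -rintD.
- have := rint_partial1_0 cA (Ck_mul ku (kp 1%N)) _.
  rewrite (partial1M ku (kp 1%N)) => h; apply/eqP; rewrite -[RHS]h; last first.
    by move=> z /p0 ->; rewrite mulr0.
  by apply: eq_rint => z; rewrite [phi z * _]mulrC.
- exact: rintegrable_continuous_test cu (test_partial1 tp).
- exact: rintegrable_continuous_test c1 tp.
Qed.

Lemma test_ibp2 U u phi : Ck 1 u -> test_function U phi ->
  \int[mu2]_z (u z * partial2 phi z) = - \int[mu2]_z (partial2 u z * phi z).
Proof.
move=> ku tp; have [kp [A [cA AU p0]]] := tp; have [cu _ c2] := CkS ku.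
apply/eqP; rewrite -addr_eq0 -rintD.
- have := rint_partial2_0 cA (Ck_mul ku (kp 1%N)) _.
  rewrite (partial2M ku (kp 1%N)) => h; apply/eqP; rewrite -[RHS]h; last first.
    by move=> z /p0 ->; rewrite mulr0.
  by apply: eq_rint => z; rewrite [phi z * _]mulrC.
- exact: rintegrable_continuous_test cu (test_partial2 tp).
- exact: rintegrable_continuous_test c2 tp.
Qed.

End PlaneIntegrationByParts.

(** * Calculus of weak derivatives on open sets *)

Section WeakDerivatives.
Variable R : realType.
Notation mu1 := (@lebesgue_measure R).
Notation mu2 := (mu1 \x mu1)%E.
Implicit Types (u v f g phi : R * R -> R) (eta psi : R -> R) (z : R * R).
Implicit Types (U V A : set (R * R)) (a : multi_index).

Lemma rintegrable_loc_test U v phi : loc_integrable U v -> test_function U phi ->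
  rintegrable mu2 (fun z => v z * phi z).
Proof.
move=> lv tp; have cp := test_continuous tp; have [_ [A [cA AU p0]]] := tp.
have [k Hk] := bounded_on_compact cA cp.
have mA := compact_measurable2 cA.
have sv : rintegrable mu2 (v \_ A).
  rewrite /rintegrable -restrict_EFin; have h := lv A cA AU.
  by apply: (integrable_mkcond _ _).1 h.
have pk z : `|phi z| <= `|k|.
  have [Az|nAz] := pselect (A z); first by rewrite (le_trans (Hk z Az))// ler_norm.
  by rewrite p0// normr0.
have := rintegrableM2 (continuous_measurable2 cp) pk sv; congr (rintegrable _ _).
apply/funext => z; rewrite patchE; case: ifPn; first by rewrite mulrC.
by rewrite notin_setE => /p0 ->; rewrite mul0r mulr0.
Qed.

Lemma loc_integrable_continuous U u : continuous u -> loc_integrable U u.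
Proof. by move=> cu A cA _; exact: continuous_compact_integrable2. Qed.

Lemma loc_integrableS U V u : V `<=` U -> loc_integrable U u -> loc_integrable V u.
Proof. by move=> VU lu A cA AV; apply: lu => //; exact: subset_trans AV VU. Qed.

Lemma loc_integrableB U u v : loc_integrable U u -> loc_integrable U v ->
  loc_integrable U (fun z => u z - v z).
Proof.
move=> lu lv A cA AU; have mA := compact_measurable2 cA.
have h : mu2.-integrable A ((EFin \o u) \- (EFin \o v))%E.
  by apply: integrableB; [exact: mA|exact: lu|exact: lv].
exact: h.
Qed.

Lemma test_functionS U V phi : V `<=` U -> test_function V phi -> test_function U phi.
Proof. by move=> VU [kp [A [cA AV p0]]]; split => //; exists A; split => //; exact: subset_trans VU. Qed.

Lemma test_iter_partial1 U n phi : test_function U phi -> test_function U (iter n (@partial1 R) phi).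
Proof. by move=> tp; elim: n => [//|n IH]; rewrite iterS; exact: test_partial1. Qed.

Lemma test_iter_partial2 U n phi : test_function U phi -> test_function U (iter n (@partial2 R) phi).
Proof. by move=> tp; elim: n => [//|n IH]; rewrite iterS; exact: test_partial2. Qed.

Lemma test_pderiv U a phi : test_function U phi -> test_function U (pderiv a phi).
Proof. by move=> tp; exact/test_iter_partial1/test_iter_partial2. Qed.

Lemma weak_derivP U a v g : is_weak_deriv U a v g <->
  [/\ loc_integrable U v, loc_integrable U g &
   forall phi, test_function U phi ->
     \int[mu2]_z (v z * pderiv a phi z) = (-1) ^+ (a.1 + a.2) * \int[mu2]_z (g z * phi z)].
Proof.
by split=> -[lv lg h]; split => // phi tp; have := h _ tp;
  rewrite (rint_test v (test_pderiv a tp)) (rint_test g tp).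
Qed.

Lemma weak_derivS U V a v g : V `<=` U -> is_weak_deriv U a v g -> is_weak_deriv V a v g.
Proof.
move=> VU /weak_derivP[lv lg h]; apply/weak_derivP; split.
- exact: loc_integrableS VU lv.
- exact: loc_integrableS VU lg.
- by move=> phi tp; apply: h; exact: test_functionS tp.
Qed.

Lemma weak_deriv_eq U a v v' g : (forall z, U z -> v z = v' z) ->
  is_weak_deriv U a v g -> is_weak_deriv U a v' g.
Proof.
move=> vv' [lv lg h]; split => //.
  move=> A cA AU; apply: eq_integrable (lv A cA AU); first exact: compact_measurable2.
  by move=> z; rewrite inE => Az /=; rewrite vv'//; exact: AU.
move=> phi tp; rewrite -h//; apply: eq_Rintegral => z; rewrite inE => Uz.
by rewrite vv'.
Qed.

Lemma weak_derivB U a v v' g g' : is_weak_deriv U a v g -> is_weak_deriv U a v' g' ->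
  is_weak_deriv U a (fun z => v z - v' z) (fun z => g z - g' z).
Proof.
move=> /weak_derivP[lv lg h] /weak_derivP[lv' lg' h']; apply/weak_derivP; split.
- exact: loc_integrableB.
- exact: loc_integrableB.
move=> phi tp; have tp' := test_pderiv a tp.
rewrite (eq_rint mu2 (fun z => mulrBl (pderiv a phi z) (v z) (v' z))).
rewrite (eq_rint mu2 (fun z => mulrBl (phi z) (g z) (g' z))).
rewrite (rintB (rintegrable_loc_test lv tp') (rintegrable_loc_test lv' tp')).
rewrite (rintB (rintegrable_loc_test lg tp) (rintegrable_loc_test lg' tp)).
by rewrite h// h'// mulrBr.
Qed.

Lemma Ck_iter_partial1 i k u : Ck (i + k) u -> Ck k (iter i (@partial1 R) u).
Proof.
elim: i k u => [//|i IH] k u; rewrite addSn -addnS => /IH h.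
by rewrite iterS; have [] := CkS h.
Qed.

Lemma Ck_iter_partial2 i k u : Ck (i + k) u -> Ck k (iter i (@partial2 R) u).
Proof.
elim: i k u => [//|i IH] k u; rewrite addSn -addnS => /IH h.
by rewrite iterS; have [] := CkS h.
Qed.

(** Classical derivatives are weak derivatives; moving the derivatives one at a time from the
    test function reverses their order. *)
Lemma weak_deriv_Ck U i j u : Ck (i + j) u ->
  is_weak_deriv U (i, j) u (iter j (@partial2 R) (iter i (@partial1 R) u)).
Proof.
move=> ku; apply/weak_derivP; split.
- exact/loc_integrable_continuous/Ck_continuous/ku.
- apply/loc_integrable_continuous; apply: (@Ck_continuous _ 0).
  by apply: Ck_iter_partial2; rewrite addn0; exact: Ck_iter_partial1.
move=> phi tp; rewrite /pderiv /=.
have step1 n v (q : R * R -> R) : Ck n v -> test_function U q ->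
    \int[mu2]_z (v z * iter n (@partial1 R) q z) = (-1) ^+ n * \int[mu2]_z (iter n (@partial1 R) v z * q z).
  elim: n v q => [|n IH] v q kv tq; first by rewrite mul1r.
  have k1 : Ck 1 v.
    by move: kv; clear; elim: n => [//|n IH kv]; apply: IH; exact: Ck_pred kv.
  rewrite iterS (test_ibp1 k1 (test_iter_partial1 n tq)) IH//; last by have [] := CkS kv.
  by rewrite exprS mulN1r mulNr -iterSr.
have step2 n v (q : R * R -> R) : Ck n v -> test_function U q ->
    \int[mu2]_z (v z * iter n (@partial2 R) q z) = (-1) ^+ n * \int[mu2]_z (iter n (@partial2 R) v z * q z).
  elim: n v q => [|n IH] v q kv tq; first by rewrite mul1r.
  have k1 : Ck 1 v.
    by move: kv; clear; elim: n => [//|n IH kv]; apply: IH; exact: Ck_pred kv.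
  rewrite iterS (test_ibp2 k1 (test_iter_partial2 n tq)) IH//; last by have [] := CkS kv.
  by rewrite exprS mulN1r mulNr -iterSr.
have ki : Ck i u.
  by move: ku; clear; elim: j => [|j IH]; rewrite ?addn0 ?addnS// => ku; apply: IH; exact: Ck_pred ku.
rewrite step1//; last exact: test_iter_partial2.
by rewrite step2 ?exprD ?mulrA//; exact: Ck_iter_partial1.
Qed.

Lemma wderivP U a v : (exists g, is_weak_deriv U a v g) -> is_weak_deriv U a v (wderiv U a v).
Proof. by move=> [g hg]; rewrite /wderiv; case: xgetP => // /(_ g). Qed.

End WeakDerivatives.

Section Cut.
Variable R : realType.
Notation mu1 := (@lebesgue_measure R).
Notation mu2 := (mu1 \x mu1)%E.
Implicit Types (u v f g phi : R * R -> R) (eta psi : R -> R) (z : R * R).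
Implicit Types (U V A : set (R * R)) (a b : R).

Definition inbox (a1 b1 a2 b2 : R) z : R := ((a1 < z.1 < b1) && (a2 < z.2 < b2))%R%:R.

Definition cut (a1 b1 a2 b2 : R) f z := inbox a1 b1 a2 b2 z * f z.

Lemma cut_off a1 b1 a2 b2 f : off2 a1 b1 a2 b2 (cut a1 b1 a2 b2 f).
Proof. by move=> z /negbTE h; rewrite /cut /inbox h mul0r. Qed.

Lemma cutE a1 b1 a2 b2 f z : box a1 b1 a2 b2 z -> cut a1 b1 a2 b2 f z = f z.
Proof. by move=> /boxE h; rewrite /cut /inbox h mul1r. Qed.

Lemma cut_patch a1 b1 a2 b2 f : cut a1 b1 a2 b2 f = f \_ (box a1 b1 a2 b2).
Proof.
apply/funext => z; rewrite patchE; case: ifPn; first by rewrite inE => /cutE.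
by rewrite notin_setE => h; apply: cut_off; apply/negP => /boxE.
Qed.

Lemma rintegrable_cut a1 b1 a2 b2 f : mu2.-integrable (box a1 b1 a2 b2) (EFin \o f) ->
  rintegrable mu2 (cut a1 b1 a2 b2 f).
Proof.
move=> h; rewrite cut_patch /rintegrable -restrict_EFin.
have mb := @measurable_box R a1 b1 a2 b2.
by apply: (integrable_mkcond _ _).1 h.
Qed.

Lemma rintegrable_cut_continuous a1 b1 a2 b2 f : continuous f ->
  rintegrable mu2 (cut a1 b1 a2 b2 f).
Proof.
move=> cf; apply: rintegrable_cut; have cK := @compact_box R a1 b1 a2 b2.
apply: integrableS (continuous_compact_integrable2 cK cf).
- exact: (compact_measurable2 cK).
- exact: measurable_box.
by move=> z /boxE/andP[/andP[? ?] /andP[? ?]]; split; rewrite /= in_itv/=; apply/andP; split; apply: ltW.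
Qed.

Lemma cut_test a1 b1 a2 b2 f eta psi : bump a1 b1 eta -> bump a2 b2 psi ->
  (fun z => cut a1 b1 a2 b2 f z * (eta z.1 * psi z.2)) = (fun z => f z * tensor eta psi z).
Proof.
move=> be bp; apply/funext => z; rewrite /cut /inbox /tensor.
case: (boolP (a1 < z.1 < b1)) => h1; last by rewrite (bump_off be h1) !(mul0r, mulr0).
case: (boolP (a2 < z.2 < b2)) => h2; last by rewrite (bump_off bp h2) !(mul0r, mulr0).
by rewrite mul1r.
Qed.

(** The fundamental lemma is applied on an exhaustion by rectangles that are compactly contained,
    where local integrability gives integrability. *)
Lemma weak_deriv_unique U (i : multi_index) v g g' a1 b1 a2 b2 : box a1 b1 a2 b2 `<=` U ->
  is_weak_deriv U i v g -> is_weak_deriv U i v g' ->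
  {ae mu2, forall z, box a1 b1 a2 b2 z -> g z = g' z}.
Proof.
move=> bU /weak_derivP[_ lg hg] /weak_derivP[_ lg' hg'].
pose e (n : nat) : R := n.+1%:R^-1.
have e0 n : 0 < e n by rewrite /e invr_gt0.
pose d n z := cut (a1 + e n) (b1 - e n) (a2 + e n) (b2 - e n) (fun z => g z - g' z) z.
have sub n : (box (a1 + e n) (b1 - e n) (a2 + e n) (b2 - e n) `<=` box a1 b1 a2 b2).
  move=> z /boxE/andP[/andP[h1 h2] /andP[h3 h4]]; apply/boxE; have := e0 n => ?.
  by apply/andP; split; apply/andP; split; lra.
have d0 n : {ae mu2, forall z, d n z = 0}.
  have cK := @compact_box R (a1 + e n) (b1 - e n) (a2 + e n) (b2 - e n).
  have KU : `[a1 + e n, b1 - e n]%classic `*` `[a2 + e n, b2 - e n]%classic `<=` U.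
    move=> z [] /=; rewrite !in_itv/= => /andP[h1 h2] /andP[h3 h4]; apply/bU/boxE.
    by have := e0 n => ?; apply/andP; split; apply/andP; split; lra.
  apply: (@bump_fundamental2 _ (a1 + e n) (b1 - e n) (a2 + e n) (b2 - e n)).
  - apply: rintegrable_cut; have := loc_integrableB lg lg' cK KU.
    apply: integrableS; [exact: compact_measurable2|exact: measurable_box|].
    by move=> z /boxE/andP[/andP[h1 h2] /andP[h3 h4]]; split; rewrite /= in_itv/=; apply/andP; split; apply: ltW.
  - exact: cut_off.
  - move=> eta psi be bp.
    have tt : test_function U (tensor eta psi).
      by apply: (test_tensor _ be bp); exact: subset_trans (sub n) bU.
    rewrite /d (cut_test _ be bp).
    rewrite (eq_rint mu2 (fun z => mulrBl (tensor eta psi z) (g z) (g' z))).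
    rewrite (rintB (rintegrable_loc_test lg tt) (rintegrable_loc_test lg' tt)).
    apply/eqP; rewrite subr_eq0; apply/eqP.
    have := hg _ tt; rewrite hg'// => /mulfI E; apply/esym/E.
    by rewrite signr_eq0.
have := ae_foralln d0.
apply: (@filterS _ _ (ae_filter_ringOfSetsType mu2)) => z dz /boxE/andP[/andP[h1 h2] /andP[h3 h4]].
pose m := Num.min (Num.min (z.1 - a1) (b1 - z.1)) (Num.min (z.2 - a2) (b2 - z.2)).
have m0 : 0 < m by rewrite !lt_min !subr_gt0 h1 h2 h3 h4.
have [e1 e2 e3 e4] : [/\ m <= z.1 - a1, m <= b1 - z.1, m <= z.2 - a2 & m <= b2 - z.2].
  by split; rewrite !ge_min lexx ?orbT.
have [n nm] : exists n, e n < m.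
  exists (Num.trunc m^-1); rewrite /e invf_plt ?posrE ?invr_gt0//.
  exact: truncnS_gt.
have := dz n; rewrite /d cutE; first by move=> /eqP; rewrite subr_eq0 => /eqP.
by apply/boxE; apply/andP; split; apply/andP; split; lra.
Qed.

End Cut.

(** * Towers of weak derivatives on a rectangle *)

Section Tower.
Variable R : realType.
Notation mu1 := (@lebesgue_measure R).
Notation mu2 := (mu1 \x mu1)%E.
Implicit Types (u v f g : R * R -> R) (q : R -> R) (z p : R * R).
Implicit Types (a b x y s t k : R) (D : nat -> nat -> R * R -> R).

Lemma weakx_marginal a1 b1 a2 b2 f g : rintegrable mu2 f -> rintegrable mu2 g ->
  off2 a1 b1 a2 b2 f -> off2 a1 b1 a2 b2 g -> weakx a1 b1 a2 b2 f g ->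
  weak1 a1 b1 (fun x => \int[mu1]_y f (x, y)) (fun x => \int[mu1]_y g (x, y)).
Proof.
move=> sf sg of2 og2 /weakx_transpose w.
exact: (weaky_marginal (rintegrable_transpose sf) (rintegrable_transpose sg)
  (off2_transpose of2) (off2_transpose og2) (w sf sg)).
Qed.

Lemma ind_itv_bounded a b q : a < b -> continuous q ->
  exists2 k, 0 <= k & forall x, `|ind_itv a b x * q x| <= k.
Proof.
move=> ab cq; have [|m _ Hm] := @EVT_max R (fun x => `|q x|) a b (ltW ab).
  apply: continuous_subspaceT => x; apply: continuous_comp; first exact: cq.
  exact: norm_continuous.
exists `|q m| => // x; rewrite /ind_itv; case: (boolP (a < x < b)) => h.
  by rewrite mul1r; apply: Hm; rewrite in_itv/=; case/andP: h => h1 h2; rewrite !ltW.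
by rewrite mul0r normr0.
Qed.

Lemma ind_itv_mul1 a1 b1 a2 b2 q f : off2 a1 b1 a2 b2 f ->
  (fun z => q z.1 * f z) = fun z => (ind_itv a1 b1 z.1 * q z.1) * f z.
Proof.
move=> of2; apply/funext => z; rewrite /ind_itv.
case: (boolP (a1 < z.1 < b1)) => h; first by rewrite mul1r.
by rewrite of2 ?mulr0// negb_and h.
Qed.

Lemma measurable_ind_mul a b q : continuous q -> measurable_fun setT (fun x => ind_itv a b x * q x).
Proof.
move=> cq; apply: measurable_funM; first exact: measurable_ind_itv.
exact: continuous_measurable_fun.
Qed.

Lemma rintegrable_weight1 a1 b1 a2 b2 q f : a1 < b1 -> continuous q ->
  rintegrable mu2 f -> off2 a1 b1 a2 b2 f -> rintegrable mu2 (fun z => q z.1 * f z).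
Proof.
move=> ab cq sf of2; rewrite (ind_itv_mul1 q of2).
have [k _ Hk] := ind_itv_bounded ab cq.
by apply: (rintegrable_mul1 (al := fun x => ind_itv a1 b1 x * q x)) Hk sf; exact: measurable_ind_mul.
Qed.

Lemma rintegrable_weight2 a1 b1 a2 b2 q f : a2 < b2 -> continuous q ->
  rintegrable mu2 f -> off2 a1 b1 a2 b2 f -> rintegrable mu2 (fun z => q z.2 * f z).
Proof.
move=> ab cq sf of2.
have := rintegrable_weight1 ab cq (rintegrable_transpose sf) (off2_transpose of2).
by move/rintegrable_transpose; congr (rintegrable _ _); apply/funext => -[].
Qed.

Lemma rint_weight_bound a1 b1 a2 b2 (w : R * R -> R) f k : rintegrable mu2 f ->
  rintegrable mu2 (fun z => w z * f z) -> off2 a1 b1 a2 b2 f ->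
  (forall z, (a1 < z.1 < b1) && (a2 < z.2 < b2) -> `|w z| <= k) ->
  `|\int[mu2]_z (w z * f z)| <= k * \int[mu2]_z `|f z|.
Proof.
move=> sf swf of2 wk; apply: le_trans (rint_norm swf) _.
have snf := rintegrable_norm sf.
rewrite -rintZ//; apply: rint_le; [exact: rintegrable_norm|exact: rintegrableZ|].
move=> z; have [h|h] := boolP ((a1 < z.1 < b1) && (a2 < z.2 < b2)).
  by rewrite normrM ler_wpM2r// wk.
by rewrite of2// mulr0 normr0 mulr0.
Qed.

Lemma measure_two_points x y : mu1 ([set x] `|` [set y]) = 0%E.
Proof.
apply/eqP; rewrite -measure_le0; apply: le_trans (measureU2 _ _ _) _ => //.
rewrite [X in (X + _)%E](_ : _ = 0%E) ?add0e; last exact: lebesgue_measure_set1.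
by rewrite [X in (X <= _)%E](_ : _ = 0%E)//; exact: lebesgue_measure_set1.
Qed.

Lemma prim_ind a b (Q q : R -> R) x : a < b -> continuous q ->
  (forall x, is_derive x 1 Q (q x)) -> a < x <= b ->
  prim (fun x => ind_itv a b x * q x) x = Q x - Q a.
Proof.
move=> ab cq dQ /andP[ax xb]; rewrite -(FTC_smooth ax cq dQ).
have sI : rintegrable mu1 (fun s => (a <= s <= x)%R%:R * q s).
  have mI : measurable_fun setT (fun s : R => (a <= s <= x)%R).
    by apply: measurable_and; apply: measurable_fun_ler.
  have -> : (fun s => (a <= s <= x)%R%:R * q s) = q \_ `[a, x].
    apply/funext => s; rewrite patchE; case: ifPn; rewrite ?inE ?notin_setE /= in_itv/=.
      by move=> ->; rewrite mul1r.
    by move=> /negP/negbTE ->; rewrite mul0r.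
  have h : mu1.-integrable `[a, x] (EFin \o q).
    apply: continuous_compact_integrable; first exact: segment_compact.
    exact: continuous_subspaceT.
  by rewrite /rintegrable -restrict_EFin; apply: (integrable_mkcond _ _).1 h.
rewrite [RHS]Rintegral_mkcond.
transitivity (\int[mu1]_s ((a <= s <= x)%R%:R * q s)); last first.
  apply: eq_rint => s; rewrite patchE; case: ifPn; rewrite ?inE ?notin_setE /= in_itv/=.
    by move=> ->; rewrite mul1r.
  by move=> /negP/negbTE ->; rewrite mul0r.
apply/esym/rint_ae => //.
  apply: measurable_funM; last exact: measurable_ind_mul.
  by apply: measurable_le_ind.
exists ([set a] `|` [set x]); split.
- exact: measurableU.
- exact: measure_two_points.
- move=> s /= h; apply: contrapT => h'; apply: h; rewrite /ind_itv.
  have sa : (s == a) = false by apply/eqP => E; apply: h'; left.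
  have sx : (s == x) = false by apply/eqP => E; apply: h'; right.
  rewrite [(a <= s)%R]le_eqVlt eq_sym sa /= mulrA; congr (_ * _).
  case: (ltP a s) => /= _; last by rewrite mulr0.
  case: (leP s x) => sx' /=; last by rewrite mul0r.
  have -> : (s < b)%R; first by rewrite (lt_le_trans _ xb)// lt_neqAle sx sx'.
  by rewrite mulr1.
Qed.

(** [Q] vanishes at the ends but is not a bump; after integration in the second variable the claim
    is [weak1_prim] on the line, with [Q] as the primitive of [q]. *)
Lemma weakx_ibp a1 b1 a2 b2 (Q q : R -> R) f g : a1 < b1 ->
  rintegrable mu2 f -> rintegrable mu2 g ->
  off2 a1 b1 a2 b2 f -> off2 a1 b1 a2 b2 g -> weakx a1 b1 a2 b2 f g ->
  continuous q -> (forall x, is_derive x 1 Q (q x)) -> Q a1 = 0 -> Q b1 = 0 ->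
  \int[mu2]_z (q z.1 * f z) = - \int[mu2]_z (Q z.1 * g z).
Proof.
move=> ab sf sg of2 og2 w cq dQ Qa Qb; have cQ := is_derive_continuous dQ.
have red (r : R -> R) h : continuous r -> rintegrable mu2 h -> off2 a1 b1 a2 b2 h ->
    \int[mu2]_z (r z.1 * h z) = \int[mu1]_x (ind_itv a1 b1 x * r x * \int[mu1]_y h (x, y)).
  move=> cr sh oh; have [k _ Hk] := ind_itv_bounded ab cr.
  by rewrite (ind_itv_mul1 r oh) (rfubini_mul1 (measurable_ind_mul _ _ cr) Hk sh).
rewrite !red//.
have [k _ Hk] := ind_itv_bounded ab cq.
have oF h : off2 a1 b1 a2 b2 h -> off a1 b1 (fun x => \int[mu1]_y h (x, y)).
  move=> oh x xab; rewrite (@eq_rint _ _ _ mu1 _ (fun=> 0)); first by rewrite Rintegral_cst ?mul0r.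
  by move=> y; rewrite oh// negb_and xab.
rewrite (weak1_prim ab (rintegrable_fubini1 sf) (rintegrable_fubini1 sg) (oF _ of2)
  (weakx_marginal sf sg of2 og2 w) (measurable_ind_mul _ _ cq) _ Hk).
- congr (- _); apply: eq_rint => x; have [h|h] := boolP (a1 < x < b1).
    rewrite (prim_ind ab cq dQ) ?Qa ?subr0//; last by case/andP: h => -> /ltW ->.
    by rewrite /ind_itv h mul1r.
  by rewrite oF// !mulr0.
- exact: ind_itv_off.
- have := prim_ind ab cq dQ (_ : a1 < b1 <= b1); rewrite Qa Qb subrr ab lexx => <-//.
  apply/esym/prim_gt => // s bs; rewrite /ind_itv.
  by rewrite [(s < b1)%R]ltNge (ltW bs) andbF mul0r.
Qed.

(** All derivatives up to order [n] at once, indexed by the multi-index and cut off outside the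
    rectangle. Only consecutive entries are related, so that every lemma below uses one
    differentiation at a time. *)
Definition tower n a1 b1 a2 b2 D :=
  (forall i j, (i + j <= n)%N -> rintegrable mu2 (D i j) /\ off2 a1 b1 a2 b2 (D i j)) /\
  (forall i j, (i + j < n)%N ->
     weakx a1 b1 a2 b2 (D i j) (D i.+1 j) /\ weaky a1 b1 a2 b2 (D i j) (D i j.+1)).

Definition transposeD D i j := transpose (D j i).

Lemma tower_transpose n a1 b1 a2 b2 D : tower n a1 b1 a2 b2 D ->
  tower n a2 b2 a1 b1 (transposeD D).
Proof.
move=> [h1 h2]; split=> i j ij.
  have [|s o] := h1 j i; first by rewrite addnC.
  by split; [exact: rintegrable_transpose|exact: off2_transpose].
have ji : (j + i < n)%N by rewrite addnC.
have [w1 w2] := h2 j i ji.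
have [s0 _] := h1 _ _ (ltnW ji).
have [s1 _] : rintegrable mu2 (D j.+1 i) /\ off2 a1 b1 a2 b2 (D j.+1 i) by apply: h1; rewrite addSn.
have [s2 _] : rintegrable mu2 (D j i.+1) /\ off2 a1 b1 a2 b2 (D j i.+1) by apply: h1; rewrite addnS.
by split; [exact: weaky_transpose|exact: weakx_transpose].
Qed.

Definition trep a1 b1 a2 b2 D i j := rep a1 b1 a2 b2 (D i j) (D i.+1 j) (D i j.+1) (D i.+1 j.+1).

Section Rep.
Variables (n : nat) (a1 b1 a2 b2 : R) (D : nat -> nat -> R * R -> R).
Hypotheses (ab1 : a1 < b1) (ab2 : a2 < b2) (tD : tower n a1 b1 a2 b2 D).

Lemma tower_int i j : (i + j <= n)%N -> rintegrable mu2 (D i j).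
Proof. by case: tD => h _ /h[]. Qed.

Lemma tower_off i j : (i + j <= n)%N -> off2 a1 b1 a2 b2 (D i j).
Proof. by case: tD => h _ /h[]. Qed.

Lemma tower_weakx i j : (i + j < n)%N -> weakx a1 b1 a2 b2 (D i j) (D i.+1 j).
Proof. by case: tD => _ h /h[]. Qed.

Lemma tower_weaky i j : (i + j < n)%N -> weaky a1 b1 a2 b2 (D i j) (D i j.+1).
Proof. by case: tD => _ h /h[]. Qed.

Variables i j : nat.
Hypothesis ijn : (i + j + 2 <= n)%N.

Let h0 : (i + j <= n)%N. Proof. by rewrite (leq_trans _ ijn)// leq_addr. Qed.
Let h0' : (i + j < n)%N. Proof. by rewrite (leq_trans _ ijn)// addn2. Qed.
Let h1 : (i.+1 + j <= n)%N. Proof. by rewrite addSn. Qed.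
Let h2 : (i + j.+1 <= n)%N. Proof. by rewrite addnS. Qed.
Let h1' : (i.+1 + j < n)%N. Proof. by rewrite (leq_trans _ ijn)// addSn addn2. Qed.
Let h2' : (i + j.+1 < n)%N. Proof. by rewrite (leq_trans _ ijn)// addnS addn2. Qed.
Let h12 : (i.+1 + j.+1 <= n)%N. Proof. by rewrite (leq_trans _ ijn)// addnS addSn addn2. Qed.

Lemma continuous_trep : continuous (trep a1 b1 a2 b2 D i j).
Proof.
exact: (continuous_rep ab1 ab2 (tower_int h0) (tower_int h1) (tower_int h2) (tower_int h12)
  (tower_off h0) (tower_off h1) (tower_off h2) (tower_off h12)).
Qed.

Lemma trep_ae : {ae mu2, forall z,
  inbox a1 b1 a2 b2 z * trep a1 b1 a2 b2 D i j z = D i j z}.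
Proof.
exact: (rep_ae ab1 ab2 (tower_int h0) (tower_int h1) (tower_int h2) (tower_int h12)
  (tower_off h0) (tower_off h1) (tower_off h2) (tower_off h12)
  (tower_weakx h0') (tower_weaky h0') (tower_weaky h1')).
Qed.

Lemma trep_vertical x : {ae mu1, forall y, ind_itv a2 b2 y * trep a1 b1 a2 b2 D i j (x, y) =
  ind_itv a2 b2 y * ((b1 - a1)^-1 *
    \int[mu1]_s (D i j (s, y) + kern a1 b1 x s * D i.+1 j (s, y)))}.
Proof.
exact: (rep_vertical ab2 (tower_int h0) (tower_int h1) (tower_int h2) (tower_int h12)
  (tower_off h0) (tower_off h1) (tower_off h2) (tower_off h12)
  (tower_weaky h0') (tower_weaky h1')).
Qed.

(** The integral over a vertical line is an integral over the rectangle: the correction by the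
    derivative in the other variable has mean value zero. *)
Lemma trep_vedge x : \int[mu1]_(t in `[a2, b2]) trep a1 b1 a2 b2 D i j (x, t) =
  (b1 - a1)^-1 * \int[mu2]_z (D i j z + kern a1 b1 x z.1 * D i.+1 j z).
Proof.
have s1 := rintegrableD (tower_int h0) (rintegrable_kern1 x (tower_int h1) (tower_off h1)).
have sF := rintegrable_fubini2 s1.
rewrite (rfubini2 s1) Rintegral_mkcond -rintZ//.
have sZ := rintegrableZ (b1 - a1)^-1 sF.
apply/esym/rint_ae => //.
  apply/(measurable_restrictT _ _).1 => //.
  apply: (measurable_funS measurableT) => //; apply: continuous_measurable_fun.
  exact: continuous_line2 continuous_trep.
have [N [mN N0 sN]] := trep_vertical x.
exists (N `|` ([set a2] `|` [set b2])); split.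
- by apply: measurableU => //; exact: measurableU.
- apply/eqP; rewrite -measure_le0; apply: le_trans (measureU2 _ _ _) _ => //.
    exact: measurableU.
  rewrite [X in (X + _)%E](_ : _ = 0%E) ?add0e; last exact: N0.
  by rewrite [X in (X <= _)%E](_ : _ = 0%E)//; exact: measure_two_points.
- move=> y /= h; apply: contrapT => h'; apply: h.
  have yN : ind_itv a2 b2 y * trep a1 b1 a2 b2 D i j (x, y) = ind_itv a2 b2 y *
      ((b1 - a1)^-1 * \int[mu1]_s (D i j (s, y) + kern a1 b1 x s * D i.+1 j (s, y))).
    by apply: contrapT => E; apply: h'; left; exact: sN.
  have ya : (y == a2) = false by apply/eqP => E; apply: h'; right; left.
  have yb : (y == b2) = false by apply/eqP => E; apply: h'; right; right.
  rewrite patchE; case: ifPn; rewrite ?inE ?notin_setE /= in_itv/=.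
    rewrite !le_eqVlt eq_sym ya yb /= => yab.
    by move: yN; rewrite /ind_itv yab !mul1r => ->.
  move=> /negP yab; rewrite (@eq_rint _ _ _ mu1 _ (fun=> 0)).
    by rewrite Rintegral_cst ?mul0r ?mulr0.
  have nb s : ~~ ((a1 < s < b1) && (a2 < y < b2)).
    by rewrite negb_and; apply/orP; right; apply: contra yab => /andP[/ltW -> /ltW ->].
  by move=> s; rewrite !tower_off ?mulr0 ?addr0//; exact: nb.
Qed.

(** Exchanging the coordinates exchanges the two steps of the representation, which lets every
    statement about vertical edges be used on horizontal ones. *)
Lemma rep_transposed p : trep a2 b2 a1 b1 (transposeD D) j i (p.2, p.1) = trep a1 b1 a2 b2 D i j p.
Proof.
rewrite /trep /rep /= mulrCA; congr (_ * (_ * _)).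
rewrite -[RHS]rint_transpose.
  apply: eq_rint => z; rewrite /rep_integrand /transposeD /transpose /=; ring.
apply: rintegrable_rep_integrand; rewrite ?(tower_int h0) ?(tower_int h1) ?(tower_int h2) ?(tower_int h12)//.
- exact: tower_off h1.
- exact: tower_off h2.
- exact: tower_off h12.
Qed.

End Rep.
End Tower.

(** * Moments on a square *)

Section Element.
Variable R : realType.
Notation mu1 := (@lebesgue_measure R).
Notation mu2 := (mu1 \x mu1)%E.
Implicit Types (f g : R * R -> R) (z p : R * R).

Section Moments.
Variables (h : R) (c : R * R).
Hypothesis h0 : 0 < h.

Local Notation A1 := (c.1 - h).
Local Notation B1 := (c.1 + h).
Local Notation A2 := (c.2 - h).
Local Notation B2 := (c.2 + h).
Local Notation inK z := ((A1 < z.1 < B1) && (A2 < z.2 < B2)).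

Definition mom f := \int[mu2]_z f z.
Definition momX f := \int[mu2]_z ((z.1 - c.1) * f z).
Definition momY f := \int[mu2]_z ((z.2 - c.2) * f z).
Definition momXY f := \int[mu2]_z ((z.1 - c.1) * ((z.2 - c.2) * f z)).
Definition momN f := \int[mu2]_z `|f z|.

Let ab1 : A1 < B1. Proof. by rewrite ltrBlDr -addrA ltrDl addr_gt0. Qed.
Let ab2 : A2 < B2. Proof. by rewrite ltrBlDr -addrA ltrDl addr_gt0. Qed.

Lemma kern_end a (b : bool) t : a - h < t < a + h ->
  kern (a - h) (a + h) (a + (-1) ^+ b * h) t = (t - a) + (-1) ^+ b * h.
Proof.
move=> /andP[t1 t2]; rewrite /kern; case: b; rewrite ?expr1 ?expr0.
  by rewrite mulN1r (ltW t1) mulr1; ring.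
by rewrite mul1r leNgt t2 mulr0; ring.
Qed.

Lemma continuous_shift (a : R) : continuous (fun t : R => t - a).
Proof. by move=> t; apply: cvgB; [exact: cvg_id|exact: cvg_cst]. Qed.

Lemma continuous_shiftX (a : R) n : continuous (fun t : R => (t - a) ^+ n).
Proof.
move=> t; apply: (@continuous_comp _ _ _ (fun t : R => t - a) (fun t => t ^+ n)).
  exact: continuous_shift.
exact: exprn_continuous.
Qed.

Section Bounded.
Variable f : R * R -> R.
Hypotheses (sf : rintegrable mu2 f) (of2 : off2 A1 B1 A2 B2 f).

Lemma rintegrable_X : rintegrable mu2 (fun z => (z.1 - c.1) * f z).
Proof. exact: (rintegrable_weight1 ab1 (@continuous_shift c.1) sf of2). Qed.

Lemma rintegrable_Y : rintegrable mu2 (fun z => (z.2 - c.2) * f z).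
Proof. exact: (rintegrable_weight2 ab2 (@continuous_shift c.2) sf of2). Qed.

Lemma norm_momX : `|momX f| <= h * momN f.
Proof.
apply: (rint_weight_bound sf rintegrable_X of2) => z /andP[/andP[h1 h2] _].
by rewrite ler_norml; apply/andP; split; lra.
Qed.

Lemma norm_momY : `|momY f| <= h * momN f.
Proof.
apply: (rint_weight_bound sf rintegrable_Y of2) => z /andP[_ /andP[h1 h2]].
by rewrite ler_norml; apply/andP; split; lra.
Qed.

Lemma norm_mom : `|mom f| <= momN f.
Proof. exact: rint_norm. Qed.

Lemma momN_ge0 : 0 <= momN f.
Proof. by apply: Rintegral_ge0 => z _; exact: normr_ge0. Qed.

Lemma rint_vkern (b : bool) g : off2 A1 B1 A2 B2 g ->
  (fun z => kern A1 B1 (c.1 + (-1) ^+ b * h) z.1 * g z) =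
  (fun z => (z.1 - c.1) * g z + ((-1) ^+ b * h) * g z).
Proof.
move=> og; apply/funext => z; have [/andP[h1 _]|hz] := boolP (inK z).
  by rewrite kern_end// mulrDl.
by rewrite og// !mulr0 addr0.
Qed.

Lemma rint_hkern (b : bool) g : off2 A1 B1 A2 B2 g ->
  (fun z => kern A2 B2 (c.2 + (-1) ^+ b * h) z.2 * g z) =
  (fun z => (z.2 - c.2) * g z + ((-1) ^+ b * h) * g z).
Proof.
move=> og; apply/funext => z; have [/andP[_ h1]|hz] := boolP (inK z).
  by rewrite kern_end// mulrDl.
by rewrite og// !mulr0 addr0.
Qed.

End Bounded.

(** First moments are traded for derivatives: the weight $X$ is the derivative of
    $(X^2-h^2)/2$, and $(h^2-X^2)/2-h^2/3$ that of $(h^2X-X^3)/6$, both of which vanish on the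
    sides $X=\pm h$. *)
Definition cubic (a t : R) : R := (h ^+ 2 * (t - a) - (t - a) ^+ 3) / 6.

Lemma continuous_cubic a : continuous (cubic a).
Proof.
move=> t; apply: cvgMl; apply: cvgB.
  by apply: cvgMr; exact: continuous_shift.
exact: continuous_shiftX.
Qed.

Lemma norm_cubic a t : a - h < t < a + h -> `|cubic a t| <= h ^+ 3 / 6.
Proof.
move=> /andP[t1 t2]; rewrite /cubic normrM (ger0_norm (_ : 0 <= 6^-1))// ler_pM2r ?invr_gt0//.
set x := t - a.
have xh : `|x| <= h by rewrite ler_norml; apply/andP; split; rewrite /x; lra.
have -> : h ^+ 2 * x - x ^+ 3 = x * (h ^+ 2 - x ^+ 2) by ring.
have x2 : x ^+ 2 <= h ^+ 2 by rewrite -real_normK ?num_real// lerXn2r ?nnegrE ?(ltW h0).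
rewrite normrM (exprS h 2) ler_pM// ger0_norm ?subr_ge0// lerBlDr lerDl sqr_ge0 //.
Qed.

Lemma is_derive_pow (a t : R) n : is_derive t 1 (fun t : R => (t - a) ^+ n.+1) (n.+1%:R * (t - a) ^+ n).
Proof.
have d1 : is_derive t 1 (fun t : R => t - a) 1.
  by apply: is_derive_eq; rewrite subr0.
elim: n => [|n IH].
  rewrite expr0 mulr1 (_ : (fun _ => _) = fun t0 : R => t0 - a) //.
have E : (fun t0 : R => (t0 - a) ^+ n.+2) = fun t0 : R => (t0 - a) * (t0 - a) ^+ n.+1.
  by apply/funext => t0; rewrite -exprS.
rewrite E; apply: (is_derive_eq (is_deriveM d1 IH)).
rewrite /GRing.scale/= mulr1 -[n.+2%:R]natr1 exprS; ring.
Qed.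

(** Two integrations by parts turn the first moment into the mean of the derivative, with a
    remainder that is of third order in [h]. *)
Lemma momX_ibp f g k : rintegrable mu2 f -> rintegrable mu2 g -> rintegrable mu2 k ->
  off2 A1 B1 A2 B2 f -> off2 A1 B1 A2 B2 g -> off2 A1 B1 A2 B2 k ->
  weakx A1 B1 A2 B2 f g -> weakx A1 B1 A2 B2 g k ->
  momX f = h ^+ 2 / 3 * mom g - \int[mu2]_z (cubic c.1 z.1 * k z).
Proof.
move=> sf sg sk of2 og ok wf wg.
have cX2 := @continuous_shiftX c.1 2.
pose Q t : R := ((t - c.1) ^+ 2 - h ^+ 2) / 2.
have dQ (t : R) : is_derive t 1 Q (t - c.1).
  have d := is_derive_pow c.1 t 1.
  by rewrite /Q; apply: is_derive_eq; rewrite /GRing.scale/= expr1; field.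
have Qa : Q A1 = 0 by rewrite /Q; field.
have Qb : Q B1 = 0 by rewrite /Q; field.
rewrite /momX (weakx_ibp ab1 sf sg of2 og wf (@continuous_shift c.1) dQ Qa Qb).
pose q t : R := (h ^+ 2 - 3 * (t - c.1) ^+ 2) / 6.
have cq : continuous q.
  by move=> t; apply: cvgMl; apply: cvgB; [exact: cvg_cst|apply: cvgMr; exact: cX2].
have dC (t : R) : is_derive t 1 (cubic c.1) (q t).
  have d3 := is_derive_pow c.1 t 2; have d1 := is_derive_pow c.1 t 0.
  rewrite (_ : (fun t0 : R => (t0 - c.1) ^+ 1) = fun t0 => t0 - c.1) in d1; last first.
    by apply/funext => t0; rewrite expr1.
  by rewrite /cubic; apply: is_derive_eq; rewrite /GRing.scale/= /q expr0; field.
have Ca : cubic c.1 A1 = 0 by rewrite /cubic; field.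
have Cb : cubic c.1 B1 = 0 by rewrite /cubic; field.
rewrite -(weakx_ibp ab1 sg sk og ok wg cq dC Ca Cb) /mom -rintZ// -rintD.
- rewrite -[LHS]mulN1r -rintZ.
    by apply: eq_rint => z; rewrite /Q /q; field.
  have cQ := is_derive_continuous dQ.
  exact: (rintegrable_weight1 ab1 cQ sg og).
- exact: rintegrableZ.
- exact: (rintegrable_weight1 ab1 cq sg og).
Qed.

Lemma norm_cubic_mom f : rintegrable mu2 f -> off2 A1 B1 A2 B2 f ->
  `|\int[mu2]_z (cubic c.1 z.1 * f z)| <= h ^+ 3 / 6 * momN f.
Proof.
move=> sf of2.
apply: (rint_weight_bound sf (rintegrable_weight1 ab1 (@continuous_cubic c.1) sf of2) of2).
by move=> z /andP[hz _]; exact: norm_cubic.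
Qed.

End Moments.
End Element.

(** * Vertex values and edge integrals as moments *)

Section ElementTower.
Variable R : realType.
Notation mu1 := (@lebesgue_measure R).
Notation mu2 := (mu1 \x mu1)%E.
Implicit Types (f g : R * R -> R) (z p : R * R).

Definition swap_center (c : R * R) : R * R := (c.2, c.1).

Lemma momY_transpose (c : R * R) f : rintegrable mu2 (fun z => (z.2 - c.2) * f z) ->
  momY c f = momX (swap_center c) (transpose f).
Proof. by move=> s; rewrite /momY -rint_transpose. Qed.

Lemma mom_transpose f : rintegrable mu2 f -> mom (transpose f) = mom f.
Proof. exact: rint_transpose. Qed.

Variables (h : R) (c : R * R) (D : nat -> nat -> R * R -> R).
Hypothesis h0 : 0 < h.
Notation A1 := (c.1 - h).
Notation B1 := (c.1 + h).
Notation A2 := (c.2 - h).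
Notation B2 := (c.2 + h).
Hypothesis tD : tower 4 A1 B1 A2 B2 D.

Let ab1 : A1 < B1. Proof. by rewrite ltrBlDr -addrA ltrDl addr_gt0. Qed.
Let ab2 : A2 < B2. Proof. by rewrite ltrBlDr -addrA ltrDl addr_gt0. Qed.

Local Notation sD := (tower_int tD).
Local Notation oD := (tower_off tD).

Definition corner i j (b1 b2 : bool) := trep A1 B1 A2 B2 D i j (elt_vertex h c b1 b2).

(** At a vertex the kernel of each variable is $(t-a)\pm h$ on the whole square, so the
    representation is a combination of moments. *)
Lemma cornerE i j (b1 b2 : bool) : (i + j + 2 <= 4)%N ->
  let s1 : R := (-1) ^+ b1 in let s2 : R := (-1) ^+ b2 in
  (2 * h) * (2 * h) * corner i j b1 b2 =
  mom (D i j) + momX c (D i.+1 j) + s1 * h * mom (D i.+1 j) +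
  momY c (D i j.+1) + s2 * h * mom (D i j.+1) +
  momXY c (D i.+1 j.+1) + s1 * h * momY c (D i.+1 j.+1) + s2 * h * momX c (D i.+1 j.+1) +
  s1 * s2 * h ^+ 2 * mom (D i.+1 j.+1).
Proof.
move=> ij s1 s2.
have k0 : (i + j <= 4)%N by rewrite (leq_trans _ ij)// leq_addr.
have k1 : (i.+1 + j <= 4)%N by rewrite (leq_trans _ ij)// addSn addn2.
have k2 : (i + j.+1 <= 4)%N by rewrite (leq_trans _ ij)// addnS addn2.
have k12 : (i.+1 + j.+1 <= 4)%N by rewrite (leq_trans _ ij)// addSn addnS addn2.
set v := D i j; set v1 := D i.+1 j; set v2 := D i j.+1; set v12 := D i.+1 j.+1.
have [sv sv1 sv2 sv12] : [/\ rintegrable mu2 v, rintegrable mu2 v1, rintegrable mu2 v2 &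
  rintegrable mu2 v12] by split; exact: sD.
have [ov ov1 ov2 ov12] : [/\ off2 A1 B1 A2 B2 v, off2 A1 B1 A2 B2 v1, off2 A1 B1 A2 B2 v2 &
  off2 A1 B1 A2 B2 v12] by split; exact: oD.
have sX1 := rintegrable_X h0 sv1 ov1; have sX12 := rintegrable_X h0 sv12 ov12.
have sY2 := rintegrable_Y h0 sv2 ov2; have sY12 := rintegrable_Y h0 sv12 ov12.
have oY12 : off2 A1 B1 A2 B2 (fun z => (z.2 - c.2) * v12 z) by exact: (off2_mul (fun z => z.2 - c.2)).
have sXY := rintegrable_X h0 sY12 oY12.
have E : \int[mu2]_z rep_integrand A1 B1 A2 B2 v v1 v2 v12 (elt_vertex h c b1 b2) z =
  mom v + momX c v1 + s1 * h * mom v1 + momY c v2 + s2 * h * mom v2 + momXY c v12 +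
  s1 * h * momY c v12 + s2 * h * momX c v12 + s1 * s2 * h ^+ 2 * mom v12.
  rewrite -!rintZ//.
  do 8 (rewrite -rintD; [|repeat (first [apply: rintegrableD|apply: rintegrableZ]); assumption..]).
  apply: eq_rint => z; rewrite /rep_integrand /elt_vertex /=.
  have o' : off2 A1 B1 A2 B2 (fun z => v2 z + ((z.1 - c.1) * v12 z + s1 * h * v12 z)).
    by move=> y hy; rewrite ov2// ov12// !mulr0 !addr0.
  have E1 : kern A1 B1 (c.1 + s1 * h) z.1 * v1 z = (z.1 - c.1) * v1 z + (s1 * h) * v1 z.
    exact: (congr1 (fun F => F z) (rint_vkern b1 ov1)).
  have E2 : kern A1 B1 (c.1 + s1 * h) z.1 * v12 z = (z.1 - c.1) * v12 z + (s1 * h) * v12 z.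
    exact: (congr1 (fun F => F z) (rint_vkern b1 ov12)).
  have E3 : kern A2 B2 (c.2 + s2 * h) z.2 * (v2 z + ((z.1 - c.1) * v12 z + s1 * h * v12 z)) =
    (z.2 - c.2) * (v2 z + ((z.1 - c.1) * v12 z + s1 * h * v12 z)) +
    (s2 * h) * (v2 z + ((z.1 - c.1) * v12 z + s1 * h * v12 z)).
    exact: (congr1 (fun F => F z) (rint_hkern b2 o')).
  rewrite E1 E2 E3; ring.
rewrite /corner /trep /rep -/v -/v1 -/v2 -/v12 E.
have -> : B2 - A2 = 2 * h by ring.
have -> : B1 - A1 = 2 * h by ring.
field; rewrite gt_eqF//.
Qed.

Definition diffEW i j := corner i j false false + corner i j false true
  - corner i j true false - corner i j true true.
Definition diffNS i j := corner i j false false + corner i j true false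
  - corner i j false true - corner i j true true.
Definition mixed i j := corner i j false false - corner i j false true
  - corner i j true false + corner i j true true.

(** Only the moments that are odd in the horizontal sign and even in the vertical one survive. *)
Lemma diffEW_mom i j : (i + j + 2 <= 4)%N ->
  h * diffEW i j = mom (D i.+1 j) + momY c (D i.+1 j.+1).
Proof.
move=> ij; have K : (2 * h) * (2 * h) != 0 by rewrite mulf_neq0// mulf_neq0// gt_eqF.
apply: (mulfI K); rewrite /diffEW.
have := cornerE false false ij; have := cornerE false true ij.
have := cornerE true false ij; have := cornerE true true ij.
rewrite /= !expr0 !expr1 => e1 e2 e3 e4.
have E (k a b c' d : R) : k * (h * (a + b - c' - d)) = h * (k * a + k * b - k * c' - k * d).
  by ring.
rewrite E e1 e2 e3 e4; ring.
Qed.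

Lemma diffNS_mom i j : (i + j + 2 <= 4)%N ->
  h * diffNS i j = mom (D i j.+1) + momX c (D i.+1 j.+1).
Proof.
move=> ij; have K : (2 * h) * (2 * h) != 0 by rewrite mulf_neq0// mulf_neq0// gt_eqF.
apply: (mulfI K); rewrite /diffNS.
have := cornerE false false ij; have := cornerE false true ij.
have := cornerE true false ij; have := cornerE true true ij.
rewrite /= !expr0 !expr1 => e1 e2 e3 e4.
have E (k a b c' d : R) : k * (h * (a + b - c' - d)) = h * (k * a + k * b - k * c' - k * d).
  by ring.
rewrite E e1 e2 e3 e4; ring.
Qed.

Lemma mixed_mom i j : (i + j + 2 <= 4)%N -> mixed i j = mom (D i.+1 j.+1).
Proof.
move=> ij; have K : (2 * h) * (2 * h) != 0 by rewrite mulf_neq0// mulf_neq0// gt_eqF.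
apply: (mulfI K); rewrite /mixed.
have := cornerE false false ij; have := cornerE false true ij.
have := cornerE true false ij; have := cornerE true true ij.
rewrite /= !expr0 !expr1 => e1 e2 e3 e4.
have E (k a b c' d : R) : k * (a - b - c' + d) = k * a - k * b - k * c' + k * d by ring.
rewrite E e1 e2 e3 e4; ring.
Qed.

Lemma vedge_mom i j (b : bool) : (i + j + 2 <= 4)%N ->
  2 * h * vedge_integral h c b (trep A1 B1 A2 B2 D i j) =
  mom (D i j) + momX c (D i.+1 j) + (-1) ^+ b * h * mom (D i.+1 j).
Proof.
move=> ij; rewrite /vedge_integral (trep_vedge ab1 ab2 tD ij).
have k0 : (i + j <= 4)%N by rewrite (leq_trans _ ij)// leq_addr.
have k1 : (i.+1 + j <= 4)%N by rewrite (leq_trans _ ij)// addSn addn2.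
have s1 := rintegrable_X h0 (sD k1) (oD k1).
have E := congr1 (fun F => fun z => D i j z + F z) (rint_vkern b (oD k1)).
rewrite (eq_rint mu2 (fun z => congr1 (fun F => F z) E)) /=.
rewrite (rintD (sD k0) (rintegrableD s1 (rintegrableZ ((-1) ^+ b * h) (sD k1)))).
rewrite (rintD s1 (rintegrableZ ((-1) ^+ b * h) (sD k1))) rintZ; last exact: sD.
have -> : B1 - A1 = 2 * h by ring.
rewrite /mom /momX; field; rewrite gt_eqF//.
Qed.

Lemma hedge_mom i j (b : bool) : (i + j + 2 <= 4)%N ->
  2 * h * hedge_integral h c b (trep A1 B1 A2 B2 D i j) =
  mom (D i j) + momY c (D i j.+1) + (-1) ^+ b * h * mom (D i j.+1).
Proof.
move=> ij; have ji : (j + i + 2 <= 4)%N by rewrite (addnC j).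
have := trep_vedge ab2 ab1 (tower_transpose tD) ji (c.2 + (-1) ^+ b * h).
have k0 : (i + j <= 4)%N by rewrite (leq_trans _ ij)// leq_addr.
have k2 : (i + j.+1 <= 4)%N by rewrite (leq_trans _ ij)// addnS addn2.
have s2 := rintegrable_Y h0 (sD k2) (oD k2).
rewrite /hedge_integral (_ : (fun t => trep A2 B2 A1 B1 (transposeD D) j i (c.2 + (-1) ^+ b * h, t)) =
   fun t => trep A1 B1 A2 B2 D i j (t, c.2 + (-1) ^+ b * h)); last first.
  by apply/funext => t; rewrite -(rep_transposed tD ij (t, c.2 + (-1) ^+ b * h)).
move=> ->.
have E z : transposeD D j i z + kern A2 B2 (c.2 + (-1) ^+ b * h) z.1 * transposeD D j.+1 i z =
  transpose (fun z => D i j z + ((z.2 - c.2) * D i j.+1 z + ((-1) ^+ b * h) * D i j.+1 z)) z.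
  have := congr1 (fun F => F (z.2, z.1)) (rint_hkern b (oD k2)) => /= E.
  by rewrite /transposeD /transpose /= -E.
rewrite (eq_rint mu2 E).
have sZ := rintegrableD (sD k0) (rintegrableD s2 (rintegrableZ ((-1) ^+ b * h) (sD k2))).
rewrite (rint_transpose sZ) (rintD (sD k0) (rintegrableD s2 (rintegrableZ ((-1) ^+ b * h) (sD k2)))).
rewrite (rintD s2 (rintegrableZ ((-1) ^+ b * h) (sD k2))) rintZ; last exact: sD.
have -> : B2 - A2 = 2 * h by ring.
rewrite /mom /momY; field; rewrite gt_eqF//.
Qed.

(** The $L^1$ norms that control every remainder on the element. *)
Definition total := momN (D 3 0) + momN (D 2 1) + momN (D 1 2) + momN (D 0 3) +
  (momN (D 4 0) + momN (D 3 1) + momN (D 2 2) + momN (D 1 3) + momN (D 0 4)).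

Lemma momX_expand i j : (i + j + 2 <= 4)%N ->
  momX c (D i j) = h ^+ 2 / 3 * mom (D i.+1 j) - \int[mu2]_z (cubic h c.1 z.1 * D i.+2 j z).
Proof.
move=> ij.
have k0 : (i + j < 4)%N by rewrite (leq_trans _ ij)// addn2.
have k1 : (i.+1 + j < 4)%N by rewrite (leq_trans _ ij)// addSn addn2.
have k2 : (i.+2 + j <= 4)%N := k1.
exact: (momX_ibp h0 (sD (ltnW k0)) (sD (ltnW k1)) (sD k2) (oD (ltnW k0)) (oD (ltnW k1)) (oD k2)
  (tower_weakx tD k0) (tower_weakx tD k1)).
Qed.

Lemma momY_expand i j : (i + j + 2 <= 4)%N ->
  exists2 r, momY c (D i j) = h ^+ 2 / 3 * mom (D i j.+1) - r & `|r| <= h ^+ 3 / 6 * momN (D i j.+2).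
Proof.
move=> ij.
have k0 : (i + j < 4)%N by rewrite (leq_trans _ ij)// addn2.
have k1 : (i + j.+1 < 4)%N by rewrite (leq_trans _ ij)// addnS addn2.
have tT := tower_transpose tD.
have q0 : (j + i < 4)%N by rewrite addnC.
have q1 : (j.+1 + i < 4)%N by rewrite addnC.
have q2 : (j.+2 + i <= 4)%N := q1.
have k2 : (i + j.+2 <= 4)%N by rewrite addnC.
exists (\int[mu2]_z (cubic h c.2 z.1 * transposeD D j.+2 i z)).
  rewrite (momY_transpose (rintegrable_Y h0 (sD (ltnW k0)) (oD (ltnW k0)))).
  have := @momX_ibp R h (swap_center c) h0 _ _ _ (tower_int tT (ltnW q0)) (tower_int tT (ltnW q1)) (tower_int tT q2)
   (tower_off tT (ltnW q0)) (tower_off tT (ltnW q1)) (tower_off tT q2)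
   (tower_weakx tT q0) (tower_weakx tT q1).
  rewrite /transposeD mom_transpose; last exact: sD (ltnW k1).
  exact.
have := @norm_cubic_mom R h (swap_center c) h0 _ (tower_int tT q2) (tower_off tT q2).
rewrite /momN /transposeD => /le_trans; apply; rewrite ler_wpM2l ?divr_ge0 ?exprn_ge0 ?(ltW h0)//.
have s := rintegrable_norm (sD k2).
by rewrite -(rint_transpose s).
Qed.

End ElementTower.

(** * The null forms on one element *)

Section ElementEstimate.
Variable R : realType.
Notation mu1 := (@lebesgue_measure R).
Notation mu2 := (mu1 \x mu1)%E.
Implicit Types (f g : R * R -> R) (z p : R * R).

Lemma product_error (B r x y x' y' : R) : `|x| <= B -> `|y| <= B ->
  `|x - x'| <= r -> `|y - y'| <= r -> `|x * y - x' * y'| <= 2 * B * r + r ^+ 2.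
Proof.
move=> hx hy hx' hy'.
have -> : x * y - x' * y' = x * (y - y') + y * (x - x') - (x - x') * (y - y') by ring.
have -> : 2 * B * r + r ^+ 2 = B * r + B * r + r * r by ring.
apply: le_trans (ler_normB _ _) _; apply: lerD; last by rewrite normrM ler_pM.
by apply: le_trans (ler_normD _ _) _; apply: lerD; rewrite normrM ler_pM.
Qed.

Lemma le_mix (a b u v P : R) : 0 <= a -> 0 <= b -> 0 <= u -> 0 <= v ->
  u <= P -> v <= P -> a * u + b * v <= (a + b) * P.
Proof. by move=> *; rewrite mulrDl lerD// ler_wpM2l. Qed.

Variables (h : R) (c : R * R) (D : nat -> nat -> R * R -> R).
Hypothesis h0 : 0 < h.
Hypothesis tD : tower 4 (c.1 - h) (c.1 + h) (c.2 - h) (c.2 + h) D.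

Local Notation diffEW := (diffEW h c D).
Local Notation diffNS := (diffNS h c D).
Local Notation P := (total D).

Lemma total_ge0 : 0 <= P.
Proof. by rewrite /total !addr_ge0// momN_ge0. Qed.

Lemma total_bounds : [/\ momN (D 3 0) <= P, momN (D 2 1) <= P, momN (D 1 2) <= P &
  momN (D 0 3) <= P] /\
  [/\ momN (D 4 0) <= P, momN (D 3 1) <= P, momN (D 2 2) <= P, momN (D 1 3) <= P &
  momN (D 0 4) <= P].
Proof.
have ge i j := momN_ge0 (D i j); rewrite /total.
move: (ge 3 0) (ge 2 1) (ge 1 2) (ge 0 3) (ge 4 0) (ge 3 1) (ge 2 2) (ge 1 3) (ge 0 4).
move: (momN (D 3 0)) (momN (D 2 1)) (momN (D 1 2)) (momN (D 0 3)) => n1 n2 n3 n4.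
move: (momN (D 4 0)) (momN (D 3 1)) (momN (D 2 2)) (momN (D 1 3)) (momN (D 0 4)) => n5 n6 n7 n8 n9.
by move=> *; split; split; lra.
Qed.

Let hX i j : (i + j <= 4)%N -> `|momX c (D i j)| <= h * momN (D i j).
Proof. by move=> ij; exact: (norm_momX h0 (tower_int tD ij) (tower_off tD ij)). Qed.
Let hY i j : (i + j <= 4)%N -> `|momY c (D i j)| <= h * momN (D i j).
Proof. by move=> ij; exact: (norm_momY h0 (tower_int tD ij) (tower_off tD ij)). Qed.
Let hM i j : (i + j <= 4)%N -> `|mom (D i j)| <= momN (D i j).
Proof. by move=> ij; exact: (norm_mom (tower_int tD ij)). Qed.

Let h3 : 0 <= h ^+ 3. Proof. by rewrite exprn_ge0// ltW. Qed.
Let h2 : 0 <= h ^+ 2. Proof. by rewrite exprn_ge0// ltW. Qed.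

(* The common shape: a first moment is [h^2/3] times a mean, up to [h^3/6 N], and
   a difference of vertex values is that mean up to [h N']. *)
Let close m x r s y N N' : m = h ^+ 2 / 3 * x - r -> `|r| <= h ^+ 3 / 6 * N ->
  h * s = x + y -> `|y| <= h * N' -> 0 <= N -> 0 <= N' -> N <= P -> N' <= P ->
  `|m - h ^+ 3 / 3 * s| <= h ^+ 3 * P.
Proof.
move=> -> hr hs hy N0 N0' NP NP'.
have -> : h ^+ 2 / 3 * x - r - h ^+ 3 / 3 * s = - (h ^+ 2 / 3 * y + r).
  have -> : y = h * s - x by rewrite hs; ring.
  ring.
rewrite normrN; apply: le_trans (ler_normD _ _) _.
rewrite normrM (ger0_norm (_ : 0 <= h ^+ 2 / 3)); last by rewrite divr_ge0.
apply: (@le_trans _ _ (h ^+ 3 / 3 * N' + h ^+ 3 / 6 * N)).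
  apply: lerD => //; have -> : h ^+ 3 / 3 * N' = h ^+ 2 / 3 * (h * N') by field.
  by rewrite ler_wpM2l// divr_ge0.
apply: le_trans (le_mix _ _ N0' N0 NP' NP) _; rewrite ?divr_ge0//.
apply: ler_wpM2r; [exact: total_ge0|move: (h ^+ 3) h3 => u u0; lra].
Qed.

Let small m x r N N' : m = h ^+ 2 / 3 * x - r -> `|r| <= h ^+ 3 / 6 * N -> `|x| <= N' ->
  0 <= N -> 0 <= N' -> N <= P -> N' <= P -> `|m| <= h ^+ 2 * (1 + h) * P.
Proof.
move=> -> hr hx N0 N0' NP NP'.
apply: le_trans (ler_normB _ _) _.
rewrite normrM (ger0_norm (_ : 0 <= h ^+ 2 / 3)); last by rewrite divr_ge0.
apply: (@le_trans _ _ (h ^+ 2 / 3 * N' + h ^+ 3 / 6 * N)).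
  by apply: lerD => //; rewrite ler_wpM2l// divr_ge0.
apply: le_trans (le_mix _ _ N0' N0 NP' NP) _; rewrite ?divr_ge0//.
apply: ler_wpM2r; first exact: total_ge0.
rewrite mulrDr mulr1 -exprSr; move: (h ^+ 3) (h ^+ 2) h3 h2 => u v u0 v0; lra.
Qed.

(** With [m], [d], [m'], [d'] as in the proof, the factors of $md-d^2+m'd'-d'^2$ are replaced by
    differences of vertex values with the same leading term: $\int X\partial_{11}w$ by the
    east-west difference of $\partial_{11}w$, and $\int Y\partial_{12}w$ by the north-south
    difference of $\partial_{12}w$ or by the east-west difference of $\partial_{22}w$. The two
    factors of $d^2$ are replaced differently, and so are those of $d'^2$, which makes the leading
    part antisymmetric. *)
Lemma element_estimate :
  `|3 / (4 * h ^+ 4) * ((momX c (D 2 0) - momY c (D 1 1)) * momY c (D 1 1) +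
                        (momY c (D 0 2) - momX c (D 1 1)) * momX c (D 1 1)) -
    h ^+ 2 / 12 * (diffEW 2 0 * diffNS 1 1 - diffNS 2 0 * diffEW 1 1 +
                  (diffNS 0 2 * diffEW 1 1 - diffEW 0 2 * diffNS 1 1))|
  <= 9 * h * (1 + h) * P ^+ 2.
Proof.
set m := momX c (D 2 0); set d := momY c (D 1 1).
set m' := momY c (D 0 2); set d' := momX c (D 1 1).
have [[P30 P21 P12 P03] [P40 P31 P22 P13 P04]] := total_bounds.
have P0 := total_ge0.
have em : exists2 r, m = h ^+ 2 / 3 * mom (D 3 0) - r & `|r| <= h ^+ 3 / 6 * momN (D 4 0).
  exists (\int[mu2]_z (cubic h c.1 z.1 * D 4 0 z)); first exact: (momX_expand h0 tD).
  exact: (norm_cubic_mom h0 (tower_int tD _) (tower_off tD _)).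
have ed' : exists2 r, d' = h ^+ 2 / 3 * mom (D 2 1) - r & `|r| <= h ^+ 3 / 6 * momN (D 3 1).
  exists (\int[mu2]_z (cubic h c.1 z.1 * D 3 1 z)); first exact: (momX_expand h0 tD).
  exact: (norm_cubic_mom h0 (tower_int tD _) (tower_off tD _)).
have [rm Em Hm] := em; have [rd' Ed' Hd'] := ed'.
have [rd Ed Hd] : exists2 r, d = h ^+ 2 / 3 * mom (D 1 2) - r & `|r| <= h ^+ 3 / 6 * momN (D 1 3).
  exact: (momY_expand h0 tD).
have [rm' Em' Hm'] : exists2 r, m' = h ^+ 2 / 3 * mom (D 0 3) - r & `|r| <= h ^+ 3 / 6 * momN (D 0 4).
  exact: (momY_expand h0 tD).
have g i j := momN_ge0 (D i j).
have S1 := close Em Hm (diffEW_mom h0 tD (i := 2) (j := 0) isT) (@hY 3 1 isT) (g _ _) (g _ _) P40 P31.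
have Z2 := close Ed Hd (diffNS_mom h0 tD (i := 1) (j := 1) isT) (@hX 2 2 isT) (g _ _) (g _ _) P13 P22.
have T1 := close Ed Hd (diffEW_mom h0 tD (i := 0) (j := 2) isT) (@hY 1 3 isT) (g _ _) (g _ _) P13 P13.
have Z1 := close Ed' Hd' (diffEW_mom h0 tD (i := 1) (j := 1) isT) (@hY 2 2 isT) (g _ _) (g _ _) P31 P22.
have S2 := close Ed' Hd' (diffNS_mom h0 tD (i := 2) (j := 0) isT) (@hX 3 1 isT) (g _ _) (g _ _) P31 P31.
have T2 := close Em' Hm' (diffNS_mom h0 tD (i := 0) (j := 2) isT) (@hX 1 3 isT) (g _ _) (g _ _) P04 P13.
have bm := small Em Hm (@hM 3 0 isT) (g _ _) (g _ _) P40 P30.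
have bd := small Ed Hd (@hM 1 2 isT) (g _ _) (g _ _) P13 P12.
have bd' := small Ed' Hd' (@hM 2 1 isT) (g _ _) (g _ _) P31 P21.
have bm' := small Em' Hm' (@hM 0 3 isT) (g _ _) (g _ _) P04 P03.
(* Four products, in the order $md-d^2+m'd'-d'^2$. *)
have e1 := product_error bm bd S1 Z2.
have e2 := product_error bd bd T1 Z2.
have e3 := product_error bm' bd' T2 Z1.
have e4 := product_error bd' bd' S2 Z1.
set F := (X in `|X| <= _); set Q := 2 * _ * _ + _ in e1 e2 e3 e4.
set E1 := (X in `|X|) in e1; set E2 := (X in `|X|) in e2.
set E3 := (X in `|X|) in e3; set E4 := (X in `|X|) in e4.
have hn : h != 0 by rewrite gt_eqF.
have -> : F = 3 / (4 * h ^+ 4) * (E1 - E2 + (E3 - E4)).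
  by rewrite /F /E1 /E2 /E3 /E4; field.
have K0 : 0 <= 3 / (4 * h ^+ 4) by rewrite divr_ge0// mulr_ge0// exprn_ge0// ltW.
rewrite normrM ger0_norm//.
apply: (@le_trans _ _ (3 / (4 * h ^+ 4) * (4 * Q))).
  rewrite ler_wpM2l//; apply: le_trans (ler_normD _ _) _.
  apply: le_trans (lerD (ler_normB E1 E2) (ler_normB E3 E4)) _.
  by rewrite (_ : 4 * Q = Q + Q + (Q + Q)) ?lerD//; ring.
have -> : 3 / (4 * h ^+ 4) * (4 * Q) = (6 * h * (1 + h) + 3 * h ^+ 2) * P ^+ 2.
  by rewrite /Q; field.
rewrite ler_wpM2r ?exprn_ge0//.
have -> : 9 * h * (1 + h) = 6 * h * (1 + h) + 3 * h ^+ 2 + 3 * h by ring.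
by rewrite lerDl mulr_ge0// ltW.
Qed.

End ElementEstimate.

(** * Moments of the indicator function of a square *)

Section BoxMoments.
Variable R : realType.
Notation mu1 := (@lebesgue_measure R).
Notation mu2 := (mu1 \x mu1)%E.
Implicit Types (f g : R * R -> R) (z p : R * R) (a b x t : R) (q : R -> R).

Lemma rint_ind_deriv a b (Q q : R -> R) : a < b -> continuous q ->
  (forall x, is_derive x 1 Q (q x)) ->
  \int[mu1]_x (ind_itv a b x * q x) = Q b - Q a.
Proof.
move=> ab cq dQ; have := prim_ind ab cq dQ (_ : a < b <= b); rewrite ab lexx => <-//.
apply/esym/prim_gt => // s bs; rewrite /ind_itv.
by rewrite [(s < b)%R]ltNge (ltW bs) andbF mul0r.
Qed.

Lemma rintegrable_ind_cont a b q : a < b -> continuous q ->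
  rintegrable mu1 (fun x => ind_itv a b x * q x).
Proof.
move=> ab cq; have [k _ Hk] := ind_itv_bounded ab cq.
by apply: (rintegrable_bounded_off (measurable_ind_mul _ _ cq) (@ind_itv_off _ _ _ _) Hk).
Qed.

Lemma rint_tensor (F G : R -> R) : rintegrable mu1 F -> rintegrable mu1 G ->
  \int[mu2]_z (F z.1 * G z.2) = (\int[mu1]_x F x) * \int[mu1]_y G y.
Proof.
move=> sF sG; rewrite (rfubini1 (rintegrable_tensor sF sG)) /=.
rewrite mulrC -rintZ//; apply: eq_rint => x.
by rewrite mulrC -rintZ//; apply: eq_rint => y; rewrite mulrC.
Qed.

Lemma rintegrable_inbox a1 b1 a2 b2 : rintegrable mu2 (@inbox R a1 b1 a2 b2).
Proof.
have := rintegrable_tensor (rintegrable_ind_itv a1 b1) (rintegrable_ind_itv a2 b2).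
congr (rintegrable _ _); apply/funext => z; rewrite /ind_itv /inbox -natrM mulnb//.
Qed.

Lemma off2_inbox a1 b1 a2 b2 : off2 a1 b1 a2 b2 (@inbox R a1 b1 a2 b2).
Proof. by move=> z /negbTE h; rewrite /inbox h. Qed.

Variables (h : R) (c : R * R).
Hypothesis h0 : 0 < h.

Local Notation A1 := (c.1 - h).
Local Notation B1 := (c.1 + h).
Local Notation A2 := (c.2 - h).
Local Notation B2 := (c.2 + h).
Local Notation inK := (@inbox R A1 B1 A2 B2).

Let ab1 : A1 < B1. Proof. by rewrite ltrBlDr -addrA ltrDl addr_gt0. Qed.
Let ab2 : A2 < B2. Proof. by rewrite ltrBlDr -addrA ltrDl addr_gt0. Qed.

Lemma rint_inbox_X (Q q : R -> R) : continuous q -> (forall x, is_derive x 1 Q (q x)) ->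
  \int[mu2]_z (q z.1 * inK z) = 2 * h * (Q B1 - Q A1).
Proof.
move=> cq dQ; rewrite -(rint_ind_deriv ab1 cq dQ) mulrC.
have <- : \int[mu1]_y ind_itv A2 B2 y = 2 * h by rewrite rint_ind_itv//; ring.
rewrite -rint_tensor; [|exact: rintegrable_ind_cont|exact: rintegrable_ind_itv].
by apply: eq_rint => z; rewrite /ind_itv /inbox [RHS]mulrAC -natrM mulnb mulrC.
Qed.

Lemma mom_inbox : mom inK = 4 * h ^+ 2.
Proof.
have c1 : continuous (fun _ : R => 1 : R) by move=> x; exact: cvg_cst.
rewrite /mom (eq_rint mu2 (fun z => esym (mul1r (inK z)))).
by rewrite (rint_inbox_X c1 (Q := id)); ring.
Qed.

Lemma momX_inbox : momX c inK = 0.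
Proof.
have dQ x : is_derive x 1 (fun t => (t - c.1) ^+ 2 / 2) (x - c.1).
  have d := is_derive_pow c.1 x 1.
  by apply: is_derive_eq; rewrite /GRing.scale/= expr1; field.
by rewrite /momX (rint_inbox_X (@continuous_shift R c.1) dQ); ring.
Qed.

Lemma mom_X2_inbox : \int[mu2]_z ((z.1 - c.1) ^+ 2 * inK z) = 4 * h ^+ 4 / 3.
Proof.
have cq := @continuous_shiftX R c.1 2.
have dQ x : is_derive x 1 (fun t => (t - c.1) ^+ 3 / 3) ((x - c.1) ^+ 2).
  have d := is_derive_pow c.1 x 2.
  by apply: is_derive_eq; rewrite /GRing.scale/=; field.
by rewrite (rint_inbox_X cq dQ); field.
Qed.

(** The Cauchy--Schwarz inequality against the indicator function of the element. *)
Lemma momN_sq f : rintegrable mu2 f -> rintegrable mu2 (fun z => f z ^+ 2) ->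
  off2 A1 B1 A2 B2 f -> momN f ^+ 2 <= 4 * h ^+ 2 * \int[mu2]_z f z ^+ 2.
Proof.
move=> sf sf2 of2; pose q := momN f / (4 * h ^+ 2).
have k0 : 0 < 4 * h ^+ 2 by rewrite mulr_gt0// exprn_gt0.
have sN := rintegrable_norm sf; have sB := rintegrable_inbox A1 B1 A2 B2.
(* [q] is the mean value of $|f|$, so this integral is its variance up to a factor. *)
have : 0 <= \int[mu2]_z (f z ^+ 2 - (2 * q * `|f z| - q ^+ 2 * inK z)).
  apply: Rintegral_ge0 => z _; have [hz|hz] := boolP ((A1 < z.1 < B1) && (A2 < z.2 < B2)).
    rewrite /inbox hz mulr1 -(real_normK (num_real (f z))).
    have -> : `|f z| ^+ 2 - (2 * q * `|f z| - q ^+ 2) = (`|f z| - q) ^+ 2 by ring.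
    exact: sqr_ge0.
  by rewrite of2// /inbox (negbTE hz) expr0n normr0 !mulr0 !subr0.
rewrite (rintB sf2 (rintegrableB (rintegrableZ (2 * q) sN) (rintegrableZ (q ^+ 2) sB))).
rewrite (rintB (rintegrableZ (2 * q) sN) (rintegrableZ (q ^+ 2) sB)) !rintZ//.
have EM : \int[mu2]_z inK z = 4 * h ^+ 2 := mom_inbox.
rewrite EM -/(momN f).
have -> : 2 * q * momN f - q ^+ 2 * (4 * h ^+ 2) = momN f ^+ 2 / (4 * h ^+ 2).
  by rewrite /q; field; rewrite gt_eqF.
by rewrite subr_ge0 ler_pdivrMr// mulrC.
Qed.

Definition energy (D : nat -> nat -> R * R -> R) :=
  let I i j := \int[mu2]_z D i j z ^+ 2 in
  I 3%N 0%N + I 2%N 1%N + I 1%N 2%N + I 0%N 3%N +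
  (I 4%N 0%N + I 3%N 1%N + I 2%N 2%N + I 1%N 3%N + I 0%N 4%N).

Lemma total_energy D : tower 4 A1 B1 A2 B2 D ->
  (forall i j, (i + j <= 4)%N -> rintegrable mu2 (fun z => D i j z ^+ 2)) ->
  total D ^+ 2 <= 36 * h ^+ 2 * energy D.
Proof.
move=> tD sq.
have N i j (ij : (i + j <= 4)%N) := momN_sq (tower_int tD ij) (sq _ _ ij) (tower_off tD ij).
have := N 3 0 isT; have := N 2 1 isT; have := N 1 2 isT; have := N 0 3 isT.
have := N 4 0 isT; have := N 3 1 isT; have := N 2 2 isT; have := N 1 3 isT.
have := N 0 4 isT; rewrite /energy /total => n1 n2 n3 n4 n5 n6 n7 n8 n9.
have sq9 (x1 x2 x3 x4 x5 x6 x7 x8 x9 : R) :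
    (x1 + x2 + x3 + x4 + (x5 + x6 + x7 + x8 + x9)) ^+ 2 <=
    9 * (x1 ^+ 2 + x2 ^+ 2 + x3 ^+ 2 + x4 ^+ 2 + (x5 ^+ 2 + x6 ^+ 2 + x7 ^+ 2 + x8 ^+ 2 + x9 ^+ 2)).
  (* The sum of the squared deviations of nine numbers from their mean [t]. *)
  set P := (X in X ^+ 2 <= _); pose t := P / 9.
  rewrite -subr_ge0.
  have -> : 9 * (x1 ^+ 2 + x2 ^+ 2 + x3 ^+ 2 + x4 ^+ 2 + (x5 ^+ 2 + x6 ^+ 2 + x7 ^+ 2 + x8 ^+ 2 + x9 ^+ 2)) - P ^+ 2
   = 9 * ((x1 - t) ^+ 2 + (x2 - t) ^+ 2 + (x3 - t) ^+ 2 + (x4 - t) ^+ 2 + ((x5 - t) ^+ 2 + (x6 - t) ^+ 2 + (x7 - t) ^+ 2 + (x8 - t) ^+ 2 + (x9 - t) ^+ 2)).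
    by rewrite /t /P; field.
  by rewrite mulr_ge0// !addr_ge0// sqr_ge0.
apply: le_trans (sq9 _ _ _ _ _ _ _ _ _) _.
have -> : 36 * h ^+ 2 = 9 * (4 * h ^+ 2) by ring.
by rewrite -mulrA ler_wpM2l// !mulrDr !lerD.
Qed.

End BoxMoments.

(** * The interpolant on one element *)

Section ElementPolynomial.
Variable R : realType.
Notation mu1 := (@lebesgue_measure R).
Notation mu2 := (mu1 \x mu1)%E.
Implicit Types (f g v p : R * R -> R) (z c : R * R) (x t h : R).

(** The family $P_T$, centered at [c]. It is stable under differentiation, so derivatives of any
    order need no separate formulas. *)
Definition epoly c (a0 a12 a1 a11 b1 a2 a22 b2 : R) z : R :=
  a0 + a12 * ((z.1 - c.1) * (z.2 - c.2)) +
  (a1 * (z.1 - c.1) + a11 * (z.1 - c.1) ^+ 2 + b1 * (z.1 - c.1) ^+ 3) +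
  (a2 * (z.2 - c.2) + a22 * (z.2 - c.2) ^+ 2 + b2 * (z.2 - c.2) ^+ 3).

Lemma epoly_derive1 c a0 a12 a1 a11 b1 a2 a22 b2 z :
  is_derive z.1 1 (fun s => epoly c a0 a12 a1 a11 b1 a2 a22 b2 (s, z.2))
    (epoly c a1 0 (2 * a11) (3 * b1) 0 a12 0 0 z).
Proof.
have d1 := is_derive_pow c.1 z.1 0; have d2 := is_derive_pow c.1 z.1 1.
have d3 := is_derive_pow c.1 z.1 2.
rewrite (_ : (fun t => (t - c.1) ^+ 1) = fun t => t - c.1) in d1; last first.
  by apply/funext => t; rewrite expr1.
rewrite /epoly /=; apply: is_derive_eq; rewrite /GRing.scale/= !expr0 !expr1; ring.
Qed.

Lemma epoly_derive2 c a0 a12 a1 a11 b1 a2 a22 b2 z :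
  is_derive z.2 1 (fun s => epoly c a0 a12 a1 a11 b1 a2 a22 b2 (z.1, s))
    (epoly c a2 0 a12 0 0 (2 * a22) (3 * b2) 0 z).
Proof.
have d1 := is_derive_pow c.2 z.2 0; have d2 := is_derive_pow c.2 z.2 1.
have d3 := is_derive_pow c.2 z.2 2.
rewrite (_ : (fun t => (t - c.2) ^+ 1) = fun t => t - c.2) in d1; last first.
  by apply/funext => t; rewrite expr1.
rewrite /epoly /=; apply: is_derive_eq; rewrite /GRing.scale/= !expr0 !expr1; ring.
Qed.

Lemma continuous_epoly c a0 a12 a1 a11 b1 a2 a22 b2 :
  continuous (epoly c a0 a12 a1 a11 b1 a2 a22 b2).
Proof.
have c1 : continuous (fun z : R * R => z.1 - c.1).
  by move=> z; apply: cvgB; [exact: cvg_fst|exact: cvg_cst].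
have c2 : continuous (fun z : R * R => z.2 - c.2).
  by move=> z; apply: cvgB; [exact: cvg_snd|exact: cvg_cst].
have cX n (u : R * R -> R) : continuous u -> continuous (fun z => u z ^+ n).
  by move=> cu z; apply: (@continuous_comp _ _ _ u (fun t => t ^+ n)); [exact: cu|exact: exprn_continuous].
have cD (u v : R * R -> R) : continuous u -> continuous v -> continuous (fun z => u z + v z).
  by move=> cu cv z; apply: cvgD; [exact: cu|exact: cv].
have cZ k (u : R * R -> R) : continuous u -> continuous (fun z => k * u z).
  by move=> cu z; apply: cvgMr; exact: cu.
have cM (u v : R * R -> R) : continuous u -> continuous v -> continuous (fun z => u z * v z).
  by move=> cu cv z; apply: cvgM; [exact: cu|exact: cv].
have c0 : continuous (fun _ : R * R => a0) by move=> z; exact: cvg_cst.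
exact: (cD _ _ (cD _ _ (cD _ _ c0 (cZ a12 _ (cM _ _ c1 c2)))
    (cD _ _ (cD _ _ (cZ a1 _ c1) (cZ a11 _ (cX 2 _ c1))) (cZ b1 _ (cX 3 _ c1))))
    (cD _ _ (cD _ _ (cZ a2 _ c2) (cZ a22 _ (cX 2 _ c2))) (cZ b2 _ (cX 3 _ c2)))).
Qed.

Lemma Ck_epoly k c a0 a12 a1 a11 b1 a2 a22 b2 : Ck k (epoly c a0 a12 a1 a11 b1 a2 a22 b2).
Proof.
elim: k a0 a12 a1 a11 b1 a2 a22 b2 => [|k IH] a0 a12 a1 a11 b1 a2 a22 b2; first exact: continuous_epoly.
exact: (Ck_intro (@continuous_epoly _ _ _ _ _ _ _ _ _) (@epoly_derive1 _ _ _ _ _ _ _ _ _)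
  (@epoly_derive2 _ _ _ _ _ _ _ _ _) (IH _ _ _ _ _ _ _ _) (IH _ _ _ _ _ _ _ _)).
Qed.

Lemma partial1_epoly c a0 a12 a1 a11 b1 a2 a22 b2 :
  partial1 (epoly c a0 a12 a1 a11 b1 a2 a22 b2) = epoly c a1 0 (2 * a11) (3 * b1) 0 a12 0 0.
Proof. by apply: partial1_eq => z; exact: epoly_derive1. Qed.

Lemma partial2_epoly c a0 a12 a1 a11 b1 a2 a22 b2 :
  partial2 (epoly c a0 a12 a1 a11 b1 a2 a22 b2) = epoly c a2 0 a12 0 0 (2 * a22) (3 * b2) 0.
Proof. by apply: partial2_eq => z; exact: epoly_derive2. Qed.

Lemma PT_epoly c a0 a12 a1 a11 b1 a2 a22 b2 : PT (epoly c a0 a12 a1 a11 b1 a2 a22 b2).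
Proof.
exists (fun z => (a0 - a1 * c.1 - a2 * c.2 + a11 * c.1 ^+ 2 + a22 * c.2 ^+ 2 + a12 * c.1 * c.2
    - b1 * c.1 ^+ 3 - b2 * c.2 ^+ 3) +
  (a1 - 2 * a11 * c.1 - a12 * c.2 + 3 * b1 * c.1 ^+ 2) * z.1 +
  (a2 - 2 * a22 * c.2 - a12 * c.1 + 3 * b2 * c.2 ^+ 2) * z.2 +
  (a11 - 3 * b1 * c.1) * z.1 ^+ 2 + a12 * (z.1 * z.2) + (a22 - 3 * b2 * c.2) * z.2 ^+ 2), b1, b2.
split; last by move=> x; rewrite /epoly; ring.
by do 6 eexists.
Qed.

Lemma PT_centered c p : PT p -> exists a0 a12 a1 a11 b1 a2 a22 b2,
  p = epoly c a0 a12 a1 a11 b1 a2 a22 b2.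
Proof.
move=> [q [b1 [b2 [[q0 [q1 [q2 [q11 [q12 [q22 Hq]]]]]] Hp]]]].
exists (q0 + q1 * c.1 + q2 * c.2 + q11 * c.1 ^+ 2 + q12 * (c.1 * c.2) + q22 * c.2 ^+ 2
  + b1 * c.1 ^+ 3 + b2 * c.2 ^+ 3), q12,
  (q1 + 2 * q11 * c.1 + q12 * c.2 + 3 * b1 * c.1 ^+ 2), (q11 + 3 * b1 * c.1), b1,
  (q2 + 2 * q22 * c.2 + q12 * c.1 + 3 * b2 * c.2 ^+ 2), (q22 + 3 * b2 * c.2), b2.
by apply/funext => z; rewrite Hp Hq /epoly; ring.
Qed.

Lemma rint_affine h x k a : 0 < h ->
  \int[mu1]_(t in `[x - h, x + h]) (k + a * (t - x)) = 2 * h * k.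
Proof.
move=> h0.
have cq : continuous (fun t : R => k + a * (t - x)).
  by move=> t; apply: cvgD; [exact: cvg_cst|apply: cvgMr; exact: continuous_shift].
have dQ (t : R) : is_derive t 1 (fun t => k * (t - x) + a / 2 * (t - x) ^+ 2) (k + a * (t - x)).
  have d1 := is_derive_pow x t 0; have d2 := is_derive_pow x t 1.
  rewrite (_ : (fun t => (t - x) ^+ 1) = fun t => t - x) in d1; last first.
    by apply/funext => y; rewrite expr1.
  by apply: is_derive_eq; rewrite /GRing.scale/= !expr0 !expr1; field.
rewrite (FTC_smooth _ cq dQ); last by rewrite ltrBlDr -addrA ltrDl addr_gt0.
by field.
Qed.

Section Coefficients.
Variables (h : R) (c : R * R).
Hypothesis h0 : 0 < h.
Variables (V : bool -> bool -> R) (E1 E2 : bool -> R).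

(** The interpolation conditions with prescribed numbers as data. *)
Definition dof p := [/\ PT p, forall b1 b2, p (elt_vertex h c b1 b2) = V b1 b2,
  forall b, vedge_integral h c b (partial1 p) = E1 b &
  forall b, hedge_integral h c b (partial2 p) = E2 b].

Lemma dof_epoly a0 a12 a1 a11 b1 a2 a22 b2 :
  dof (epoly c a0 a12 a1 a11 b1 a2 a22 b2) <->
  [/\ forall s1 s2 : bool, a0 + (-1) ^+ s1 * (-1) ^+ s2 * a12 * h ^+ 2 +
      ((-1) ^+ s1 * h * a1 + a11 * h ^+ 2 + (-1) ^+ s1 * b1 * h ^+ 3) +
      ((-1) ^+ s2 * h * a2 + a22 * h ^+ 2 + (-1) ^+ s2 * b2 * h ^+ 3) = V s1 s2,
   forall s : bool, 2 * h * (a1 + 2 * (-1) ^+ s * a11 * h + 3 * b1 * h ^+ 2) = E1 s &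
   forall s : bool, 2 * h * (a2 + 2 * (-1) ^+ s * a22 * h + 3 * b2 * h ^+ 2) = E2 s].
Proof.
rewrite /dof partial1_epoly partial2_epoly.
have v s1 s2 : epoly c a0 a12 a1 a11 b1 a2 a22 b2 (elt_vertex h c s1 s2) =
   a0 + (-1) ^+ s1 * (-1) ^+ s2 * a12 * h ^+ 2 +
      ((-1) ^+ s1 * h * a1 + a11 * h ^+ 2 + (-1) ^+ s1 * b1 * h ^+ 3) +
      ((-1) ^+ s2 * h * a2 + a22 * h ^+ 2 + (-1) ^+ s2 * b2 * h ^+ 3).
  by rewrite /epoly /elt_vertex /=; case: s1; case: s2; rewrite ?expr0 ?expr1; ring.
have e1 s : vedge_integral h c s (epoly c a1 0 (2 * a11) (3 * b1) 0 a12 0 0) =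
    2 * h * (a1 + 2 * (-1) ^+ s * a11 * h + 3 * b1 * h ^+ 2).
  rewrite -(rint_affine c.2 _ a12 h0); apply: eq_Rintegral => t _.
  by rewrite /epoly /=; case: s; rewrite ?expr0 ?expr1; ring.
have e2 s : hedge_integral h c s (epoly c a2 0 a12 0 0 (2 * a22) (3 * b2) 0) =
    2 * h * (a2 + 2 * (-1) ^+ s * a22 * h + 3 * b2 * h ^+ 2).
  rewrite -(rint_affine c.1 _ a12 h0); apply: eq_Rintegral => t _.
  by rewrite /epoly /=; case: s; rewrite ?expr0 ?expr1; ring.
split.
  by move=> [_ h1 h2 h3]; split=> [s1 s2|s|s]; rewrite -?v -?e1 -?e2.
move=> [h1 h2 h3]; split=> [|s1 s2|s|s]; first exact: PT_epoly.
- by rewrite v.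
- by rewrite e1.
- by rewrite e2.
Qed.

(** The equations decouple: the alternating sum of the vertex values gives the mixed coefficient,
    differences and sums of edge integrals give the quadratic and cubic ones. *)
Lemma exists_dof : exists p, dof p.
Proof.
have hn : h != 0 by rewrite gt_eqF.
pose Q1 := V false false + V false true - V true false - V true true.
pose Q2 := V false false + V true false - V false true - V true true.
pose a11 := (E1 false - E1 true) / (8 * h ^+ 2).
pose a22 := (E2 false - E2 true) / (8 * h ^+ 2).
pose b1 := (E1 false + E1 true - Q1) / (8 * h ^+ 3).
pose b2 := (E2 false + E2 true - Q2) / (8 * h ^+ 3).
exists (epoly c ((V false false + V false true + V true false + V true true) / 4
    - a11 * h ^+ 2 - a22 * h ^+ 2)
  ((V false false - V false true - V true false + V true true) / (4 * h ^+ 2))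
  ((Q1 - 4 * b1 * h ^+ 3) / (4 * h)) a11 b1 ((Q2 - 4 * b2 * h ^+ 3) / (4 * h)) a22 b2).
apply/dof_epoly; split=> [s1 s2|s|s].
- by rewrite /b1 /b2 /Q1 /Q2; case: s1; case: s2; rewrite ?expr0 ?expr1; field.
- by rewrite /b1 /a11 /Q1; case: s; rewrite ?expr0 ?expr1; field.
- by rewrite /b2 /a22 /Q2; case: s; rewrite ?expr0 ?expr1; field.
Qed.

Lemma dof_coefficients p : dof p -> exists a0 a12 a1 a11 b1 a2 a22 b2,
  [/\ p = epoly c a0 a12 a1 a11 b1 a2 a22 b2,
      4 * h ^+ 2 * a12 = V false false - V false true - V true false + V true true,
      8 * h ^+ 2 * a11 = E1 false - E1 true /\ 8 * h ^+ 2 * a22 = E2 false - E2 true,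
      8 * h ^+ 3 * b1 =
        E1 false + E1 true - (V false false + V false true - V true false - V true true) &
      8 * h ^+ 3 * b2 =
        E2 false + E2 true - (V false false + V true false - V false true - V true true)].
Proof.
move=> dp; have [/(PT_centered c)[a0 [a12 [a1 [a11 [b1 [a2 [a22 [b2 Ep]]]]]]]] _ _ _] := dp.
move: dp; rewrite Ep => /dof_epoly[hV hE1 hE2].
exists a0, a12, a1, a11, b1, a2, a22, b2.
by rewrite -!hV -!hE1 -!hE2 !expr0 !expr1; split=> //; [ring|split; ring|ring|ring].
Qed.

End Coefficients.

(** Equality on the closed element follows from equality almost everywhere inside. *)
Lemma cont_repr_eq h c v (t : R * R -> R) : 0 < h -> continuous t ->
  {ae mu2, forall z, box (c.1 - h) (c.1 + h) (c.2 - h) (c.2 + h) z -> t z = v z} ->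
  forall z, elt h c z -> cont_repr (elt h c) v z = t z.
Proof.
move=> h0 ct tv.
have ab1 : c.1 - h < c.1 + h by rewrite ltrBlDr -addrA ltrDl addr_gt0.
have ab2 : c.2 - h < c.2 + h by rewrite ltrBlDr -addrA ltrDl addr_gt0.
have tv' : {ae mu2, forall z, elt h c z -> t z = v z}.
  have := ae_not_on_lines (c.1 - h) (c.2 - h); have := ae_not_on_lines (c.1 + h) (c.2 + h).
  apply: (@filterS3 _ _ (ae_filter_ringOfSetsType mu2) _ _ _ _ _ tv) => z tvz [n1 n2] [n3 n4].
  move=> [] /=; rewrite !in_itv/= => /andP[h1 h2] /andP[h3 h4]; apply/tvz/boxE.
  by rewrite !lt_neqAle h1 h2 h3 h4 n1 n2 !(eq_sym (_ - _)) n3 n4.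
have [ct' cv'] : [set u : R * R -> R | {within elt h c, continuous u} /\
    {ae mu2, forall z, elt h c z -> u z = v z}] (cont_repr (elt h c) v).
  rewrite /cont_repr; case: xgetP => // /(_ t) []; split => //.
  exact: continuous_subspaceT.
apply: (continuous_ae_eq ab1 ab2) => //; first exact: continuous_subspaceT.
apply: (@filterS2 _ _ (ae_filter_ringOfSetsType mu2) _ _ _ _ tv' cv') => z h1 h2 hz.
by rewrite h1// h2.
Qed.

Variables (h : R) (c : R * R) (D : nat -> nat -> R * R -> R) (v : R * R -> R).
Hypothesis h0 : 0 < h.
Local Notation A1 := (c.1 - h).
Local Notation B1 := (c.1 + h).
Local Notation A2 := (c.2 - h).
Local Notation B2 := (c.2 + h).
Local Notation K := (elt h c).
Hypothesis tD : tower 4 A1 B1 A2 B2 D.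
Hypothesis Dv : {ae mu2, forall z, box A1 B1 A2 B2 z -> D 0%N 0%N z = v z}.
Hypothesis D1 : {ae mu2, forall z, box A1 B1 A2 B2 z -> D 1%N 0%N z = wderiv K° (1%N, 0%N) v z}.
Hypothesis D2 : {ae mu2, forall z, box A1 B1 A2 B2 z -> D 0%N 1%N z = wderiv K° (0%N, 1%N) v z}.

Let ab1 : A1 < B1. Proof. by rewrite ltrBlDr -addrA ltrDl addr_gt0. Qed.
Let ab2 : A2 < B2. Proof. by rewrite ltrBlDr -addrA ltrDl addr_gt0. Qed.

Let repr i j u z : (i + j + 2 <= 4)%N ->
  {ae mu2, forall z, box A1 B1 A2 B2 z -> D i j z = u z} -> K z ->
  cont_repr K u z = trep A1 B1 A2 B2 D i j z.
Proof.
move=> ij Du; apply: cont_repr_eq => //; first exact: (continuous_trep ab1 ab2 tD ij).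
apply: (@filterS2 _ _ (ae_filter_ringOfSetsType mu2) _ _ _ _ Du (trep_ae ab1 ab2 tD ij)) => y h1 h2 hy.
by rewrite -h1// -h2 /inbox (boxE _ _ _ _ _).1 ?mul1r.
Qed.

Let vertexK b1 b2 : K (elt_vertex h c b1 b2).
Proof.
have hh := ltW h0.
by split; rewrite /= in_itv/=; [case: b1|case: b2]; rewrite ?expr0 ?expr1; apply/andP; split; lra.
Qed.

Let vedgeK (b : bool) t : t \in `[A2, B2]%classic -> K (c.1 + (-1) ^+ b * h, t).
Proof.
have hh := ltW h0.
rewrite inE => ht; split=> //; rewrite /= in_itv/=; case: b; rewrite ?expr0 ?expr1; apply/andP; split; lra.
Qed.

Let hedgeK (b : bool) t : t \in `[A1, B1]%classic -> K (t, c.2 + (-1) ^+ b * h).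
Proof.
have hh := ltW h0.
rewrite inE => ht; split=> //; rewrite /= in_itv/=; case: b; rewrite ?expr0 ?expr1; apply/andP; split; lra.
Qed.

(** Vertex values and edge integrals of a function with enough derivatives are moments, so the
    coefficients are moments too: the quadratic part of the interpolant has the mean second
    derivatives of the function, and its cubic part the difference of two first moments. *)
Lemma Pi_elt_epoly : exists a0 a12 a1 a11 b1 a2 a22 b2,
  [/\ Pi_elt h c v = epoly c a0 a12 a1 a11 b1 a2 a22 b2,
      4 * h ^+ 2 * a12 = mom (D 1 1),
      8 * h ^+ 2 * a11 = mom (D 2 0) /\ 8 * h ^+ 2 * a22 = mom (D 0 2),
      8 * h ^+ 4 * b1 = momX c (D 2 0) - momY c (D 1 1) &
      8 * h ^+ 4 * b2 = momY c (D 0 2) - momX c (D 1 1)].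
Proof.
have hn : h != 0 by rewrite gt_eqF.
pose V b1 b2 := corner h c D 0 0 b1 b2.
pose E1 b := vedge_integral h c b (trep A1 B1 A2 B2 D 1 0).
pose E2 b := hedge_integral h c b (trep A1 B1 A2 B2 D 0 1).
have eq p : is_interpolant h c v p <-> dof h c V E1 E2 p.
  have e0 b1 b2 : cont_repr K v (elt_vertex h c b1 b2) = V b1 b2 by exact: repr.
  have e1 b : vedge_integral h c b (cont_repr K (wderiv K° (1%N, 0%N) v)) = E1 b.
    by apply: eq_Rintegral => t ht; apply: repr => //; exact: vedgeK.
  have e2 b : hedge_integral h c b (cont_repr K (wderiv K° (0%N, 1%N) v)) = E2 b.
    by apply: eq_Rintegral => t ht; apply: repr => //; exact: hedgeK.
  split=> -[h1 h2 h3 h4]; split; first [exact: h1|move=> b|move=> b1 b2].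
  - by move=> b'; rewrite h2 e0.
  - by rewrite h3 e1.
  - by rewrite h4 e2.
  - by move=> b'; rewrite h2 e0.
  - by rewrite h3 e1.
  - by rewrite h4 e2.
have dP : dof h c V E1 E2 (Pi_elt h c v).
  apply/eq; rewrite /Pi_elt; case: xgetP => // no.
  by have [p /eq hp] := exists_dof c h0 V E1 E2; have := no p.
have [a0 [a12 [a1 [a11 [b1 [a2 [a22 [b2 [Ep e12 [e11 e22] eb1 eb2]]]]]]]]] := dof_coefficients h0 dP.
exists a0, a12, a1, a11, b1, a2, a22, b2.
have EW := diffEW_mom h0 tD (i := 0) (j := 0) isT.
have NS := diffNS_mom h0 tD (i := 0) (j := 0) isT.
have v0 : 2 * h * E1 false = mom (D 1 0) + momX c (D 2 0) + 1 * h * mom (D 2 0).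
  exact: (vedge_mom h0 tD (i := 1) (j := 0) false isT).
have v1 : 2 * h * E1 true = mom (D 1 0) + momX c (D 2 0) + -1 * h * mom (D 2 0).
  exact: (vedge_mom h0 tD (i := 1) (j := 0) true isT).
have w0 : 2 * h * E2 false = mom (D 0 1) + momY c (D 0 2) + 1 * h * mom (D 0 2).
  exact: (hedge_mom h0 tD (i := 0) (j := 1) false isT).
have w1 : 2 * h * E2 true = mom (D 0 1) + momY c (D 0 2) + -1 * h * mom (D 0 2).
  exact: (hedge_mom h0 tD (i := 0) (j := 1) true isT).
have MX := mixed_mom h0 tD (i := 0) (j := 0) isT.
rewrite -/(diffEW h c D 0 0) in eb1; rewrite -/(diffNS h c D 0 0) in eb2.
rewrite -/(mixed h c D 0 0) MX in e12.
move: e11 e22 eb1 eb2 v0 v1 w0 w1 EW NS; clear -Ep e12 hn.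
move: (E1 false) (E1 true) (E2 false) (E2 true) (diffEW h c D 0 0) (diffNS h c D 0 0).
move: (mom (D 1 0)) (momX c (D 2 0)) (mom (D 2 0)) (mom (D 0 1)) (momY c (D 0 2)) (mom (D 0 2))
  (momY c (D 1 1)) (momX c (D 1 1)).
move=> p q r s t u y x l1 l2 l3 l4 l5 l6 e11 e22 eb1 eb2 v0 v1 w0 w1 EW NS.
have X1 (x' y' : R) : 2 * h * x' = 2 * h * y' -> x' = y' by apply: mulfI; rewrite mulf_neq0.
split; first exact: Ep.
- exact: e12.
- by split; apply: X1; [rewrite e11 mulrBr v0 v1|rewrite e22 mulrBr w0 w1]; ring.
- have -> : 8 * h ^+ 4 * b1 = h * (8 * h ^+ 3 * b1) by ring.
  rewrite eb1 mulrBr EW; apply: X1.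
  have -> : 2 * h * (h * (l1 + l2) - (p + y)) =
    h * (2 * h * l1 + 2 * h * l2 - 2 * (p + y)) by ring.
  rewrite v0 v1; ring.
- have -> : 8 * h ^+ 4 * b2 = h * (8 * h ^+ 3 * b2) by ring.
  rewrite eb2 mulrBr NS; apply: X1.
  have -> : 2 * h * (h * (l3 + l4) - (s + x)) =
    h * (2 * h * l3 + 2 * h * l4 - 2 * (s + x)) by ring.
  rewrite w0 w1; ring.
Qed.

End ElementPolynomial.

(** * The error product on one element *)

Section ElementEnergy.
Variable R : realType.
Notation mu1 := (@lebesgue_measure R).
Notation mu2 := (mu1 \x mu1)%E.
Implicit Types (f g v p : R * R -> R) (z c : R * R) (x t h k l : R).

Section Affine.
Variables (h : R) (c : R * R).
Hypothesis h0 : 0 < h.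
Local Notation A1 := (c.1 - h).
Local Notation B1 := (c.1 + h).
Local Notation A2 := (c.2 - h).
Local Notation B2 := (c.2 + h).
Local Notation inK := (@inbox R A1 B1 A2 B2).

Definition affX k l z := inK z * (k + l * (z.1 - c.1)).

Let ab1 : A1 < B1. Proof. by rewrite ltrBlDr -addrA ltrDl addr_gt0. Qed.

Lemma affXE f k l : off2 A1 B1 A2 B2 f ->
  (fun z => (f z - affX k l z) * affX k l z) =
  (fun z => k * f z + l * ((z.1 - c.1) * f z) -
    (k ^+ 2 * inK z + 2 * k * l * ((z.1 - c.1) * inK z) + l ^+ 2 * ((z.1 - c.1) ^+ 2 * inK z))).
Proof.
move=> of2; apply/funext => z; rewrite /affX.
have [hz|hz] := boolP ((A1 < z.1 < B1) && (A2 < z.2 < B2)); first by rewrite /inbox hz /=; ring.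
by rewrite of2// /inbox (negbTE hz) /=; ring.
Qed.

Let sI := rintegrable_inbox A1 B1 A2 B2.
Let sX : rintegrable mu2 (fun z => (z.1 - c.1) * inK z).
Proof. exact: (rintegrable_X h0 sI (@off2_inbox _ _ _ _ _)). Qed.
Let sX2 : rintegrable mu2 (fun z => (z.1 - c.1) ^+ 2 * inK z).
Proof.
exact: (rintegrable_weight1 ab1 (@continuous_shiftX R c.1 2) sI (@off2_inbox _ _ _ _ _)).
Qed.

Let sL f k l (sf : rintegrable mu2 f) (of2 : off2 A1 B1 A2 B2 f) :=
  rintegrableD (rintegrableZ k sf) (rintegrableZ l (rintegrable_X h0 sf of2)).
Let sQ k l := rintegrableD (rintegrableD (rintegrableZ (k ^+ 2) sI) (rintegrableZ (2 * k * l) sX))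
  (rintegrableZ (l ^+ 2) sX2).

Lemma rintegrable_affX f k l : rintegrable mu2 f -> off2 A1 B1 A2 B2 f ->
  rintegrable mu2 (fun z => (f z - affX k l z) * affX k l z).
Proof. by move=> sf of2; rewrite (affXE _ _ of2); exact: rintegrableB (sL k l sf of2) (sQ k l). Qed.

Lemma rint_affX f k l : rintegrable mu2 f -> off2 A1 B1 A2 B2 f ->
  \int[mu2]_z ((f z - affX k l z) * affX k l z) =
  k * mom f + l * momX c f - (4 * h ^+ 2 * k ^+ 2 + 4 * h ^+ 4 / 3 * l ^+ 2).
Proof.
move=> sf of2; rewrite (affXE _ _ of2) (rintB (sL k l sf of2) (sQ k l)).
have sXf := rintegrable_X h0 sf of2.
rewrite (rintD (rintegrableZ k sf) (rintegrableZ l sXf)) !rintZ//.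
rewrite (rintD (rintegrableD (rintegrableZ (k ^+ 2) sI) (rintegrableZ (2 * k * l) sX)) (rintegrableZ (l ^+ 2) sX2)).
rewrite (rintD (rintegrableZ (k ^+ 2) sI) (rintegrableZ (2 * k * l) sX)) !rintZ//.
have e0 : \int[mu2]_z inK z = _ := mom_inbox c h0.
have e1 : \int[mu2]_z ((z.1 - c.1) * inK z) = _ := momX_inbox c h0.
rewrite e0 e1 (mom_X2_inbox c h0) -/(mom f) -/(momX c f); ring.
Qed.

End Affine.

Variables (h : R) (c : R * R).
Hypothesis h0 : 0 < h.
Local Notation A1 := (c.1 - h).
Local Notation B1 := (c.1 + h).
Local Notation A2 := (c.2 - h).
Local Notation B2 := (c.2 + h).
Local Notation inK := (@inbox R A1 B1 A2 B2).

Definition affY k l z := inK z * (k + l * (z.2 - c.2)).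

Let affYE f k l : (fun z => (f z - affY k l z) * affY k l z) =
  transpose (fun z => (transpose f z - affX h (swap_center c) k l z) * affX h (swap_center c) k l z).
Proof.
apply/funext => z; rewrite /transpose /affY /affX /inbox /= andbC; case: z => z1 z2 //=.
Qed.

Lemma rintegrable_affY f k l : rintegrable mu2 f -> off2 A1 B1 A2 B2 f ->
  rintegrable mu2 (fun z => (f z - affY k l z) * affY k l z).
Proof.
move=> sf of2; rewrite affYE; apply/rintegrable_transpose/rintegrable_affX => //.
  exact: rintegrable_transpose.
exact: off2_transpose.
Qed.

Lemma rint_affY f k l : rintegrable mu2 f -> off2 A1 B1 A2 B2 f ->
  \int[mu2]_z ((f z - affY k l z) * affY k l z) =
  k * mom f + l * momY c f - (4 * h ^+ 2 * k ^+ 2 + 4 * h ^+ 4 / 3 * l ^+ 2).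
Proof.
move=> sf of2; have sT := rintegrable_transpose sf.
have oT : off2 A2 B2 A1 B1 (transpose f) by exact: off2_transpose.
rewrite affYE [LHS](rint_transpose (rintegrable_affX (c := swap_center c) h0 k l sT oT)).
rewrite (rint_affX (c := swap_center c) h0 k l sT oT) mom_transpose// momY_transpose//.
exact: (rintegrable_Y h0 sf of2).
Qed.

(** The error of the mixed derivative has mean value zero, so its product with the constant mixed
    derivative of the interpolant disappears. The pure second derivatives of the interpolant are
    affine with the right mean value, and $8h^4b_1$ is a difference of two first moments, which
    leaves products of first moments. *)
Lemma element_energy (D : nat -> nat -> R * R -> R) a12 a11 a22 b1 b2 :
  tower 4 A1 B1 A2 B2 D ->
  4 * h ^+ 2 * a12 = mom (D 1 1) ->
  8 * h ^+ 2 * a11 = mom (D 2 0) -> 8 * h ^+ 2 * a22 = mom (D 0 2) ->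
  8 * h ^+ 4 * b1 = momX c (D 2 0) - momY c (D 1 1) ->
  8 * h ^+ 4 * b2 = momY c (D 0 2) - momX c (D 1 1) ->
  let F z := (D 2 0 z - affX h c (2 * a11) (6 * b1) z) * affX h c (2 * a11) (6 * b1) z +
     2 * ((D 1 1 z - affX h c a12 0 z) * affX h c a12 0 z) +
     (D 0 2 z - affY (2 * a22) (6 * b2) z) * affY (2 * a22) (6 * b2) z in
  rintegrable mu2 F /\ \int[mu2]_z F z =
  3 / (4 * h ^+ 4) * ((momX c (D 2 0) - momY c (D 1 1)) * momY c (D 1 1) +
                        (momY c (D 0 2) - momX c (D 1 1)) * momX c (D 1 1)).
Proof.
move=> tD e12 e11 e22 eb1 eb2 F.
have s i j := @tower_int _ _ _ _ _ _ _ tD i j; have o i j := @tower_off _ _ _ _ _ _ _ tD i j.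
have s20 := rintegrable_affX h0 (2 * a11) (6 * b1) (s 2 0 isT) (o 2 0 isT).
have s11 := rintegrable_affX h0 a12 0 (s 1 1 isT) (o 1 1 isT).
have s02 := rintegrable_affY (2 * a22) (6 * b2) (s 0 2 isT) (o 0 2 isT).
split; first exact: rintegrableD (rintegrableD s20 (rintegrableZ 2 s11)) s02.
rewrite (rintD (rintegrableD s20 (rintegrableZ 2 s11)) s02) (rintD s20 (rintegrableZ 2 s11)) (rintZ 2 s11).
rewrite (rint_affX h0 (2 * a11) (6 * b1) (s 2 0 isT) (o 2 0 isT)).
rewrite (rint_affX h0 a12 0 (s 1 1 isT) (o 1 1 isT)).
rewrite (rint_affY (2 * a22) (6 * b2) (s 0 2 isT) (o 0 2 isT)).
rewrite -e12 -e11 -e22.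
have -> : momX c (D 2 0) = 8 * h ^+ 4 * b1 + momY c (D 1 1) by rewrite eb1; ring.
have -> : momY c (D 0 2) = 8 * h ^+ 4 * b2 + momX c (D 1 1) by rewrite eb2; ring.
by field; rewrite gt_eqF.
Qed.

End ElementEnergy.

(** * Geometry of the mesh *)

Section Mesh.
Variable R : realType.
Notation mu1 := (@lebesgue_measure R).
Notation mu2 := (mu1 \x mu1)%E.
Implicit Types (f g v p w : R * R -> R) (z c : R * R) (h : R) (T : {fset (R * R)}).
Implicit Types (U V A Omega : set (R * R)).

Notation ebox h c := (box (c.1 - h) (c.1 + h) (c.2 - h) (c.2 + h)).
Notation ecut h c := (cut (c.1 - h) (c.1 + h) (c.2 - h) (c.2 + h)).

Lemma elt_interior h c : (elt h c)° = ebox h c.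
Proof.
rewrite eqEsubset; split=> z.
  move=> /nbhs_boxP[e e0 he]; have e2 : 0 < e / 2 by rewrite divr_gt0.
  have [] : elt h c (z.1 + e / 2, z.2 + e / 2).
    by apply/he/boxE => /=; apply/andP; split; apply/andP; split; lra.
  have [] : elt h c (z.1 - e / 2, z.2 - e / 2).
    by apply/he/boxE => /=; apply/andP; split; apply/andP; split; lra.
  rewrite /= !in_itv/= => /andP[h1 _] /andP[h2 _] /andP[_ h3] /andP[_ h4].
  by apply/boxE; apply/andP; split; apply/andP; split; lra.
move=> /nbhs_box; apply: filterS => y /boxE/andP[/andP[h1 h2] /andP[h3 h4]].
by split; rewrite /= in_itv/=; apply/andP; split; apply: ltW.
Qed.

Lemma mesh_sub Omega h T c : square_mesh Omega h T -> c \in T -> ebox h c `<=` Omega.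
Proof.
move=> [_ -> _] cT; rewrite -elt_interior; apply: interiorS => z cz.
by exists c.
Qed.

Lemma mesh_open Omega h T : square_mesh Omega h T -> open Omega.
Proof. by move=> [_ -> _]; exact: open_interior. Qed.

Lemma edge_not_interior h c F z : is_edge h c F -> F z -> ~ ebox h c z.
Proof.
move=> [b eF] Fz /boxE/andP[/andP[h1 h2] /andP[h3 h4]].
case: eF => E; move: Fz; rewrite E => -[/= h5 h6].
  by case: b h5 {E} => h5; move: h1 h2; rewrite h5 ?expr1 ?expr0 ?mulN1r ?mul1r ltxx.
by case: b h6 {E} => h6; move: h3 h4; rewrite h6 ?expr1 ?expr0 ?mulN1r ?mul1r ltxx.
Qed.

(** Two elements meet in a vertex or an edge at most, and those consist of boundary points. *)
Lemma mesh_disjoint Omega h T c c' z : square_mesh Omega h T -> c \in T -> c' \in T ->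
  ebox h c z -> ebox h c' z -> c = c'.
Proof.
move=> [_ _ hT] cT c'T zc zc'; apply/eqP; apply: contrapT => /negP ncc'.
have sub d : ebox h d `<=` elt h d by rewrite -elt_interior; exact: interior_subset.
have zz : (elt h c `&` elt h c') z by split; apply: sub.
case: (hT c c' cT c'T ncc').
- by move=> E; rewrite E in zz.
- move=> [x [[b1 [b2 vx]] _ E]]; move: zz; rewrite E /= => zx.
  apply: (@edge_not_interior h c (elt_vedge h c b1) z) => //.
    by exists b1; left.
  move/boxE : zc => /andP[_ /andP[h3 h4]].
  rewrite zx vx; split=> //=; rewrite in_itv/=.
  by move: h3 h4; rewrite zx vx /= => /ltW -> /ltW ->.
- by move=> [F [eF _ E]]; rewrite E in zz; exact: (edge_not_interior eF zz).
Qed.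

Lemma piecewise_in Omega h T (F : R * R -> R * R -> R) c z : square_mesh Omega h T -> c \in T ->
  ebox h c z -> piecewise h T F z = F c z.
Proof.
move=> mT cT zc; rewrite /piecewise (bigD1_seq c)//=; last exact: fset_uniq.
rewrite patchE ifT; last by rewrite inE elt_interior.
rewrite big_seq_cond big1 ?addr0// => c' /andP[c'T nc]; rewrite patchE ifF//.
apply/negbTE; rewrite notin_setE elt_interior => zc'.
by move/eqP : nc; apply; exact: (mesh_disjoint mT c'T cT zc' zc).
Qed.

Lemma piecewise_out h T (F : R * R -> R * R -> R) z : (forall c, c \in T -> ~ ebox h c z) ->
  piecewise h T F z = 0.
Proof.
move=> hz; rewrite /piecewise big_seq big1// => c cT; rewrite patchE ifF//.
by apply/negbTE; rewrite notin_setE elt_interior; exact: hz.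
Qed.

Lemma weak_deriv0 U v g : is_weak_deriv U (0%N, 0%N) v g -> is_weak_deriv U (0%N, 0%N) v v.
Proof. by move=> [lv _ _]; split => // phi _; rewrite expr0 mul1r. Qed.

(** Tensor products of bumps on the rectangle are test functions on the open set; both sides of
    each relation reduce to the integral of [w] against the same derivative of such a product. *)
Lemma tower_cut n U a1 b1 a2 b2 w (D : nat -> nat -> R * R -> R) : box a1 b1 a2 b2 `<=` U ->
  (forall i j, (i + j <= n)%N -> is_weak_deriv U (i, j) w (D i j)) ->
  (forall i j, (i + j <= n)%N -> mu2.-integrable (box a1 b1 a2 b2) (EFin \o D i j)) ->
  tower n a1 b1 a2 b2 (fun i j => cut a1 b1 a2 b2 (D i j)).
Proof.
move=> bU wD iD; split=> i j ij.
  by split; [exact/rintegrable_cut/iD|exact: cut_off].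
(* All entries are expressed by [w] itself. *)
have key i' j' eta psi : (i' + j' <= n)%N -> bump a1 b1 eta -> bump a2 b2 psi ->
    \int[mu2]_z (cut a1 b1 a2 b2 (D i' j') z * (eta z.1 * psi z.2)) =
    (-1) ^+ (i' + j') * \int[mu2]_z (w z * tensor (derive1n i' eta) (derive1n j' psi) z).
  move=> ij' be bp; have [_ _ H] := (weak_derivP _ _ _ _).1 (wD _ _ ij').
  have := H _ (test_tensor bU be bp); rewrite pderiv_tensor; [|by case: be|by case: bp].
  by move=> ->; rewrite mulrA -expr2 sqrr_sign mul1r (cut_test _ be bp).
have i1 : (i.+1 + j <= n)%N by rewrite addSn.
have j1 : (i + j.+1 <= n)%N by rewrite addnS.
split=> eta psi be bp.
  rewrite (key _ _ _ _ (ltnW ij) (bump_derive1 be) bp) (key _ _ _ _ i1 be bp).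
  by rewrite addSn exprS mulN1r mulNr opprK -derive1Sn.
rewrite (key _ _ _ _ (ltnW ij) be (bump_derive1 bp)) (key _ _ _ _ j1 be bp).
by rewrite addnS exprS mulN1r mulNr opprK -derive1Sn.
Qed.

(** Here $|g|\le 1+g^2$ and the rectangle has finite measure. *)
Lemma L2_integrable_box U a1 b1 a2 b2 g : open U -> box a1 b1 a2 b2 `<=` U -> L2 U g ->
  mu2.-integrable (box a1 b1 a2 b2) (EFin \o g) /\
  rintegrable mu2 (fun z => cut a1 b1 a2 b2 g z ^+ 2).
Proof.
move=> oU bU [mg ig]; have mU := open_measurable2 oU; have mb := @measurable_box R a1 b1 a2 b2.
have ib : mu2.-integrable (box a1 b1 a2 b2) (fun z => (g z ^+ 2)%:E) by exact: integrableS ig.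
have s2 : rintegrable mu2 (fun z => cut a1 b1 a2 b2 g z ^+ 2).
  have := rintegrable_cut (f := fun z => g z ^+ 2) ib; congr (rintegrable _ _).
  apply/funext => z; rewrite /cut /inbox; case: (_ && _) => /=; first by rewrite !mul1r.
  by rewrite !mul0r expr0n.
split=> //.
have mgb : measurable_fun setT (g \_ (box a1 b1 a2 b2)).
  have mgb := measurable_funS mU bU mg.
  by apply: (measurable_restrictT _ mb).1 mgb.
have sB := rintegrableD (rintegrable_inbox a1 b1 a2 b2) s2.
suff H z : `|(g \_ (box a1 b1 a2 b2)) z| <= inbox a1 b1 a2 b2 z + cut a1 b1 a2 b2 g z ^+ 2.
  have : rintegrable mu2 (g \_ (box a1 b1 a2 b2)) by apply: rintegrable_le sB H; exact: mgb.
  rewrite /rintegrable -restrict_EFin => r.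
  by apply: (integrable_mkcond _ _).2 r.
rewrite -cut_patch /cut /inbox; case: (_ && _) => /=; rewrite ?mul0r ?normr0 ?expr0n ?addr0//.
rewrite mul1r -(real_normK (num_real (g z))).
have := sqr_ge0 (`|g z| - 1); have := sqr_ge0 (`|g z|); rewrite sqrrB1 => ? ?; lra.
Qed.

Lemma loc_integrable_measurable a1 b1 a2 b2 g : loc_integrable (box a1 b1 a2 b2) g ->
  measurable_fun (box a1 b1 a2 b2) g.
Proof.
move=> lg.
pose e (n : nat) : R := n.+1%:R^-1.
have e0 n : 0 < e n by rewrite /e invr_gt0.
pose K (n : nat) : set (R * R) := `[a1 + e n, b1 - e n]%classic `*` `[a2 + e n, b2 - e n]%classic.
have Kb n : K n `<=` box a1 b1 a2 b2.
  move=> z [] /=; rewrite !in_itv/= => /andP[h1 h2] /andP[h3 h4]; apply/boxE.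
  by have := e0 n => ?; apply/andP; split; apply/andP; split; lra.
have cK n : compact (K n) by exact: compact_box.
have -> : box a1 b1 a2 b2 = \bigcup_n K n.
  rewrite eqEsubset; split=> z; last by move=> [n _]; exact: Kb.
  move=> /boxE/andP[/andP[h1 h2] /andP[h3 h4]].
  pose m := Num.min (Num.min (z.1 - a1) (b1 - z.1)) (Num.min (z.2 - a2) (b2 - z.2)).
  have m0 : 0 < m by rewrite !lt_min !subr_gt0 h1 h2 h3 h4.
  have [e1 e2 e3 e4] : [/\ m <= z.1 - a1, m <= b1 - z.1, m <= z.2 - a2 & m <= b2 - z.2].
    by split; rewrite !ge_min lexx ?orbT.
  exists (Num.trunc m^-1) => //.
  have nm : e (Num.trunc m^-1) < m by rewrite /e invf_plt ?posrE//; exact: truncnS_gt.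
  by split; rewrite /= in_itv/=; apply/andP; split; lra.
apply/measurable_fun_bigcup; first by move=> n; exact: compact_measurable2.
by move=> n; have /integrableP[/measurable_EFinP] := lg _ (cK n) (Kb n).
Qed.

Lemma ae_seq (s : seq (R * R)) (P : R * R -> R * R -> Prop) :
  (forall c, c \in s -> {ae mu2, forall z, P c z}) ->
  {ae mu2, forall z, forall c, c \in s -> P c z}.
Proof.
elim: s => [|c s IH] h.
  by apply: (@filterS _ _ (ae_filter_ringOfSetsType mu2) setT) => //; exact: filterT.
have h1 := h c (mem_head _ _).
have h2 : {ae mu2, forall z, forall c, c \in s -> P c z}.
  by apply: IH => c' c's; apply: h; rewrite inE c's orbT.
apply: (@filterS2 _ _ (ae_filter_ringOfSetsType mu2) _ _ _ _ h1 h2) => z Pc Ps c'.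
by rewrite inE => /orP[/eqP ->//|]; exact: Ps.
Qed.

End Mesh.

(** * From the domain to the elements *)

Section MeshData.
Variable R : realType.
Notation mu1 := (@lebesgue_measure R).
Notation mu2 := (mu1 \x mu1)%E.
Implicit Types (f g v p : R * R -> R) (z c : R * R) (h : R) (T : {fset (R * R)}).

Notation ebox h c := (box (c.1 - h) (c.1 + h) (c.2 - h) (c.2 + h)).
Notation ecut h c := (cut (c.1 - h) (c.1 + h) (c.2 - h) (c.2 + h)).
Notation ein h c := (inbox (c.1 - h) (c.1 + h) (c.2 - h) (c.2 + h)).
Notation classical i j p := (iter j (@partial2 R) (iter i (@partial1 R) p)).

Lemma loc_integrable_wderiv (U : set (R * R)) (a : multi_index) v :
  loc_integrable U (wderiv U a v).
Proof.
rewrite /wderiv; case: xgetP => [y _ []//|_].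
by apply: loc_integrable_continuous => z; exact: cvg_cst.
Qed.

Variables (Omega : set (R * R)) (w : R * R -> R) (D : nat -> nat -> R * R -> R).
Hypothesis oO : open Omega.
Hypothesis wD : forall i j, (i + j <= 4)%N -> is_weak_deriv Omega (i, j) w (D i j).
Hypothesis lD : forall i j, (i + j <= 4)%N -> L2 Omega (D i j).

Lemma mesh_tower a1 b1 a2 b2 : box a1 b1 a2 b2 `<=` Omega ->
  tower 4 a1 b1 a2 b2 (fun i j => cut a1 b1 a2 b2 (D i j)).
Proof.
move=> bO; apply: (tower_cut bO wD) => i j ij.
by have [] := L2_integrable_box oO bO (lD ij).
Qed.

(** Inside an element the piecewise interpolant is a polynomial, whose weak derivatives are the
    classical ones. *)
Lemma wderiv_elt h c (i j : nat) p W : ebox h c `<=` Omega -> (i + j <= 4)%N -> Ck (i + j) p ->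
  (forall z, ebox h c z -> W z = w z - p z) ->
  {ae mu2, forall z, ebox h c z -> wderiv (elt h c)° (i, j) W z = D i j z - classical i j p z}.
Proof.
move=> bO ij kp Wp; rewrite elt_interior.
have wd : is_weak_deriv (ebox h c) (i, j) W (fun z => D i j z - classical i j p z).
  apply: (@weak_deriv_eq _ _ _ (fun z => w z - p z)); first by move=> z /Wp ->.
  by apply: weak_derivB; [exact: weak_derivS bO (wD ij)|exact: weak_deriv_Ck].
apply: (weak_deriv_unique _ _ wd); first by [].
by apply: wderivP; exists (fun z => D i j z - classical i j p z).
Qed.

Lemma wderiv_elt_classical h c (i j : nat) p W : Ck (i + j) p ->
  (forall z, ebox h c z -> W z = p z) ->
  {ae mu2, forall z, ebox h c z -> wderiv (elt h c)° (i, j) W z = classical i j p z}.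
Proof.
move=> kp Wp; rewrite elt_interior.
have wd : is_weak_deriv (ebox h c) (i, j) W (classical i j p).
  by apply: (@weak_deriv_eq _ _ _ p); [move=> z /Wp ->|exact: weak_deriv_Ck].
apply: (weak_deriv_unique _ _ wd); first by [].
by apply: wderivP; exists (classical i j p).
Qed.

Lemma Pi_elt_data h c : 0 < h -> ebox h c `<=` Omega ->
  exists a0 a12 a1 a11 b1 a2 a22 b2, let D' i j := ecut h c (D i j) in
  [/\ Pi_elt h c w = epoly c a0 a12 a1 a11 b1 a2 a22 b2,
      4 * h ^+ 2 * a12 = mom (D' 1%N 1%N),
      8 * h ^+ 2 * a11 = mom (D' 2%N 0%N) /\ 8 * h ^+ 2 * a22 = mom (D' 0%N 2%N),
      8 * h ^+ 4 * b1 = momX c (D' 2%N 0%N) - momY c (D' 1%N 1%N) &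
      8 * h ^+ 4 * b2 = momY c (D' 0%N 2%N) - momX c (D' 1%N 1%N)].
Proof.
move=> h0 bO; have d (i j : nat) : (i + j <= 4)%N ->
    {ae mu2, forall z, ebox h c z -> ecut h c (D i j) z = wderiv (elt h c)° (i, j) w z}.
  move=> ij; have wd : is_weak_deriv (ebox h c) (i, j) w (D i j) by exact: weak_derivS bO (wD ij).
  have := weak_deriv_unique (@subset_refl _ _) wd (wderivP (ex_intro _ _ wd)).
  apply: (@filterS _ _ (ae_filter_ringOfSetsType mu2)) => z hz zc.
  by rewrite cutE// elt_interior; exact: hz.
apply: (Pi_elt_epoly h0 (mesh_tower bO)); [|exact: d|exact: d].
have := weak_deriv_unique bO (wD (i := 0%N) (j := 0%N) isT) (weak_deriv0 (wD (i := 0%N) (j := 0%N) isT)).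
by apply: (@filterS _ _ (ae_filter_ringOfSetsType mu2)) => z hz zc; rewrite cutE// hz.
Qed.

Definition elt_integrand h c z :=
  let q i j z := ein h c z * classical i j (Pi_elt h c w) z in
  let d i j z := ecut h c (D i j) z in
  (d 2%N 0%N z - q 2%N 0%N z) * q 2%N 0%N z + 2 * ((d 1%N 1%N z - q 1%N 1%N z) * q 1%N 1%N z) +
  (d 0%N 2%N z - q 0%N 2%N z) * q 0%N 2%N z.

Definition elt_product h c :=
  let d i j := ecut h c (D i j) in
  3 / (4 * h ^+ 4) * ((momX c (d 2%N 0%N) - momY c (d 1%N 1%N)) * momY c (d 1%N 1%N) +
                      (momY c (d 0%N 2%N) - momX c (d 1%N 1%N)) * momX c (d 1%N 1%N)).

Lemma Ck_Pi_elt h c k : 0 < h -> ebox h c `<=` Omega -> Ck k (Pi_elt h c w).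
Proof.
move=> h0 bO; have [a0 [a12 [a1 [a11 [b1 [a2 [a22 [b2 [-> _ _ _ _]]]]]]]]] := Pi_elt_data h0 bO.
exact: Ck_epoly.
Qed.

Lemma elt_integral h c : 0 < h -> ebox h c `<=` Omega ->
  rintegrable mu2 (elt_integrand h c) /\ \int[mu2]_z elt_integrand h c z = elt_product h c.
Proof.
move=> h0 bO; have tD := mesh_tower bO.
have [a0 [a12 [a1 [a11 [b1 [a2 [a22 [b2 [Ep e12 [e11 e22] eb1 eb2]]]]]]]]] := Pi_elt_data h0 bO.
have := element_energy h0 tD e12 e11 e22 eb1 eb2; rewrite -/(elt_product h c).
set F := (fun z => _); suff -> : elt_integrand h c = F by [].
apply/funext => z; rewrite /elt_integrand Ep /F /= !(partial1_epoly, partial2_epoly).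
have E20 : ein h c z * epoly c (2 * a11) 0 (2 * (3 * b1)) (3 * 0) 0 0 0 0 z =
    affX h c (2 * a11) (6 * b1) z by rewrite /affX /epoly; ring.
have E11 : ein h c z * epoly c a12 0 0 0 0 (2 * 0) (3 * 0) 0 z = affX h c a12 0 z.
  by rewrite /affX /epoly; ring.
have E02 : ein h c z * epoly c (2 * a22) 0 0 0 0 (2 * (3 * b2)) (3 * 0) 0 z =
    affY h c (2 * a22) (6 * b2) z by rewrite /affY /epoly; ring.
by rewrite E20 E11 E02.
Qed.

Variables (h : R) (T : {fset (R * R)}).
Hypothesis mT : square_mesh Omega h T.

Let h0 : 0 < h. Proof. by case: mT. Qed.
Let bO c (cT : c \in T) : ebox h c `<=` Omega := mesh_sub mT cT.

Let W := w \- Pi_h h T w.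

Definition mesh_integrand z := \sum_i \sum_j hess_h h T W z i j * hess_h h T (Pi_h h T w) z i j.

Lemma measurable_hess v (i j : 'I_2) : measurable_fun setT (fun z => hess_h h T v z i j).
Proof.
rewrite (_ : (fun z => _) = fun z =>
    \sum_(c <- T) ((wderiv (elt h c)° (hess_index i j) v) \_ (elt h c)°) z); last first.
  by apply/funext => z; rewrite mxE.
apply: measurable_sum => c; rewrite elt_interior.
have mb := @measurable_box R (c.1 - h) (c.1 + h) (c.2 - h) (c.2 + h).
have mw := loc_integrable_measurable (loc_integrable_wderiv (hess_index i j) v (U := ebox h c)).
by apply: (measurable_restrictT _ mb).1 mw.
Qed.

Lemma measurable_mesh_integrand : measurable_fun setT mesh_integrand.
Proof.
apply: measurable_sum => i; apply: measurable_sum => j.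
by apply: measurable_funM; exact: measurable_hess.
Qed.

Lemma mesh_integrand_elt c : c \in T ->
  {ae mu2, forall z, ebox h c z -> mesh_integrand z = elt_integrand h c z}.
Proof.
move=> cT; pose p := Pi_elt h c w.
have kp k : Ck k p by exact: Ck_Pi_elt h0 (bO cT).
have Wp z : ebox h c z -> W z = w z - p z.
  by move=> zc; rewrite /W /Pi_h /= (piecewise_in _ mT cT zc).
have Pp z : ebox h c z -> Pi_h h T w z = p z.
  by move=> zc; exact: (piecewise_in _ mT cT zc).
have A i j (ij : (i + j <= 4)%N) := wderiv_elt (bO cT) ij (kp _) Wp.
have B i j := wderiv_elt_classical (i := i) (j := j) (kp _) Pp.
have A20 := A 2%N 0%N isT; have A11 := A 1%N 1%N isT; have A02 := A 0%N 2%N isT.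
have Bs := @filterS3 _ _ (ae_filter_ringOfSetsType mu2) _ _ _ _
  (fun z x1 x2 x3 => And3 x1 x2 x3) (B 2%N 0%N) (B 1%N 1%N) (B 0%N 2%N).
have As := @filterS3 _ _ (ae_filter_ringOfSetsType mu2) _ _ _ _
  (fun z x1 x2 x3 => And3 x1 x2 x3) A20 A11 A02.
apply: (@filterS2 _ _ (ae_filter_ringOfSetsType mu2) _ _ _ _ As Bs) => z [x1 x2 x3] [y1 y2 y3] zc.
have hE v i j : hess_h h T v z i j = wderiv (elt h c)° (hess_index i j) v z.
  by rewrite mxE (piecewise_in _ mT cT zc).
(* The mixed entry occurs twice in the Hessian. *)
have h00 : hess_index ord0 ord0 = (2, 0)%N by [].
have h01 : hess_index ord0 (lift ord0 ord0) = (1, 1)%N by [].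
have h10 : hess_index (lift ord0 ord0) ord0 = (1, 1)%N by [].
have h11 : hess_index (lift ord0 ord0) (lift ord0 ord0) = (0, 2)%N by [].
rewrite /mesh_integrand !big_ord_recl !big_ord0 !hE h00 h01 h10 h11.
rewrite (x1 zc) (x2 zc) (x3 zc) (y1 zc) (y2 zc) (y3 zc) /elt_integrand.
have hi : ein h c z = 1 by rewrite /inbox ((boxE _ _ _ _ _).1 zc).
rewrite /cut hi -/p.
move: (D 2%N 0%N z) (D 1%N 1%N z) (D 0%N 2%N z) (classical 2%N 0%N p z) (classical 1%N 1%N p z)
  (classical 0%N 2%N p z) => d1 d2 d3 q1 q2 q3; ring.
Qed.

(** Outside the open elements both sides vanish, so the edges need no argument. *)
Lemma mesh_integrand_ae : {ae mu2, forall z, \sum_(c <- T) elt_integrand h c z = mesh_integrand z}.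
Proof.
have := ae_seq (fun c (cT : c \in (T : seq _)) => mesh_integrand_elt cT).
apply: (@filterS _ _ (ae_filter_ringOfSetsType mu2)) => z hz.
have out c : ~ ebox h c z -> elt_integrand h c z = 0.
  move=> /boxE zc; have hi : ein h c z = 0 by rewrite /inbox; move/negP/negbTE: zc => ->.
  rewrite /elt_integrand /cut hi.
  move: (D 2%N 0%N z) (D 1%N 1%N z) (D 0%N 2%N z) (classical 2%N 0%N (Pi_elt h c w) z)
    (classical 1%N 1%N (Pi_elt h c w) z) (classical 0%N 2%N (Pi_elt h c w) z) => d1 d2 d3 q1 q2 q3; ring.
have [[c cT zc]|no] := pselect (exists2 c, c \in T & ebox h c z).
  rewrite (hz c cT zc) (bigD1_seq c cT (fset_uniq T)) /=.
  rewrite big_seq_cond big1 ?addr0// => c' /andP[c'T nc]; apply: out => zc'.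
  by move/eqP : nc; apply; exact: (mesh_disjoint mT c'T cT zc' zc).
have no' c : c \in T -> ~ ebox h c z by move=> cT zc; apply: no; exists c.
rewrite big_seq big1; last by move=> c cT; apply/out/no'.
apply/esym/big1 => i _; apply: big1 => j _.
by rewrite mxE piecewise_out ?mul0r.
Qed.

Lemma L2_inner_elements : L2_inner Omega (hess_h h T W) (hess_h h T (Pi_h h T w)) =
  \sum_(c <- T) elt_product h c.
Proof.
pose F c z := if c \in T then elt_integrand h c z else 0.
have sF c : rintegrable mu2 (F c).
  rewrite /F; case: (boolP (c \in T)) => cT; last exact: integrable0.
  by have [] := elt_integral h0 (bO cT).
have EF z : \sum_(c <- T) F c z = \sum_(c <- T) elt_integrand h c z.
  by apply: eq_big_seq => c cT; rewrite /F cT.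
transitivity (\int[mu2]_z mesh_integrand z).
  rewrite /L2_inner Rintegral_mkcond; apply: eq_rint => z; rewrite patchE.
  case: ifPn => //; rewrite notin_setE => zO; apply/esym/big1 => i _; apply: big1 => j _.
  by rewrite mxE piecewise_out ?mul0r// => c cT zc; apply: zO; exact: bO zc.
transitivity (\int[mu2]_z \sum_(c <- T) F c z).
  apply/esym/rint_ae; [exact: rintegrable_sum|exact: measurable_mesh_integrand|].
  apply: (@filterS _ _ (ae_filter_ringOfSetsType mu2) _ _ _ mesh_integrand_ae) => z hz.
  by rewrite EF.
rewrite rint_sum//; apply: eq_big_seq => c cT.
by rewrite /F cT; have [] := elt_integral h0 (bO cT).
Qed.

Definition domain_energy :=
  let I i j := \int[mu2]_(z in Omega) (D i j z ^+ 2) in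
  I 3%N 0%N + I 2%N 1%N + I 1%N 2%N + I 0%N 3%N +
  (I 4%N 0%N + I 3%N 1%N + I 2%N 2%N + I 1%N 3%N + I 0%N 4%N).

(** The elements overlap in null sets only. *)
Lemma sum_elt_sq i j : (i + j <= 4)%N ->
  \sum_(c <- T) \int[mu2]_z (ecut h c (D i j) z ^+ 2) <= \int[mu2]_(z in Omega) (D i j z ^+ 2).
Proof.
move=> ij; have mO := open_measurable2 oO.
pose F c z := if c \in T then ecut h c (D i j) z ^+ 2 else 0.
have sF c : rintegrable mu2 (F c).
  rewrite /F; case: (boolP (c \in T)) => cT; last exact: integrable0.
  by have [_] := L2_integrable_box oO (bO cT) (lD ij).
rewrite [leLHS](_ : _ = \int[mu2]_z \sum_(c <- T) F c z); last first.
  by rewrite rint_sum//; apply: eq_big_seq => c cT; rewrite /F cT.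
have sO : rintegrable mu2 ((fun z => D i j z ^+ 2) \_ Omega).
  rewrite /rintegrable -restrict_EFin; have [_ h1] := lD ij.
  by apply: (integrable_mkcond _ _).1 h1.
rewrite [leRHS]Rintegral_mkcond; apply: (rint_le (rintegrable_sum T sF) sO) => z.
rewrite patchE.
have [[c cT zc]|no] := pselect (exists2 c, c \in T & ebox h c z).
  rewrite ifT; last by rewrite inE; exact: bO zc.
  rewrite (bigD1_seq c cT (fset_uniq T)) /=.
  rewrite big_seq_cond big1 ?addr0; first by rewrite /F cT cutE.
  move=> c' /andP[c'T nc]; rewrite /F c'T cut_off ?expr0n//; apply/negP => /boxE zc'.
  by move/eqP : nc; apply; exact: (mesh_disjoint mT c'T cT zc' zc).
rewrite big_seq big1; first by case: ifPn => // _; exact: sqr_ge0.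
move=> c cT; rewrite /F cT cut_off ?expr0n//; apply/negP => /boxE zc'.
by apply: no; exists c.
Qed.

Lemma sum_energy : \sum_(c <- T) energy (fun i j => ecut h c (D i j)) <= domain_energy.
Proof. by rewrite /energy !big_split /= /domain_energy !lerD//; exact: sum_elt_sq. Qed.

End MeshData.

(** * Cancellation between neighbouring elements *)

Section Cancellation.
Variable R : realType.
Notation mu1 := (@lebesgue_measure R).
Notation mu2 := (mu1 \x mu1)%E.
Implicit Types (f g v p : R * R -> R) (z c e : R * R) (h : R) (T : {fset (R * R)}).

Notation ebox h c := (box (c.1 - h) (c.1 + h) (c.2 - h) (c.2 + h)).
Notation ecut h c := (cut (c.1 - h) (c.1 + h) (c.2 - h) (c.2 + h)).

(** Summation by translation: the terms without a partner vanish. *)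
Lemma sum_shift T e (F G : R * R -> R) :
  (forall c, c \in T -> c + e \in T -> F c = G (c + e)) ->
  (forall c, c \in T -> c + e \notin T -> F c = 0) ->
  (forall c, c \in T -> c - e \notin T -> G c = 0) ->
  \sum_(c <- T) F c = \sum_(c <- T) G c.
Proof.
move=> h1 h2 h3.
have -> : \sum_(c <- T) F c = \sum_(c <- T | c + e \in T) G (c + e).
  rewrite big_seq [RHS]big_seq_cond [RHS]big_mkcondr /=.
  by apply: eq_bigr => c cT; case: ifPn => ce; [exact: h1|exact: h2].
have -> : \sum_(c <- T) G c = \sum_(c <- T | c - e \in T) G c.
  rewrite big_seq [RHS]big_seq_cond [RHS]big_mkcondr /=.
  by apply: eq_bigr => c cT; case: ifPn => ce; [|exact: h3].
rewrite -big_filter -[RHS]big_filter -(big_map (fun c => c + e) xpredT G).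
apply: perm_big; apply: uniq_perm.
- by rewrite map_inj_uniq ?filter_uniq ?fset_uniq//; exact: addIr.
- by rewrite filter_uniq ?fset_uniq.
move=> c; rewrite mem_filter; apply/mapP/andP => [[d]|[cT cT']].
  by rewrite mem_filter => /andP[deT dT] ->; rewrite addrK.
by exists (c - e); rewrite ?subrK// mem_filter subrK cT'.
Qed.

Variables (Omega : set (R * R)) (w : R * R -> R) (D : nat -> nat -> R * R -> R).
Hypothesis oO : open Omega.
Hypothesis wD : forall i j, (i + j <= 4)%N -> is_weak_deriv Omega (i, j) w (D i j).
Hypothesis lD : forall i j, (i + j <= 4)%N -> L2 Omega (D i j).

(** Both sides are continuous, and equal almost everywhere on the smaller rectangle. This is how
    the values computed in two neighbouring elements are identified at their common vertices. *)
Lemma trep_sub (i j : nat) (a1 b1 a2 b2 c1 d1 c2 d2 : R) z : (i + j + 2 <= 4)%N -> a1 < b1 -> a2 < b2 ->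
  box a1 b1 a2 b2 `<=` box c1 d1 c2 d2 -> box c1 d1 c2 d2 `<=` Omega ->
  (`[a1, b1] `*` `[a2, b2]) z ->
  trep a1 b1 a2 b2 (fun i j => cut a1 b1 a2 b2 (D i j)) i j z =
  trep c1 d1 c2 d2 (fun i j => cut c1 d1 c2 d2 (D i j)) i j z.
Proof.
move=> ij ab1 ab2 ac cO; have aO := subset_trans ac cO.
have [cd1 cd2] : c1 < d1 /\ c2 < d2.
  have : box c1 d1 c2 d2 ((a1 + b1) / 2, (a2 + b2) / 2).
    by apply/ac/boxE; rewrite /= !midf_lt.
  by move=> /boxE/andP[/andP[x1 x2] /andP[x3 x4]]; split; [exact: lt_trans x1 x2|exact: lt_trans x3 x4].
have tA := mesh_tower oO wD lD aO; have tC := mesh_tower oO wD lD cO.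
move: z; apply: (continuous_ae_eq ab1 ab2).
- exact/continuous_subspaceT/(continuous_trep ab1 ab2 tA ij).
- exact/continuous_subspaceT/(continuous_trep cd1 cd2 tC ij).
have n1 := ae_not_on_lines a1 a2; have n2 := ae_not_on_lines b1 b2.
have n3 := @filterS2 _ _ (ae_filter_ringOfSetsType mu2) _ _ _ (fun z x y => conj x y) n1 n2.
apply: (@filterS3 _ _ (ae_filter_ringOfSetsType mu2) _ _ _ _ _
  (trep_ae ab1 ab2 tA ij) (trep_ae cd1 cd2 tC ij) n3) => z e1 e2 [[n4 n5] [n6 n7]].
move=> [] /=; rewrite !in_itv/= => /andP[h1 h2] /andP[h3 h4].
have za : box a1 b1 a2 b2 z.
  by apply/boxE; rewrite !lt_neqAle h1 h2 h3 h4 n6 n7 !(eq_sym _ z.1) !(eq_sym _ z.2) n4 n5.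
have zc := ac _ za; move: e1 e2.
by rewrite /inbox ((boxE _ _ _ _ _).1 za) ((boxE _ _ _ _ _).1 zc) !mul1r !cutE// => -> ->.
Qed.

Definition vertex_value h c i j (b1 b2 : bool) :=
  corner h c (fun i j => ecut h c (D i j)) i j b1 b2.

Let vertexK h c b1 b2 : 0 < h ->
  (`[c.1 - h, c.1 + h] `*` `[c.2 - h, c.2 + h]) (elt_vertex h c b1 b2).
Proof.
move=> h0; have hh := ltW h0.
by split; rewrite /= in_itv/=; [case: b1|case: b2]; rewrite ?expr0 ?expr1; apply/andP; split; lra.
Qed.

Lemma vertex_value_shared h c c' (i j : nat) (b1 b2 b1' b2' : bool) (c1 d1 c2 d2 : R) : 0 < h ->
  (i + j + 2 <= 4)%N -> ebox h c `<=` box c1 d1 c2 d2 -> ebox h c' `<=` box c1 d1 c2 d2 ->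
  box c1 d1 c2 d2 `<=` Omega -> elt_vertex h c b1 b2 = elt_vertex h c' b1' b2' ->
  vertex_value h c i j b1 b2 = vertex_value h c' i j b1' b2'.
Proof.
move=> h0 ij cB c'B BO E; rewrite /vertex_value /corner.
have lt (x : R) : x - h < x + h by rewrite ltrBlDr -addrA ltrDl addr_gt0.
rewrite (trep_sub ij (lt _) (lt _) cB BO (vertexK c b1 b2 h0)).
by rewrite (trep_sub ij (lt _) (lt _) c'B BO (vertexK c' b1' b2' h0)) E.
Qed.

Variables (h : R) (T : {fset (R * R)}).
Hypothesis mT : square_mesh Omega h T.
Let h0 : 0 < h. Proof. by case: mT. Qed.
Let bO c (cT : c \in T) : ebox h c `<=` Omega := mesh_sub mT cT.

Let e1 : R * R := (2 * h, 0).
Let e2 : R * R := (0, 2 * h).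

Lemma union_box B : open B -> (forall z, B z -> exists2 c, c \in T & elt h c z) -> B `<=` Omega.
Proof.
move=> oB hB z Bz; have [_ -> _] := mT.
have : nbhs z B by exact: open_nbhs_nbhs.
by apply: filterS => y /hB[c cT cy]; exists c.
Qed.

Lemma union_EW c : c \in T -> c + e1 \in T ->
  box (c.1 - h) (c.1 + 3 * h) (c.2 - h) (c.2 + h) `<=` Omega.
Proof.
move=> cT ceT; apply: union_box; first exact: open_box.
move=> z /boxE/andP[/andP[z1 z2] /andP[z3 z4]].
have [zc|zc] := leP z.1 (c.1 + h).
  by exists c => //; split; rewrite /= in_itv/=; apply/andP; split; lra.
by exists (c + e1) => //; split; rewrite /= in_itv/=; apply/andP; split; lra.
Qed.

Lemma union_NS c : c \in T -> c + e2 \in T ->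
  box (c.1 - h) (c.1 + h) (c.2 - h) (c.2 + 3 * h) `<=` Omega.
Proof.
move=> cT ceT; apply: union_box; first exact: open_box.
move=> z /boxE/andP[/andP[z1 z2] /andP[z3 z4]].
have [zc|zc] := leP z.2 (c.2 + h).
  by exists c => //; split; rewrite /= in_itv/=; apply/andP; split; lra.
by exists (c + e2) => //; split; rewrite /= in_itv/=; apply/andP; split; lra.
Qed.

Lemma vertex_value_EW c i j b : (i + j + 2 <= 4)%N -> c \in T -> c + e1 \in T ->
  vertex_value h c i j false b = vertex_value h (c + e1) i j true b.
Proof.
move=> ij cT ceT; apply: (vertex_value_shared h0 ij _ _ (union_EW cT ceT)).
- move=> z /boxE/andP[/andP[z1 z2] /andP[z3 z4]]; have := h0 => ?.
  by apply/boxE; apply/andP; split; apply/andP; split; lra.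
- move=> z /boxE/= /andP[/andP[z1 z2] /andP[z3 z4]]; have := h0 => ?.
  by apply/boxE; apply/andP; split; apply/andP; split; lra.
- by rewrite /elt_vertex /= expr0 expr1 addr0; congr (_, _); ring.
Qed.

Lemma vertex_value_NS c i j b : (i + j + 2 <= 4)%N -> c \in T -> c + e2 \in T ->
  vertex_value h c i j b false = vertex_value h (c + e2) i j b true.
Proof.
move=> ij cT ceT; apply: (vertex_value_shared h0 ij _ _ (union_NS cT ceT)).
- move=> z /boxE/andP[/andP[z1 z2] /andP[z3 z4]]; have := h0 => ?.
  by apply/boxE; apply/andP; split; apply/andP; split; lra.
- move=> z /boxE/= /andP[/andP[z1 z2] /andP[z3 z4]]; have := h0 => ?.
  by apply/boxE; apply/andP; split; apply/andP; split; lra.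
- by rewrite /elt_vertex /= expr0 expr1 addr0; congr (_, _); ring.
Qed.

Hypothesis bE : forall c b, c \in T -> c + e1 \notin T -> vertex_value h c 1 1 false b = 0.
Hypothesis bW : forall c b, c \in T -> c - e1 \notin T -> vertex_value h c 1 1 true b = 0.
Hypothesis bN : forall c b, c \in T -> c + e2 \notin T -> vertex_value h c 1 1 b false = 0.
Hypothesis bS : forall c b, c \in T -> c - e2 \notin T -> vertex_value h c 1 1 b true = 0.

(** The contribution of a vertical edge to the null form: the sum of the values of one second
    derivative at its ends times the difference of those of $\partial_{12}w$. It is the same from
    both sides of the edge. *)
Definition vflux i j c b := (vertex_value h c i j b false + vertex_value h c i j b true) *
  (vertex_value h c 1 1 b false - vertex_value h c 1 1 b true).
Definition hflux i j c b := (vertex_value h c i j false b + vertex_value h c i j true b) *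
  (vertex_value h c 1 1 false b - vertex_value h c 1 1 true b).

Lemma sum_vflux i j : (i + j + 2 <= 4)%N ->
  \sum_(c <- T) vflux i j c false = \sum_(c <- T) vflux i j c true.
Proof.
move=> ij; apply: (@sum_shift _ e1) => c cT ce; rewrite /vflux.
- by rewrite !(vertex_value_EW _ _ cT ce).
- by rewrite !bE// subrr mulr0.
- by rewrite !bW// subrr mulr0.
Qed.

Lemma sum_hflux i j : (i + j + 2 <= 4)%N ->
  \sum_(c <- T) hflux i j c false = \sum_(c <- T) hflux i j c true.
Proof.
move=> ij; apply: (@sum_shift _ e2) => c cT ce; rewrite /hflux.
- by rewrite !(vertex_value_NS _ _ cT ce).
- by rewrite !bN// subrr mulr0.
- by rewrite !bS// subrr mulr0.
Qed.

Definition null_form c :=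
  let d i j := ecut h c (D i j) in
  diffEW h c d 2 0 * diffNS h c d 1 1 - diffNS h c d 2 0 * diffEW h c d 1 1 +
  (diffNS h c d 0 2 * diffEW h c d 1 1 - diffEW h c d 0 2 * diffNS h c d 1 1).

(** A discrete divergence: $\partial_1s\,\partial_2z-\partial_2s\,\partial_1z$ is the divergence
    of $s(\partial_2z,-\partial_1z)$, and the identity is its analogue for differences. *)
Lemma null_form_flux c : null_form c =
  2 * (vflux 2 0 c false - vflux 2 0 c true - (hflux 2 0 c false - hflux 2 0 c true)) -
  2 * (vflux 0 2 c false - vflux 0 2 c true - (hflux 0 2 c false - hflux 0 2 c true)).
Proof.
rewrite /null_form /diffEW /diffNS /vflux /hflux /vertex_value.
set d := fun i j => ecut h c (D i j).
move: (corner h c d 2 0 false false) (corner h c d 2 0 false true) (corner h c d 2 0 true false) (corner h c d 2 0 true true) => s1 s2 s3 s4.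
move: (corner h c d 1 1 false false) (corner h c d 1 1 false true) (corner h c d 1 1 true false) (corner h c d 1 1 true true) => z1 z2 z3 z4.
move: (corner h c d 0 2 false false) (corner h c d 0 2 false true) (corner h c d 0 2 true false) (corner h c d 0 2 true true) => t1 t2 t3 t4.
ring.
Qed.

Lemma sum_null_form : \sum_(c <- T) null_form c = 0.
Proof.
rewrite (eq_bigr _ (fun c _ => null_form_flux c)) sumrB -!mulr_sumr !sumrB.
have vs : \sum_(c <- T) vflux 2 0 c false = \sum_(c <- T) vflux 2 0 c true by exact: sum_vflux.
have vt : \sum_(c <- T) vflux 0 2 c false = \sum_(c <- T) vflux 0 2 c true by exact: sum_vflux.
have hs : \sum_(c <- T) hflux 2 0 c false = \sum_(c <- T) hflux 2 0 c true by exact: sum_hflux.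
have ht : \sum_(c <- T) hflux 0 2 c false = \sum_(c <- T) hflux 0 2 c true by exact: sum_hflux.
rewrite vs vt hs ht; move: (\sum_(c <- T) vflux 2 0 c true) (\sum_(c <- T) hflux 2 0 c true).
move: (\sum_(c <- T) vflux 0 2 c true) (\sum_(c <- T) hflux 0 2 c true) => p q r s; ring.
Qed.

(** With the null forms gone only the remainders are left, each of them at most a multiple of
    $h^3(1+h)$ times the energy of the third and fourth derivatives on the element. *)
Lemma mesh_estimate :
  L2_inner Omega (hess_h h T (w \- Pi_h h T w)) (hess_h h T (Pi_h h T w)) <=
  324 * domain_energy Omega D * (h * (1 + h)) * h ^+ 2.
Proof.
rewrite (L2_inner_elements oO wD lD mT).
have -> : \sum_(c <- T) elt_product D h c =
    \sum_(c <- T) (elt_product D h c - h ^+ 2 / 12 * null_form c).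
  have N0 : \sum_(c <- T) h ^+ 2 / 12 * null_form c = 0 by rewrite -mulr_sumr sum_null_form mulr0.
  by rewrite sumrB N0 subr0.
apply: (@le_trans _ _ (\sum_(c <- T) (9 * h * (1 + h)) *
    (36 * h ^+ 2 * energy (fun i j => ecut h c (D i j))))).
  rewrite big_seq [leRHS]big_seq; apply: ler_sum => c cT.
  have tD := mesh_tower oO wD lD (bO cT).
  apply: le_trans (ler_norm _) _; apply: le_trans (element_estimate h0 tD) _.
  apply: ler_wpM2l; first by rewrite !mulr_ge0// ?addr_ge0// ltW.
  apply: (total_energy h0 tD) => i j ij.
  by have [] := L2_integrable_box oO (bO cT) (lD ij).
rewrite -mulr_sumr -mulr_sumr.
have -> : 324 * domain_energy Omega D * (h * (1 + h)) * h ^+ 2 =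
  9 * h * (1 + h) * (36 * h ^+ 2 * domain_energy Omega D) by ring.
apply: ler_wpM2l; first by rewrite !mulr_ge0// ?addr_ge0// ltW.
apply: ler_wpM2l; first by rewrite mulr_ge0// exprn_ge0// ltW.
exact: (sum_energy oO lD mT).
Qed.

End Cancellation.

(** * Edges on the boundary of the domain *)

Section BoundaryEdges.
Variable R : realType.
Implicit Types (z c x : R * R) (h : R) (T : {fset (R * R)}) (F Omega : set (R * R)).

Notation ebox h c := (box (c.1 - h) (c.1 + h) (c.2 - h) (c.2 + h)).

Lemma elt_closed h c : closed (elt h c).
Proof. exact: (compact_closed2 (@compact_box R _ _ _ _)). Qed.

Lemma edge_sub h c F : 0 < h -> is_edge h c F -> F `<=` elt h c.
Proof.
move=> h0 [b [-> | ->]] z [/= z1 z2]; split=> //=; rewrite in_itv/=.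
  by rewrite z1; case: b {z1}; rewrite ?expr0 ?expr1; apply/andP; split; lra.
by rewrite z2; case: b {z2}; rewrite ?expr0 ?expr1; apply/andP; split; lra.
Qed.

(** If no other element contained the point, a neighbourhood of it would avoid all other closed
    elements and lie in [elt h c], of which the point is not interior. The common part of the two
    elements is then an edge, and the edge is unique because the point is no vertex. *)
Lemma interior_edge Omega h T c F x : square_mesh Omega h T -> c \in T -> is_edge h c F ->
  F x -> ~ is_vertex h c x -> Omega x ->
  exists2 c', c' \in T & [/\ c != c', is_edge h c' F & elt h c `&` elt h c' = F].
Proof.
move=> mT cT eF Fx nv Ox; have [h0 EO hT] := mT.
have Kx : elt h c x by exact: (edge_sub h0 eF).
have [c' [c'T ncc' K'x]] : exists c', [/\ c' \in T, c != c' & elt h c' x].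
  apply: contrapT => no.
  have : nbhs x (fun z => forall c', c' \in (T : seq _) -> c != c' -> ~ elt h c' z).
    have : forall c', c' \in (T : seq _) -> c != c' -> ~ elt h c' x.
      by move=> c' c'T nc K'x; apply: no; exists c'.
    elim: (T : seq _) => [_|d s IH hs]; first by apply: filterS filterT.
    have n1 : nbhs x (fun z => forall c', c' \in s -> c != c' -> ~ elt h c' z).
      by apply: IH => c' c's; apply: hs; rewrite inE c's orbT.
    have n2 : nbhs x (fun z => c != d -> ~ elt h d z).
      have [_|ncd] := eqVneq c d; first by apply: filterS filterT.
      have : nbhs x (~` elt h d).
        apply: open_nbhs_nbhs; split; first exact/closed_openC/elt_closed.
        by apply: hs => //; rewrite inE eqxx.
      by apply: filterS.
    apply: filterS2 n1 n2 => z h1 h2 c'; rewrite inE => /orP[/eqP ->//|]; exact: h1.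
  have : nbhs x (\bigcup_(c in [set` T]) elt h c) by move: Ox; rewrite EO.
  move=> n1 n2; apply: (edge_not_interior eF Fx); rewrite -elt_interior.
  rewrite /interior; apply: filterS2 n1 n2 => z [d dT Kd] hz.
  by have [->//|ncd] := eqVneq c d; have := hz d dT ncd.
have xx : (elt h c `&` elt h c') x by [].
exists c' => //; case: (hT c c' cT c'T ncc').
- by move=> E; rewrite E in xx.
- move=> [y [vy _ E]]; move: xx; rewrite E /= => xy.
  by rewrite xy in nv.
move=> [G [eG eG' E]]; suff -> : F = G by [].
have xG : G x by rewrite -E.
(* A point on two different edges of [c] is a vertex of [c]. *)
clear -eF eG Fx xG nv h0.
have [b hF] := eF; have [b' hG] := eG.
have S (e : bool) (t : R) : 0 < h -> t + (-1) ^+ e * h = t + (-1) ^+ (~~ e) * h -> False.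
  by move=> ?; case: e; rewrite ?expr0 ?expr1 => /addrI; lra.
have S2 (e e' : bool) (t : R) : t + (-1) ^+ e * h = t + (-1) ^+ e' * h -> e = e'.
  by move=> E; apply: contrapT => ne; apply: (S e t h0); rewrite E; congr (_ + (-1) ^+ _ * _); case: e e' ne {E} => -[].
case: hF => EF; case: hG => EG; rewrite EF EG; rewrite EF in Fx; rewrite EG in xG;
  case: Fx => /= x1 x2; case: xG => /= y1 y2.
- by congr (elt_vedge h c _); apply: (S2 b b' c.1); rewrite -x1 -y1.
- by case: nv; exists b, b'; rewrite (surjective_pairing x) x1 y2.
- by case: nv; exists b', b; rewrite (surjective_pairing x) y1 x2.
- by congr (elt_hedge h c _); apply: (S2 b b' c.2); rewrite -x2 -y2.
Qed.

Lemma vedge_neighbour h c c' b : 0 < h -> c != c' -> is_edge h c' (elt_vedge h c b) ->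
  c' = c + ((-1) ^+ b * (2 * h), 0).
Proof.
move=> h0 ncc' [b' eE].
have p1 : elt_vedge h c b (c.1 + (-1) ^+ b * h, c.2 - h) by split => //=; rewrite in_itv/=; apply/andP; split; lra.
have p2 : elt_vedge h c b (c.1 + (-1) ^+ b * h, c.2 + h) by split => //=; rewrite in_itv/=; apply/andP; split; lra.
case: eE => E; rewrite E in p1 p2; clear E; case: p1 => /=; case: p2 => /=; last first.
  by move=> _ q1 _ q2; exfalso; clear ncc'; lra.
rewrite !in_itv/= => _ /andP[h1 h2] h3 /andP[h4 h5].
have E2 : c'.2 = c.2 by lra.
have nb : b != b'.
  apply: contraNN ncc' => /eqP bb; apply/eqP; rewrite (surjective_pairing c) (surjective_pairing c') E2.
  by move: h3; rewrite bb => /addIr ->.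
rewrite (surjective_pairing c') E2; congr (_, _); rewrite /= ?addr0//.
by case: b b' nb h3 => -[]//= _; rewrite ?expr0 ?expr1; lra.
Qed.

Lemma hedge_neighbour h c c' b : 0 < h -> c != c' -> is_edge h c' (elt_hedge h c b) ->
  c' = c + (0, (-1) ^+ b * (2 * h)).
Proof.
move=> h0 ncc' [b' eE].
have p1 : elt_hedge h c b (c.1 - h, c.2 + (-1) ^+ b * h) by split => //=; rewrite in_itv/=; apply/andP; split; lra.
have p2 : elt_hedge h c b (c.1 + h, c.2 + (-1) ^+ b * h) by split => //=; rewrite in_itv/=; apply/andP; split; lra.
case: eE => E; rewrite E in p1 p2; clear E; case: p1 => /=; case: p2 => /=.
  by move=> q1 _ q2 _; exfalso; clear ncc'; lra.
rewrite !in_itv/= => /andP[h1 h2] _ /andP[h4 h5] h3.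
have E1 : c'.1 = c.1 by lra.
have nb : b != b'.
  apply: contraNN ncc' => /eqP bb; apply/eqP; rewrite (surjective_pairing c) (surjective_pairing c') E1.
  by move: h3; rewrite bb => /addIr ->.
rewrite (surjective_pairing c') E1; congr (_, _); rewrite /= ?addr0//.
by case: b b' nb h3 => -[]//= _; rewrite ?expr0 ?expr1; lra.
Qed.

Lemma vedge_outside Omega h T c (b : bool) (y : R) : square_mesh Omega h T -> c \in T ->
  c + ((-1) ^+ b * (2 * h), 0) \notin T -> c.2 - h < y < c.2 + h ->
  ~ Omega (c.1 + (-1) ^+ b * h, y).
Proof.
move=> mT cT ce /andP[y1 y2] Ox; have [h0 _ _] := mT.
have eF : is_edge h c (elt_vedge h c b) by exists b; left.
have Fx : elt_vedge h c b (c.1 + (-1) ^+ b * h, y).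
  by split => //=; rewrite in_itv/= (ltW y1) (ltW y2).
have nv : ~ is_vertex h c (c.1 + (-1) ^+ b * h, y).
  by move=> [b1 [b2 [_ E]]]; move: y1 y2; rewrite E; case: b2 {E}; rewrite ?expr0 ?expr1; lra.
have [c' c'T [ncc' eF' _]] := interior_edge mT cT eF Fx nv Ox.
by move: ce; rewrite -(vedge_neighbour h0 ncc' eF') c'T.
Qed.

Lemma hedge_outside Omega h T c (b : bool) (y : R) : square_mesh Omega h T -> c \in T ->
  c + (0, (-1) ^+ b * (2 * h)) \notin T -> c.1 - h < y < c.1 + h ->
  ~ Omega (y, c.2 + (-1) ^+ b * h).
Proof.
move=> mT cT ce /andP[y1 y2] Ox; have [h0 _ _] := mT.
have eF : is_edge h c (elt_hedge h c b) by exists b; right.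
have Fx : elt_hedge h c b (y, c.2 + (-1) ^+ b * h).
  by split => //=; rewrite in_itv/= (ltW y1) (ltW y2).
have nv : ~ is_vertex h c (y, c.2 + (-1) ^+ b * h).
  by move=> [b1 [b2 [E _]]]; move: y1 y2; rewrite E; case: b1 {E}; rewrite ?expr0 ?expr1; lra.
have [c' c'T [ncc' eF' _]] := interior_edge mT cT eF Fx nv Ox.
by move: ce; rewrite -(hedge_neighbour h0 ncc' eF') c'T.
Qed.

End BoundaryEdges.

(** * The mixed derivative on boundary edges *)

Section BoundaryTrace.
Variable R : realType.
Notation mu1 := (@lebesgue_measure R).
Notation mu2 := (mu1 \x mu1)%E.
Implicit Types (f g : R * R -> R) (z : R * R) (eta : R -> R).

Lemma continuous_ae0 (a b : R) (phi : R -> R) : a < b -> continuous phi ->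
  {ae mu1, forall y, ind_itv a b y * phi y = 0} -> forall y, a <= y <= b -> phi y = 0.
Proof.
move=> ab cphi h y /andP[ay yb]; apply: contrapT => /eqP nz.
have : nbhs y (fun t => phi t != 0) by exact: (cvgr_neq0 _ (cphi y)).
move=> /nbhs_ballP[e /= e0 he].
have [] := @ae_itv_neq0 R (Num.max a (y - e)) (Num.min b (y + e)) _ _ h.
  rewrite gt_max !lt_min ab /=; apply/andP; split; first by lra.
  by apply/andP; split; lra.
move=> t /andP[]; rewrite gt_max lt_min => /andP[t1 t2] /andP[t3 t4].
rewrite /ind_itv t1 t3 mul1r => /eqP; apply/negP; apply: he.
by rewrite /ball/= distrC ltr_norml; apply/andP; split; lra.
Qed.

Variables (a1 b1 a2 b2 : R) (D : nat -> nat -> R * R -> R) (x0 : R).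
Variables (u v : nat -> R * R -> R).
Hypotheses (ab1 : a1 < b1) (ab2 : a2 < b2) (tD : tower 4 a1 b1 a2 b2 D).
Hypothesis hx0 : x0 = a1 \/ x0 = b1.
Hypotheses (cu : forall n, continuous (u n)) (cv : forall n, continuous (v n)).
Hypothesis du : forall n z, is_derive z.1 1 (fun s => u n (s, z.2)) (v n z).
Hypothesis u0 : forall n y, a2 < y < b2 -> u n (x0, y) = 0.

Local Notation K := (kern a1 b1 x0).
Local Notation ucut := (cut a1 b1 a2 b2).

Let sc g : continuous g -> rintegrable mu2 (ucut g) := @rintegrable_cut_continuous _ _ _ _ _ g.

Let line0 n y : a2 < y < b2 -> \int[mu1]_s (ucut (u n) (s, y) + K s * ucut (v n) (s, y)) = 0.
Proof.
move=> y12.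
have cul := @continuous_line1 _ _ y (@cu n); have cvl := @continuous_line1 _ _ y (@cv n).
have dul (s : R) : is_derive s 1 (fun s => u n (s, y)) (v n (s, y)) by exact: (du n (s, y)).
(* On the interval the kernel is $s-o$ where [o] is the end opposite to [x0], and then the
   integrand is the derivative of $(s-o)u$, which vanishes at [o] by its first factor and at [x0]
   by its second. *)
have key (o : R) : (forall s, a1 < s < b1 -> K s = s - o) -> (b1 - o) * u n (b1, y) = (a1 - o) * u n (a1, y) ->
    \int[mu1]_s (ucut (u n) (s, y) + K s * ucut (v n) (s, y)) = 0.
  move=> hK e; pose q (s : R) := u n (s, y) + (s - o) * v n (s, y).
  have cq : continuous q.
    move=> s; apply: cvgD; first exact: cul.
    by apply: cvgM; [exact: continuous_shift|exact: cvl].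
  have dQ (s : R) : is_derive s 1 (fun s => (s - o) * u n (s, y)) (q s).
    have d1 : is_derive s 1 (fun s : R => s - o) 1 by apply: is_derive_eq; rewrite subr0.
    apply: (is_derive_eq (is_deriveM d1 (dul s))); rewrite /GRing.scale/= /q mulr1; ring.
  transitivity (\int[mu1]_s (ind_itv a1 b1 s * q s)); last first.
    by rewrite (rint_ind_deriv ab1 cq dQ) e subrr.
  apply: eq_rint => s; rewrite /cut /inbox /ind_itv /= y12 andbT.
  by case: (boolP (a1 < s < b1)) => h; rewrite ?mul0r ?mulr0 ?addr0// !mul1r hK.
case: hx0 => E; [apply: (key b1)|apply: (key a1)].
- by move=> s /andP[h1 h2]; rewrite /kern E (ltW h1) mulr1; ring.
- by rewrite subrr mul0r -E u0// mulr0.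
- by move=> s /andP[h1 h2]; rewrite /kern E leNgt h2 mulr0 subr0.
- by rewrite subrr mul0r -E u0// mulr0.
Qed.

Hypothesis cvg1 : \int[mu2]_z `|D 1%N 0%N z - ucut (u n) z| @[n --> \oo] --> (0 : R).
Hypothesis cvg2 : \int[mu2]_z `|D 2%N 0%N z - ucut (v n) z| @[n --> \oo] --> (0 : R).

Let f z := D 1%N 0%N z + K z.1 * D 2%N 0%N z.
Let g z := D 1%N 1%N z + K z.1 * D 2%N 1%N z.

Let s10 := tower_int tD (i := 1%N) (j := 0%N) isT.
Let s20 := tower_int tD (i := 2%N) (j := 0%N) isT.
Let s11 := tower_int tD (i := 1%N) (j := 1%N) isT.
Let s21 := tower_int tD (i := 2%N) (j := 1%N) isT.
Let o10 := tower_off tD (i := 1%N) (j := 0%N) isT.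
Let o20 := tower_off tD (i := 2%N) (j := 0%N) isT.

Let o11 := tower_off tD (i := 1%N) (j := 1%N) isT.
Let o21 := tower_off tD (i := 2%N) (j := 1%N) isT.

Let sf : rintegrable mu2 f := rintegrableD s10 (rintegrable_kern1 x0 s20 o20).
Let sg : rintegrable mu2 g := rintegrableD s11 (rintegrable_kern1 x0 s21 o21).

(** For the test functions the integral vanishes on every line, and it is continuous in $L^1$. *)
Let slice_zero eta : bump a2 b2 eta -> \int[mu2]_z (eta z.2 * f z) = 0.
Proof.
move=> be; have [k Hk] := bump_bounded be; have me := bump_measurable be.
pose fn n z := ucut (u n) z + K z.1 * ucut (v n) z.
have sfn n : rintegrable mu2 (fn n).
  have r1 := sc (@cu n).
  have r2 := rintegrable_kern1 x0 (sc (@cv n)) (@cut_off R a1 b1 a2 b2 (v n)).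
  by apply: rintegrableD; [exact: r1|exact: r2].
have fn0 n : \int[mu2]_z (eta z.2 * fn n z) = 0.
  rewrite (rfubini_mul2 me Hk (sfn n)) (@eq_rint _ _ _ mu1 _ (fun=> 0)); first by rewrite Rintegral_cst ?mul0r.
  move=> y; have [y12|y12] := boolP (a2 < y < b2); first by rewrite line0// mulr0.
  by rewrite (bump_off be y12) mul0r.
pose m n := k * (\int[mu2]_z `|D 1%N 0%N z - ucut (u n) z| + (b1 - a1) * \int[mu2]_z `|D 2%N 0%N z - ucut (v n) z|).
have m0 : m n @[n --> \oo] --> (0 : R).
  rewrite -(mulr0 k) -(addr0 0) -{2}(mulr0 (b1 - a1)).
  by apply: cvgMr; apply: cvgD => //; apply: cvgMr.
have bound n : `|\int[mu2]_z (eta z.2 * f z)| <= m n.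
  have d1 := rintegrableB s10 (sc (@cu n)); have d2 := rintegrableB s20 (sc (@cv n)).
  have n1 := rintegrable_norm d1; have n2 := rintegrable_norm d2.
  have sef := rintegrable_mul2 me Hk sf; have sefn := rintegrable_mul2 me Hk (sfn n).
  rewrite -[X in `|X|]subr0 -(fn0 n) -(rintB sef sefn).
  apply: le_trans (rint_norm (rintegrableB sef sefn)) _.
  rewrite /m -(rintZ (b1 - a1) n2) -(rintD n1 (rintegrableZ (b1 - a1) n2)).
  rewrite -(rintZ k (rintegrableD n1 (rintegrableZ (b1 - a1) n2))).
  have r1 := rintegrable_norm (rintegrableB sef sefn).
  have r2 := rintegrableZ k (rintegrableD n1 (rintegrableZ (b1 - a1) n2)).
  apply: (rint_le r1 r2) => z; rewrite -mulrBr normrM; apply: ler_pM => //.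
  have [h|h] := boolP ((a1 < z.1 < b1) && (a2 < z.2 < b2)); last first.
    by rewrite /f /fn o10// o20// !cut_off// !mulr0 !addr0 subr0 normr0 mulr0 addr0.
  have -> : f z - fn n z = (D 1%N 0%N z - ucut (u n) z) + K z.1 * (D 2%N 0%N z - ucut (v n) z).
    by rewrite /f /fn; ring.
  apply: le_trans (ler_normD _ _) _; rewrite lerD// normrM ler_wpM2r//.
  by apply: norm_kern; case/andP: h.
apply/eqP; rewrite -normr_le0 leNgt; apply/negP => p0.
have /cvgrPdist_lt/(_ _ p0)[N _ HN] := m0; have := HN N (leqnn N); rewrite /= sub0r normrN => lt.
by move: (le_lt_trans (le_trans (bound N) (ler_norm (m N))) lt); rewrite ltxx.
Qed.

(** Up to a factor, the average of [f] in the first variable is the trace of the first derivative,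
    and the average of [g] is that of the mixed derivative. The latter is the weak derivative of
    the former, which annihilates all bumps by [slice_zero]. In the application [u] and [v] are
    the derivatives $\partial_1\phi_n$ and $\partial_{11}\phi_n$ of test functions. *)
Lemma boundary_vertical y : a2 <= y <= b2 -> trep a1 b1 a2 b2 D 1 1 (x0, y) = 0.
Proof.
have ct := @continuous_line2 _ _ x0 (continuous_trep ab1 ab2 tD (i := 1%N) (j := 1%N) isT).
move: y; apply: (continuous_ae0 ab2 ct).
have of2 : off2 a1 b1 a2 b2 f.
  by apply: off2_add => //; exact: (off2_mul (fun z => K z.1)).
have og2 : off2 a1 b1 a2 b2 g.
  by apply: off2_add => //; exact: (off2_mul (fun z => K z.1)).
have wfg : weaky a1 b1 a2 b2 f g.
  have r20 := rintegrable_kern1 x0 s20 o20; have r21 := rintegrable_kern1 x0 s21 o21.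
  have w1 := tower_weaky tD (i := 1%N) (j := 0%N) isT.
  have w2 := weaky_kern1 x0 s20 s21 o20 o21 (tower_weaky tD (i := 2%N) (j := 0%N) isT).
  exact: (weaky_add s10 s11 r20 r21 w1 w2).
have w1 := weaky_marginal sf sg of2 og2 wfg.
have G0 : {ae mu1, forall y, \int[mu1]_s g (s, y) = 0}.
  apply: (@bump_fundamental _ a2 b2 _ (rintegrable_fubini2 sg)).
    move=> y y12; rewrite (@eq_rint _ _ _ mu1 _ (fun=> 0)); first by rewrite Rintegral_cst ?mul0r.
    by move=> s; rewrite og2// negb_and y12 orbT.
  move=> eta be; have be' := bump_derive1 be.
  have [k Hk] := bump_bounded be'.
  apply/eqP; rewrite -oppr_eq0 -w1//; apply/eqP.
  rewrite -[RHS](slice_zero be') (rfubini_mul2 (bump_measurable be') Hk sf).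
  by apply: eq_rint => y; rewrite mulrC.
have tv := trep_vertical ab2 tD (i := 1%N) (j := 1%N) isT x0.
apply: (@filterS2 _ _ (ae_filter_ringOfSetsType mu1) _ _ _ _ tv G0) => y -> Gy.
by rewrite [X in _ * (_ * X)]Gy !mulr0.
Qed.

End BoundaryTrace.

(** * Approximation by test functions *)

Section Approximation.
Variable R : realType.
Notation mu1 := (@lebesgue_measure R).
Notation mu2 := (mu1 \x mu1)%E.
Implicit Types (f g v p : R * R -> R) (z c : R * R) (T : {fset (R * R)}).

Notation ebox h c := (box (c.1 - h) (c.1 + h) (c.2 - h) (c.2 + h)).
Notation ecut h c := (cut (c.1 - h) (c.1 + h) (c.2 - h) (c.2 + h)).
Notation classical i j p := (iter j (@partial2 R) (iter i (@partial1 R) p)).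

(** Needed to compare the $H^2$ norm on the domain, defined by weak derivatives that are only
    locally integrable, with integrals over elements. *)
Lemma loc_integrable_measurable_open (U : set (R * R)) g : open U -> loc_integrable U g ->
  measurable_fun U g.
Proof.
move=> oU lg; pose P (V : set (R * R)) := measurable V /\ measurable_fun V g.
suff [] : P U by [].
apply: (open_induction oU).
- by split; [exact: measurable0|exact: measurable_fun_set0].
- move=> a1 b1 a2 b2 bU; split; first exact: measurable_box.
  exact: (loc_integrable_measurable (loc_integrableS bU lg)).
- move=> F hF; have mF n : measurable (F n) by have [] := hF n.
  split; first exact: bigcup_measurable.
  by apply/(measurable_fun_bigcup _ mF) => n; have [] := hF n.
Qed.

Lemma continuous_transpose f : continuous f -> continuous (transpose f).
Proof.
move=> cf z; apply: (@continuous_comp _ _ _ (fun z : R * R => (z.2, z.1)) f z); last exact: cf.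
by apply: (@cvg_pair _ _ _ (nbhs z) (nbhs z.2) (nbhs z.1)); [exact: cvg_snd|exact: cvg_fst].
Qed.

Lemma cvg0_sqr (x r : nat -> R) (k : R) : (forall n, 0 <= x n) -> (forall n, x n ^+ 2 <= k * r n) ->
  r n @[n --> \oo] --> 0 -> x n @[n --> \oo] --> 0.
Proof.
move=> x0 xr r0; have kr0 : k * r n @[n --> \oo] --> 0.
  by rewrite -(mulr0 k); apply: cvgMr.
apply/cvgrPdist_lt => e e0; have e2 : 0 < e ^+ 2 by rewrite exprn_gt0.
have /cvgrPdist_lt/(_ _ e2) := kr0; apply: filterS => n.
rewrite !sub0r !normrN (ger0_norm (x0 n)) => h.
rewrite -(ltr_pXn2r (n := 2))// ?nnegrE ?(ltW e0)//.
exact: le_lt_trans (xr n) (le_lt_trans (ler_norm _) h).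
Qed.

Variables (Omega : set (R * R)) (w : R * R -> R) (D : nat -> nat -> R * R -> R).
Hypothesis oO : open Omega.
Hypothesis wD : forall i j, (i + j <= 4)%N -> is_weak_deriv Omega (i, j) w (D i j).
Hypothesis lD : forall i j, (i + j <= 4)%N -> L2 Omega (D i j).
Variable phi : nat -> R * R -> R.
Hypothesis tphi : forall n, test_function Omega (phi n).
Hypothesis cphi : Hk_sqnorm Omega 2 (w \- phi n) @[n --> \oo] --> 0%E.

Lemma test_classical i j n : test_function Omega (classical i j (phi n)).
Proof. exact/test_iter_partial2/test_iter_partial1. Qed.

Let rintegrable_error (h : R) c (i j n : nat) : (i + j <= 2)%N -> ebox h c `<=` Omega ->
  rintegrable mu2 (fun z => ecut h c (D i j) z - ecut h c (classical i j (phi n)) z).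
Proof.
move=> ij bO; have ij4 : (i + j <= 4)%N by exact: leq_trans ij _.
have [iD _] := L2_integrable_box oO bO (lD ij4).
have cq := test_continuous (test_classical i j n).
have r1 := rintegrable_cut iD.
have r2 := @rintegrable_cut_continuous R (c.1 - h) (c.1 + h) (c.2 - h) (c.2 + h) _ cq.
by apply: rintegrableB; [exact: r1|exact: r2].
Qed.

Let ae_sqnorm (h : R) c i j n (ij : (i + j <= 2)%N) : 0 < h -> ebox h c `<=` Omega ->
  rintegrable mu2 (fun z => (ecut h c (D i j) z - ecut h c (classical i j (phi n)) z) ^+ 2) /\
  ((\int[mu2]_z ((ecut h c (D i j) z - ecut h c (classical i j (phi n)) z) ^+ 2))%:E <=
   Hk_sqnorm Omega 2 (w \- phi n)%R)%E.
Proof.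
move=> h0 bO; have ij4 : (i + j <= 4)%N by exact: leq_trans ij _.
have mb := @measurable_box R (c.1 - h) (c.1 + h) (c.2 - h) (c.2 + h).
have mO := open_measurable2 oO.
pose q := classical i j (phi n); pose gn z := D i j z - q z.
have cq : continuous q by exact: test_continuous (test_classical i j n).
have E z : ecut h c (D i j) z - ecut h c q z = ecut h c gn z by rewrite /cut /gn mulrBr.
have [_ sD2] := L2_integrable_box oO bO (lD ij4).
have sq2 : rintegrable mu2 (fun z => q z ^+ 2).
  have [_ [A [cA _ q0]]] := test_classical i j n.
  apply: (rintegrable_Cc cA).
    by move=> z; apply: (@continuous_comp _ _ _ q (fun t => t ^+ 2)); [exact: cq|exact: exprn_continuous].
  by move=> z /q0 Eq; rewrite /q Eq expr0n.
have [iD _] := L2_integrable_box oO bO (lD ij4).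
have mg : measurable_fun setT (ecut h c gn).
  have m1 := rintegrable_meas (rintegrable_cut iD).
  have m2 : measurable_fun setT (ecut h c q).
    have := rintegrable_meas (rintegrable_inbox (c.1 - h) (c.1 + h) (c.2 - h) (c.2 + h)).
    by move=> mi; apply: measurable_funM; [exact: mi|exact: continuous_measurable2].
  rewrite (_ : ecut h c gn = fun z => ecut h c (D i j) z - ecut h c q z); last first.
    by apply/funext => z; rewrite E.
  exact: measurable_funB.
have sg2 : rintegrable mu2 (fun z => ecut h c gn z ^+ 2).
  have sB := rintegrableD (rintegrableZ 2 sD2) (rintegrableZ 2 sq2).
  have mg2 : measurable_fun setT (fun z => ecut h c gn z ^+ 2) by exact: measurable_funX.
  suff H z : `|ecut h c gn z ^+ 2| <= 2 * ecut h c (D i j) z ^+ 2 + 2 * q z ^+ 2.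
    by apply: rintegrable_le sB H; exact: mg2.
  rewrite ger0_norm ?sqr_ge0// -E /cut /inbox.
  case: (_ && _) => /=; last by rewrite !mul0r subrr expr0n mulr0 add0r mulr_ge0// sqr_ge0.
  rewrite !mul1r; have := sqr_ge0 (D i j z + q z); move: (D i j z) (q z) => x y.
  by rewrite sqrrD sqrrB; lra.
have FE : (fun z => (ecut h c (D i j) z - ecut h c q z) ^+ 2) = fun z => ecut h c gn z ^+ 2.
  by apply/funext => z; rewrite E.
rewrite -/q FE; split=> //.
pose W := wderiv Omega (i, j) (w \- phi n).
have wd : is_weak_deriv Omega (i, j) (w \- phi n) gn.
  apply: weak_derivB; first exact: wD.
  by apply: weak_deriv_Ck; have [k _] := tphi n; exact: k.
have wW : is_weak_deriv Omega (i, j) (w \- phi n) W by apply: wderivP; exists gn.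
have mW : measurable_fun Omega W.
  by apply: loc_integrable_measurable_open => //; case: wW.
have mW2 : measurable_fun Omega (fun z => (W z ^+ 2)%:E).
  by apply/measurable_EFinP; exact: measurable_funX.
have step1 : ((\int[mu2]_z (ecut h c gn z ^+ 2))%:E <= \int[mu2]_(z in Omega) (W z ^+ 2)%:E)%E.
  have fin : (\int[mu2]_z (ecut h c gn z ^+ 2)%:E)%E \is a fin_num by exact: integrable_fin_num sg2.
  rewrite /Rintegral fineK//.
  apply: (@le_trans _ _ (\int[mu2]_(z in ebox h c) (W z ^+ 2)%:E)%E); last first.
    by apply: ge0_subset_integral => // z _; rewrite lee_fin sqr_ge0.
  rewrite [leRHS]integral_mkcond le_eqVlt; apply/orP; left; apply/eqP.
  apply: ae_eq_integral => //.
  - by apply/measurable_EFinP; exact: measurable_funX.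
  - apply: (measurable_restrictT _ mb).1.
    exact: (measurable_funS mO bO mW2).
  apply: (@filterS _ _ (ae_filter_ringOfSetsType mu2) _ _ _ (weak_deriv_unique bO wd wW)) => z hz _.
  rewrite patchE; case: ifPn.
    by rewrite inE => zb; rewrite cutE// hz.
  by rewrite notin_setE => zb; rewrite cut_off ?expr0n//; apply/negP => /boxE.
apply: le_trans step1 _; rewrite /Hk_sqnorm.
have i3 : (i < 3)%N by rewrite ltnS (leq_trans _ ij)// leq_addr.
have j3 : (j < 3)%N by rewrite ltnS (leq_trans _ ij)// leq_addl.
have I0 (a : multi_index) : (0 <= \int[mu2]_(z in Omega) ((wderiv Omega a (w \- phi n)%R z) ^+ 2)%:E)%E.
  by apply: integral_ge0 => z _; rewrite lee_fin sqr_ge0.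
rewrite (bigD1 (Ordinal i3))//= (bigD1 (Ordinal j3))//= -/W -addeA leeDl// adde_ge0//.
  by apply: sume_ge0 => k _.
by apply: sume_ge0 => k _; apply: sume_ge0 => l _.
Qed.

(** Each term of the $H^2$ norm bounds an $L^2$ norm on the element, hence an $L^1$ norm. *)
Lemma cvg_test (h : R) c i j : (i + j <= 2)%N -> 0 < h -> ebox h c `<=` Omega ->
  \int[mu2]_z `|ecut h c (D i j) z - ecut h c (classical i j (phi n)) z| @[n --> \oo] --> (0 : R).
Proof.
move=> ij h0 bO; pose gn n z := ecut h c (D i j) z - ecut h c (classical i j (phi n)) z.
have sgn n : rintegrable mu2 (gn n) by exact: rintegrable_error.
have ogn n : off2 (c.1 - h) (c.1 + h) (c.2 - h) (c.2 + h) (gn n).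
  by move=> z hz; rewrite /gn !cut_off// subrr.
apply: (@cvg0_sqr _ (fun n => \int[mu2]_z (gn n z ^+ 2)) (4 * h ^+ 2)).
- by move=> n; exact: (momN_ge0 (gn n)).
- move=> n; have [s2 _] := ae_sqnorm n ij h0 bO.
  exact: (momN_sq h0 (sgn n) s2 (ogn n)).
have /fine_cvgP[fin cv0] := cphi.
apply: (@squeeze_cvgr _ _ _ _ (fun=> 0) (fine \o (fun n => Hk_sqnorm Omega 2 (w \- phi n)))) => //; last exact: cvg_cst.
apply: filterS fin => n fn; have [s2 le2] := ae_sqnorm n ij h0 bO.
apply/andP; split; first by apply: Rintegral_ge0 => z _; exact: sqr_ge0.
by move: le2; rewrite -[X in (_ <= X)%E](fineK fn) lee_fin.
Qed.

Variables (h : R) (T : {fset (R * R)}).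
Hypothesis mT : square_mesh Omega h T.
Let h0 : 0 < h. Proof. by case: mT. Qed.
Let bO c (cT : c \in T) : ebox h c `<=` Omega := mesh_sub mT cT.
Let lt (x : R) : x - h < x + h. Proof. by rewrite ltrBlDr -addrA ltrDl addr_gt0. Qed.
Let endpoint (x : R) (b : bool) : x + (-1) ^+ b * h = x - h \/ x + (-1) ^+ b * h = x + h.
Proof. by case: b; [left; rewrite expr1 mulN1r|right; rewrite expr0 mul1r]. Qed.
Let inside (x : R) (b : bool) : x - h <= x + (-1) ^+ b * h <= x + h.
Proof. by have hh := ltW h0; case: b; rewrite ?expr1 ?expr0; apply/andP; split; lra. Qed.

Lemma vertical_zero c (b b2 : bool) : c \in T -> c + ((-1) ^+ b * (2 * h), 0) \notin T ->
  vertex_value D h c 1 1 b b2 = 0.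
Proof.
move=> cT ce; rewrite /vertex_value /corner /elt_vertex.
have tD := mesh_tower oO wD lD (bO cT).
apply: (@boundary_vertical _ _ _ _ _ _ _ (fun n => partial1 (phi n))
  (fun n => partial1 (partial1 (phi n))) (lt _) (lt _) tD (endpoint _ _)).
- by move=> n; exact: test_continuous (test_partial1 (tphi n)).
- by move=> n; exact: test_continuous (test_partial1 (test_partial1 (tphi n))).
- by move=> n z; have [k _] := test_partial1 (tphi n); exact: Ck_derive1 (k 1%N).
- move=> n y hy; apply: (test_off (test_partial1 (tphi n))).
  exact: (vedge_outside mT cT ce hy).
- exact: (cvg_test (i := 1%N) (j := 0%N) isT h0 (bO cT)).
- exact: (cvg_test (i := 2%N) (j := 0%N) isT h0 (bO cT)).
- exact: inside.
Qed.

(** This is [boundary_vertical] for the transposed derivatives. *)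
Lemma horizontal_zero c (b1 b : bool) : c \in T -> c + (0, (-1) ^+ b * (2 * h)) \notin T ->
  vertex_value D h c 1 1 b1 b = 0.
Proof.
move=> cT ce; rewrite /vertex_value /corner /elt_vertex.
have tD := mesh_tower oO wD lD (bO cT).
rewrite -(rep_transposed tD (i := 1%N) (j := 1%N) isT) /=.
pose L i n := \int[mu2]_z `|transposeD (fun i j => ecut h c (D i j)) i 0 z -
    cut (c.2 - h) (c.2 + h) (c.1 - h) (c.1 + h) (transpose (iter i (@partial2 R) (phi n))) z|.
have cvgT i : (0 + i <= 2)%N -> L i n @[n --> \oo] --> (0 : R).
  move=> i2; have C := cvg_test i2 h0 (bO cT).
  suff -> : L i = fun n => \int[mu2]_z `|ecut h c (D 0%N i) z - ecut h c (classical 0 i (phi n)) z| by [].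
  apply/funext => n; rewrite /L.
  have iD : rintegrable mu2 (fun z => ecut h c (D 0%N i) z - ecut h c (classical 0 i (phi n)) z).
    exact: (rintegrable_error n i2 (bO cT)).
  rewrite -(rint_transpose (rintegrable_norm iD)); apply: eq_rint => z.
  by rewrite /transposeD /transpose /cut /inbox /= andbC.
apply: (@boundary_vertical _ _ _ _ _ _ _ (fun n => transpose (partial2 (phi n)))
  (fun n => transpose (partial2 (partial2 (phi n)))) (lt _) (lt _) (tower_transpose tD) (endpoint _ _)).
- by move=> n; apply: continuous_transpose; exact: test_continuous (test_partial2 (tphi n)).
- by move=> n; apply: continuous_transpose; exact: test_continuous (test_partial2 (test_partial2 (tphi n))).
- by move=> n z; have [k _] := test_partial2 (tphi n); exact: (Ck_derive2 (z.2, z.1) (k 1%N)).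
- move=> n y hy; apply: (test_off (test_partial2 (tphi n))).
  exact: (hedge_outside mT cT ce hy).
- exact: (cvgT 1%N isT).
- exact: (cvgT 2%N isT).
- exact: inside.
Qed.

Lemma mesh_bound :
  L2_inner Omega (hess_h h T (w \- Pi_h h T w)) (hess_h h T (Pi_h h T w)) <=
  324 * domain_energy Omega D * (h * (1 + h)) * h ^+ 2.
Proof.
apply: (mesh_estimate oO wD lD mT) => c b cT ce.
- by apply: vertical_zero => //; rewrite expr0 mul1r.
- apply: vertical_zero => //; apply: contra ce; rewrite (_ : c + _ = c - (2 * h, 0))//.
  by rewrite [LHS]surjective_pairing [RHS]surjective_pairing; congr (_, _); rewrite /= ?expr1; ring.
- by apply: horizontal_zero => //; rewrite expr0 mul1r.
- apply: horizontal_zero => //; apply: contra ce; rewrite (_ : c + _ = c - (0, 2 * h))//.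
  by rewrite [LHS]surjective_pairing [RHS]surjective_pairing; congr (_, _); rewrite /= ?expr1; ring.
Qed.

End Approximation.

(** * The estimate on the domain *)

Section Data.
Variable R : realType.

Lemma exists_derivatives (Omega : set (R * R)) (w : R * R -> R) : in_Hk Omega 4 w ->
  exists D : nat -> nat -> R * R -> R, forall i j, (i + j <= 4)%N ->
    is_weak_deriv Omega (i, j) w (D i j) /\ L2 Omega (D i j).
Proof.
move=> [_ hw]; pose S i j : set (R * R -> R) := [set g | is_weak_deriv Omega (i, j) w g /\ L2 Omega g].
exists (fun i j => xget (fun=> 0) (S i j)) => i j ij.
have [g hg] := hw (i, j) ij; have : S i j (xget (fun=> 0) (S i j)) by case: xgetP => // /(_ g).
by [].
Qed.

Lemma cvg_rate (H : set R) (k : R) : k * (h * (1 + h)) @[h --> within H 0^'+] --> 0.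
Proof.
have c0 : {for (0 : R), continuous (fun h : R => k * (h * (1 + h)))}.
  apply: cvgMr; apply: cvgM; first exact: cvg_id.
  by apply: cvgD; [exact: cvg_cst|exact: cvg_id].
have {}c0 : (fun h : R => k * (h * (1 + h))) @ nbhs (0 : R) --> (0 : R).
  by move: c0; rewrite /prop_for /continuous_at mul0r mulr0.
move=> A /c0 hA.
have : nbhs (0 : R) (fun h : R => 0 < h -> H h -> A (k * (h * (1 + h)))).
  by apply: (@filterS _ _ (nbhs_filter (0 : R)) _ _ _ hA) => h Ah _ _; exact: Ah.
by [].
Qed.

End Data.

Theorem lemma2p3 (R : realType) (Omega : set (R * R)) (H : set R)
    (T : R -> {fset (R * R)}) (w : R * R -> R)
    (meshT : forall h, H h -> square_mesh Omega h (T h))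
    (w0 : in_Hk0 Omega 2 w) (w4 : in_Hk Omega 4 w) :
  exists alpha : R -> R,
    alpha h @[h --> within H 0^'+] --> 0 /\
    forall h, H h ->
      L2_inner Omega (hess_h h (T h) (w \- Pi_h h (T h) w))
                     (hess_h h (T h) (Pi_h h (T h) w)) <= alpha h * h ^+ 2.
Proof.
have [D hD] := exists_derivatives w4.
have wD i j : (i + j <= 4)%N -> is_weak_deriv Omega (i, j) w (D i j) by move=> /hD[].
have lD i j : (i + j <= 4)%N -> L2 Omega (D i j) by move=> /hD[].
have [_ [phi [tphi cphi]]] := w0.
exists (fun h => 324 * domain_energy Omega D * (h * (1 + h))); split; first exact: cvg_rate.
move=> h Hh; have mT := meshT h Hh.
exact: (mesh_bound (mesh_open mT) wD lD tphi cphi mT).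
Qed.
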